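(* Let $V(z)=\gamma+\int_0^\infty\frac{d\sigma(t)}{t-z}$ be a scalar function of the class $S_0(R)$, and suppose that $\sigma(t)$ is the distribution function of an operator pair $\tilde B_\theta$, $\tilde B$ in $L_2[a,+\infty)$, where $\tilde By=-y''+q(x)y$, $y(a)=y'(a)=0$, and $\tilde B_\theta y=-y''+q(x)y$, $y'(a)=\theta y(a)$, is a positive self-adjoint extension of $\tilde B$. Let $\Theta$ be the unique rigged canonical system with Schrödinger operator $T_h$ ($\operatorname{Im}h>0$) realizing $V$, i.e. $V(z)=V_\Theta(z)$. Then the system $\Theta$ is accretive, and its symmetric operator $A$ ($Ay=-y''+q(x)y$, $y(a)=y'(a)=0$) is such that its Krein–von Neumann extension $A_K$ does not coincide with its Friedrichs extension $A_F$.
   Context: Class $S_0(R)$ (scalar): functions $V(z)=\gamma+\int_0^\infty\frac{d\sigma(t)}{t-z}$ with $\gamma\ge0$ and $\sigma$ non-decreasing on $[0,+\infty)$ with $\int_0^\infty\frac{d\sigma(t)}{1+t}<\infty$ and $\int_0^\infty d\sigma(t)=\infty$. Differential operators: $q$ is a real locally summable function on $[a,+\infty)$, $l(y)=-y''+q(x)y$, and $D^*$ is the set of $y\in L_2[a,+\infty)$ that are locally absolutely continuous together with $y'$ and satisfy $l(y)\in L_2[a,+\infty)$. All operators act as $l$ on the elements of $D^*$ satisfying the indicated boundary condition; $T_hy=l(y)$, $y'(a)=hy(a)$. The symmetric operator $\tilde B$ has deficiency indices $(1,1)$; $\theta$ is real. Distribution function of the pair: a non-decreasing $\sigma$ on $[0,+\infty)$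 is the distribution function of the pair $\tilde B_\theta,\tilde B$ if there is an isometric one-to-one correspondence $U$ of $L_2[a,+\infty)$ onto $L_2^\sigma[0,+\infty)$ under which $\tilde B_\theta$ is unitarily equivalent to the multiplication operator $\Lambda_\sigma\varphi(\lambda)=\lambda\varphi(\lambda)$, while $\tilde B$ is unitarily equivalent to the restriction $\Lambda^0_\sigma$ of $\Lambda_\sigma$ to those $\varphi$ in its domain with $\int_0^\infty\varphi\,d\sigma=0$. Realizing system: $\mathcal H=L_2[a,+\infty)$, $\mathcal H_+=D^*$ with $(y,z)_+=\int_a^\infty(y\bar z+l(y)\overline{l(z)})\,dx$, and $\mathcal H_+\subset\mathcal H\subset\mathcal H_-$ is the corresponding rigged space; $\delta(x-a),\delta'(x-a)\in\mathcal H_-$ act by $(y,\delta(x-a))=y(a)$, $(y,\delta'(x-a))=-y'(a)$. The system is $$\Theta=\begin{pmatrix}\mathbb A&K&1\\ \mathcal H_+\subset L_2[a,+\infty)\subset\mathcal H_-&&\mathbb C\end{pmatrix}$$ with, for some $h$, $\operatorname{Im}h>0$, and $\mu\in[-\infty,+\infty]$, $$\mathbb Ay=-y''+qy-\tfrac{1}{\mu-h}[y'(a)-hy(a)][\mu\delta(x-a)+\delta'(x-a)],\qquad Kc=cg,\quad g=\tfrac{(\operatorname{Im}h)^{1/2}}{|\mu-h|}[\mu\delta(x-a)+\delta'(x-a)],$$ (limits taken when $\mu=\pm\infty$), and $V_\Theta(z)=K^*(\operatorname{Re}\mathbb A-zI)^{-1}K$, $\operatorname{Re}\mathbb A=\frac12(\mathbb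 A+\mathbb A^* )$. It is known that under the stated hypotheses such a system with $V=V_\Theta$ exists and is unique. The symmetric operator $A$ of the system is $\tilde B$. The system is accretive if its main operator $\mathbb A$ is accretive, i.e. $(\operatorname{Re}\mathbb Ay,y)\ge0$ for all $y\in\mathcal H_+$. $A_K$ and $A_F$ are the Krein–von Neumann and Friedrichs extensions (the smallest and largest nonnegative self-adjoint extensions) of the nonnegative operator $A$; explicitly, $A_F$ is given by $l(y)$ with $y(a)=0$. *)

(* Defs.v *)
From HB Require Import structures.
From mathcomp Require Import all_boot all_order all_algebra.
From mathcomp Require Import complex.
From mathcomp Require Import all_classical all_reals all_analysis.
Import Order.TTheory GRing.Theory Num.Theory.
Import numFieldNormedType.Exports.
Import ComplexField.Normc.

Set Implicit Arguments.
Unset Strict Implicit.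
Unset Printing Implicit Defensive.

Local Open Scope classical_set_scope.
Local Open Scope complex_scope.
Local Open Scope ring_scope.

(** * Stieltjes integrals on the half-line *)

Record nondecr_halfline (R : realType) := NondecrHalfline {
  nd_fun :> R -> R ;
  nd_funP : {in `[0, +oo[ &, {homo nd_fun : s t / s <= t}} }.

(* [stieltjes_reg s t] is [s(t+)] for [0 <= t] and [s 0] for [t < 0]: its
   Lebesgue-Stieltjes measure is the measure [ds] of the classical Stieltjes
   integrals over the closed half-line, with mass [s(0+) - s(0)] at 0. *)
Definition stieltjes_reg (R : realType) (s : nondecr_halfline R) (t : R) : R :=
  inf [set s u | u in [set u | 0 <= u /\ t < u]].

Section StieltjesReg.
Context {R : realType} (s : nondecr_halfline R).

Let above t := [set s u | u in [set u | 0 <= u /\ t < u]].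

Let above_inf t : has_inf (above t).
Proof.
split.
  exists (s (Num.max 0 (t + 1))), (Num.max 0 (t + 1)) => //=; split.
    by rewrite le_max lexx.
  by rewrite lt_max ltrDl ltr01 orbT.
exists (s 0) => _ [u [u0 _] <-].
by apply: nd_funP => //; rewrite in_itv /= ?lexx ?u0.
Qed.

Lemma stieltjes_reg_nondecreasing : nondecreasing (stieltjes_reg s).
Proof.
move=> x y xy; apply: lb_le_inf; first by have [] := above_inf y.
move=> _ [u [u0 yu] <-]; apply: ge_inf; first by have [] := above_inf x.
by exists u => //; split => //; exact: le_lt_trans yu.
Qed.

Lemma stieltjes_reg_right_continuous : right_continuous (stieltjes_reg s).
Proof.
move=> x; apply/cvgrPdist_lt => e e0.
have [_ [u [u0 xu] <-] su] := inf_adherent e0 (above_inf x).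
near=> t.
have xt : x <= t by near: t; apply: nbhs_right_ge.
have tu : t < u by near: t; apply: nbhs_right_lt.
rewrite distrC ger0_norm ?subr_ge0 ?stieltjes_reg_nondecreasing//.
rewrite ltrBlDl; apply: le_lt_trans su.
by apply: ge_inf; [have [] := above_inf t|exists u].
Unshelve. all: by end_near. Qed.

HB.instance Definition _ := isCumulative.Build R _ R (stieltjes_reg s)
  stieltjes_reg_nondecreasing stieltjes_reg_right_continuous.

End StieltjesReg.

Definition stieltjes_measure (R : realType) (s : nondecr_halfline R) :
    {measure set (measurableTypeR R) -> \bar R} :=
  lebesgue_stieltjes_measure (stieltjes_reg s).

(** * Complex L^2 spaces and operators in them *)

Section L2.
Context {R : realType}.
Variables (m : {measure set (measurableTypeR R) -> \bar R}) (D : set R).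

Definition cintegral (f : R -> R[i]) : R[i] :=
  Rintegral m D (fun x => complex.Re (f x))
    +i* Rintegral m D (fun x => complex.Im (f x)).

Definition L2 (f : R -> R[i]) : Prop :=
  [/\ measurable_fun (D : set (measurableTypeR R)) (fun x => complex.Re (f x)),
      measurable_fun (D : set (measurableTypeR R)) (fun x => complex.Im (f x)) &
      (\int[m]_(x in D) ((normc (f x)) ^+ 2)%:E < +oo)%E].

Definition aeq (f g : R -> R[i]) : Prop := {ae m, forall x, D x -> f x = g x}.

Definition ip (f g : R -> R[i]) : R[i] := cintegral (fun x => f x * (g x)^*%C).

(* An operator is given by its graph: [T y f] means that [y] is in the domain
   of [T] and [T y = f]. *)
Definition operator := (R -> R[i]) -> (R -> R[i]) -> Prop.

Definition densely_defined (T : operator) : Prop :=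
  forall f, L2 f -> forall e : R, 0 < e -> exists y g,
    T y g /\ (\int[m]_(x in D) ((normc (f x - y x)) ^+ 2)%:E < e%:E)%E.

Definition adjoint (T : operator) : operator := fun z g =>
  [/\ L2 z, L2 g & forall y f, T y f -> ip f z = ip y g].

Definition extends (S T : operator) : Prop := forall y f, T y f -> S y f.

Definition symmetric_op (T : operator) : Prop :=
  densely_defined T /\ extends (adjoint T) T.

Definition selfadjoint (T : operator) : Prop :=
  densely_defined T /\ (forall y f, T y f <-> adjoint T y f).

Definition nonnegative (T : operator) : Prop :=
  forall y f, T y f -> 0 <= ip f y.

(* The orthogonal complement of the range of [T - z]. *)
Definition defect_space (T : operator) (z : R[i]) (f : R -> R[i]) : Prop :=
  L2 f /\ forall y g, T y g -> ip (fun x => g x - z * y x) f = 0.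

Definition one_dimensional (N : (R -> R[i]) -> Prop) : Prop :=
  exists e, [/\ L2 e, ~ aeq e (fun=> 0) &
    forall f, L2 f -> (N f <-> exists c : R[i], aeq f (fun x => c * e x))].

Definition deficiency_indices_1_1 (T : operator) : Prop :=
  one_dimensional (defect_space T 'i%C) /\
  one_dimensional (defect_space T (- 'i%C)).

(* The order [S1 <= S2] of nonnegative self-adjoint operators, i.e.
   [(S2 + c)^-1 <= (S1 + c)^-1] for every [c > 0]. *)
Definition op_le (S1 S2 : operator) : Prop :=
  forall (c : R) f u v, 0 < c ->
    S1 u (fun x => f x - c%:C * u x) -> S2 v (fun x => f x - c%:C * v x) ->
    ip v f <= ip u f.

Definition nonneg_sa_extension (A S : operator) : Prop :=
  [/\ selfadjoint S, nonnegative S & extends S A].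

Definition krein_von_neumann (A S : operator) : Prop :=
  nonneg_sa_extension A S /\
  forall S', nonneg_sa_extension A S' -> op_le S S'.

Definition friedrichs (A S : operator) : Prop :=
  nonneg_sa_extension A S /\
  forall S', nonneg_sa_extension A S' -> op_le S' S.

End L2.

(** * The Schroedinger expression on [a, +oo[ *)

Section Schrodinger.
Context {R : realType}.
Implicit Types (a : R) (q : R -> R) (f : R -> R[i]).

Definition locally_summable a q : Prop :=
  forall b, lebesgue_measure.-integrable `[a, b] (EFin \o q).

Definition absolutely_continuous f (s t : R) : Prop :=
  forall e : R, 0 < e -> exists2 d : R, 0 < d & forall I : seq (R * R),
    all (fun u => (s <= u.1) && (u.1 <= u.2) && (u.2 <= t)) I ->
    pairwise (fun u v => (u.2 <= v.1) || (v.2 <= u.1)) I ->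
    \sum_(u <- I) (u.2 - u.1) < d ->
    \sum_(u <- I) normc (f u.2 - f u.1) < e.

Definition locally_absolutely_continuous a f : Prop :=
  forall b, absolutely_continuous f a b.

(* Derivative at [x] of [f] restricted to [a, +oo[ (one-sided at [a]). *)
Definition has_derivative a f (x : R) (l : R[i]) : Prop :=
  let quot (p : R[i] -> R) := fun t : R => (p (f t) - p (f x)) / (t - x) in
  quot (@complex.Re R) @ within `[a, +oo[ x^' --> complex.Re l /\
  quot (@complex.Im R) @ within `[a, +oo[ x^' --> complex.Im l.

Definition L2a a := L2 (@lebesgue_measure R) `[a, +oo[.
Definition aeqa a := aeq (@lebesgue_measure R) `[a, +oo[.
Definition ipa a := ip (@lebesgue_measure R) `[a, +oo[.

(* The space [D^* = H_+]. An element carries its first derivative and an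
   almost everywhere version of its second one; [lexpr] is then [l(y)]. *)
Record Dstar a q := MkDstar {
  dval :> R -> R[i] ;
  dval' : R -> R[i] ;
  dval'' : R -> R[i] ;
  lexpr := fun x => - dval'' x + (q x)%:C * dval x ;
  dstar_L2 : L2a a dval ;
  dstar_ac : locally_absolutely_continuous a dval ;
  dstar_deriv : forall x, a <= x -> has_derivative a dval x (dval' x) ;
  dstar_ac' : locally_absolutely_continuous a dval' ;
  dstar_deriv' : {ae @lebesgue_measure R, forall x, a <= x ->
                    has_derivative a dval' x (dval'' x)} ;
  dstar_lL2 : L2a a lexpr }.

(* The operator [y |-> l(y)] on the elements of [D^*] whose boundary data
   [(y a, y' a)] satisfy [bc]. *)
Definition schrodinger_op a q (bc : R[i] -> R[i] -> Prop) : operator :=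
  fun y f => [/\ L2a a y, L2a a f & exists Y : Dstar a q,
    [/\ bc (Y a) (dval' Y a), aeqa a y Y & aeqa a f (lexpr Y)]].

Definition Btilde a q : operator :=
  schrodinger_op a q (fun u v => u = 0 /\ v = 0).

Definition Btheta a q (theta : R) : operator :=
  schrodinger_op a q (fun u v => v = theta%:C * u).

(** * Distribution functions and the class S_0(R) *)

Definition L2s (s : nondecr_halfline R) := L2 (stieltjes_measure s) `[0, +oo[.
Definition aeqs (s : nondecr_halfline R) := aeq (stieltjes_measure s) `[0, +oo[.
Definition ips (s : nondecr_halfline R) := ip (stieltjes_measure s) `[0, +oo[.

Definition mult_op (s : nondecr_halfline R) : operator := fun phi psi =>
  [/\ L2s s phi, L2s s psi & aeqs s psi (fun t => t%:C * phi t)].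

Definition mult_op0 (s : nondecr_halfline R) : operator := fun phi psi =>
  mult_op s phi psi /\ cintegral (stieltjes_measure s) `[0, +oo[ phi = 0.

Definition isometric_correspondence a (s : nondecr_halfline R)
    (U : (R -> R[i]) -> (R -> R[i])) : Prop :=
  [/\ forall f, L2a a f -> L2s s (U f),
      forall (c : R[i]) f g, L2a a f -> L2a a g ->
        aeqs s (U (fun x => c * f x + g x)) (fun t => c * U f t + U g t),
      forall f g, L2a a f -> L2a a g -> ips s (U f) (U g) = ipa a f g &
      forall phi, L2s s phi -> exists2 f, L2a a f & aeqs s (U f) phi].

Definition equivalent_under a (U : (R -> R[i]) -> (R -> R[i]))
    (T S : operator) : Prop :=
  forall y f, L2a a y -> L2a a f -> (T y f <-> S (U y) (U f)).

Definition distribution_function a q (theta : R) (s : nondecr_halfline R) :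
    Prop :=
  exists U, [/\ isometric_correspondence a s U,
    equivalent_under a U (Btheta a q theta) (mult_op s) &
    equivalent_under a U (Btilde a q) (mult_op0 s)].

(* In the order of [R[i]], [0 <= z] means that [z] is real and nonnegative. *)
Definition class_S0 (V : R[i] -> R[i]) (gamma : R) (s : nondecr_halfline R) :
    Prop :=
  [/\ 0 <= gamma,
      (\int[stieltjes_measure s]_(t in `[0%R, +oo[) ((1 + t)^-1)%:E < +oo)%E,
      stieltjes_measure s [set` `[0, +oo[] = +oo%E &
      forall z, ~~ (0 <= z) -> V z = gamma%:C +
        cintegral (stieltjes_measure s) `[0, +oo[ (fun t => (t%:C - z)^-1)].

(** * The rigged canonical system *)

(* An element [phi] of [H_-] is represented by the antilinear functional
   [z |-> (phi, z)] on [H_+]; equality in [H_-] is equality of functionals. *)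
Definition Hminus a q := Dstar a q -> R[i].

Definition delta a q : Hminus a q := fun z => (z a)^*%C.
Definition delta' a q : Hminus a q := fun z => - (dval' z a)^*%C.

Record schrodinger_system := SchrodingerSystem {
  sys_h : R[i] ;
  sys_mu : \bar R ;
  sys_hP : 0 < complex.Im sys_h }.

Implicit Type Th : schrodinger_system.

(* [(mu delta + delta') / (mu - h)], [delta] in the limit [mu = +oo, -oo]. *)
Definition sys_channel a q Th : Hminus a q := fun z =>
  if sys_mu Th is EFin mu then
    (mu%:C - sys_h Th)^-1 * (mu%:C * delta z + delta' z)
  else delta z.

(* [g = (Im h)^(1/2) (mu delta + delta') / |mu - h|], with its limits. *)
Definition sys_g a q Th : Hminus a q := fun z =>
  let s := Num.sqrt (complex.Im (sys_h Th)) in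
  match sys_mu Th with
  | EFin mu =>
      (s / normc (mu%:C - sys_h Th))%:C * (mu%:C * delta z + delta' z)
  | +oo%E => s%:C * delta z
  | -oo%E => - (s%:C * delta z)
  end.

(* The main operator; it extends [T_h], as the boundary term vanishes when
   [y'(a) = h y(a)]. *)
Definition sys_A a q Th (y : Dstar a q) : Hminus a q := fun z =>
  ipa a (lexpr y) z - (dval' y a - sys_h Th * y a) * sys_channel Th z.

(* [(A^* y, z) = (y, A z)]. *)
Definition sys_Aadj a q Th (y : Dstar a q) : Hminus a q := fun z =>
  (sys_A Th z y)^*%C.

Definition sys_ReA a q Th (y : Dstar a q) : Hminus a q := fun z =>
  2^-1 * (sys_A Th y z + sys_Aadj Th y z).

Definition sys_K a q Th (c : R[i]) : Hminus a q := fun z => c * sys_g Th z.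

(* [K^* y = (y, g)], since [(y, K c) = (y, g) c^*]. *)
Definition sys_Kadj a q Th (y : Dstar a q) : R[i] := (sys_g Th y)^*%C.

(* [v = K^* (Re A - z I)^-1 K 1]. [Re A] being Hermitian on [H_+], the element
   [y = (Re A - z I)^-1 K 1] is unique when [z] is not real. *)
Definition is_VTheta a q Th (z v : R[i]) : Prop :=
  exists y : Dstar a q,
    (forall w : Dstar a q,
       sys_ReA Th y w - z * ipa a y w = sys_K Th 1 w) /\
    v = sys_Kadj Th y.

Definition realizes a q Th (V : R[i] -> R[i]) : Prop :=
  forall z, complex.Im z != 0 -> is_VTheta a q Th z (V z).

Definition accretive a q Th : Prop :=
  forall y : Dstar a q, 0 <= sys_ReA Th y y.

End Schrodinger.

(* Main.v *)
Require Import Defs.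
From HB Require Import structures.
From mathcomp Require Import all_boot all_order all_algebra.
From mathcomp Require Import complex ring lra.
From mathcomp Require Import all_classical all_reals all_analysis measurable_realfun.
Import Order.TTheory GRing.Theory Num.Theory.
Import numFieldNormedType.Exports.
Import ComplexField.Normc.
Set Implicit Arguments.
Unset Strict Implicit.
Unset Printing Implicit Defensive.
Local Open Scope classical_set_scope.
Local Open Scope complex_scope.
Local Open Scope ring_scope.

(** For [y] in the domain of the maximal operator put [u = y a] and
    [w = y' a - theta * u], so that [w = 0] is the boundary condition of [Btheta].
    Under the spectral isometry [U] there is a constant [rho] with
    [U (l y) = t * U y + conj rho * w] and, up to a term [r * w] with [r] real,
    [u = rho * \int U y dsigma].  Elements concentrated near [a] with [u = 0] and
    [w = 1] have arbitrarily small norm and form, which is incompatible with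
    [r <> 0] because [\int dsigma / (1 + t) < +oo].  With [r = 0] one gets
    [(l y, y) - w * conj u = \int t * |U y|^2 dsigma >= 0].

    Put [F z = \int dsigma / (t - z)].  The equation [V_Theta z = gamma + F z] becomes
    a polynomial relation in [F z], and [F z] tends to [0] along the imaginary axis
    without vanishing, so the relation determines its coefficients.  This makes
    [y' a = theta * y a] the boundary condition of [Re A], and [(Re A y, y)] the
    nonnegative form above plus a multiple of [|w|^2] with the sign of [gamma].

    If the smallest and the largest extension coincided, [Btheta] would have the
    same resolvent form at [-1] as the Dirichlet operator, and the common extension
    would be contained in [Btilde], which is not self-adjoint. *)

(** * Absolutely continuous functions *)

Section AbsolutelyContinuous.
Context {R : realType}.
Implicit Types (f g : R -> R) (a b s t x l : R) (I : seq (R * R)).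
Local Notation mu := (@lebesgue_measure R).

(** On the domain of [Btheta] the functionals [u] and [\int U y dsigma] have the same kernel, the
    domain of [Btilde]; hence they are proportional, and [rho] is the factor. Green's formula then
    acts as a duality that carries [l] from this domain to the whole maximal domain. It cannot see
    [r]: adding a real multiple of [w] to [u] leaves Green's form unchanged, so only a quantitative
    argument removes it. If [u = 0] and [w = 1], then [rho * \int U y dsigma = r], and
    Cauchy-Schwarz with weight [t + x] bounds [|\int U y dsigma|^2] by [\int dsigma / (t + x)],
    small for large [x], times [\int (t + x) |U y|^2 dsigma], which is at most close to [- r] when
    [y] has small norm and form.

    The behaviour of [q] at infinity enters only through properties of [Btilde], and operators are
    graphs of functions up to almost everywhere equality. The vanishing of the boundary term at
    infinity, the independence of the boundary data of the representative and the description of the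
    adjoint of [Btilde] are therefore derived from symmetry, the deficiency indices and the
    isometry. *)

Definition real_ac f s t : Prop :=
  forall e : R, 0 < e -> exists2 d : R, 0 < d & forall I : seq (R * R),
    all (fun u => (s <= u.1) && (u.1 <= u.2) && (u.2 <= t)) I ->
    pairwise (fun u v => (u.2 <= v.1) || (v.2 <= u.1)) I ->
    \sum_(u <- I) (u.2 - u.1) < d ->
    \sum_(u <- I) `|f u.2 - f u.1| < e.

Definition right_derivative a f x l : Prop :=
  (fun t => (f t - f x) / (t - x)) @ within `[a, +oo[ x^' --> l.

(** Induction along a segment: the supremum of the points satisfying [P] cannot stop before [b]. The
    step crosses [c] from a nearby point on its left, since [P c] is not known at the supremum
    itself. *)
Lemma real_segment_ind (P : R -> Prop) a b : a <= b -> P a ->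
  (forall c, a <= c <= b -> exists2 r, 0 < r & forall x t,
    a <= x <= c -> c <= t <= b -> c - r < x -> t < c + r -> P x -> P t) ->
  P b.
Proof.
move=> ab Pa H; pose S := [set x | a <= x <= b /\ P x].
have supS : has_sup S.
  split; first by exists a; split => //; rewrite lexx.
  by exists b => x [/andP[]].
pose c := sup S.
have ac : a <= c by apply: ub_le_sup; [case: supS|split; rewrite ?lexx].
have cb : c <= b by apply: ge_sup; [case: supS|move=> x [/andP[]]].
have [|r r0 Hr] := H c; first by rewrite ac.
have [x [/andP[ax xb] Px] cx] := sup_adherent r0 supS.
have xc : x <= c by apply: ub_le_sup; [case: supS|split; rewrite ?ax].
have Pt t : c <= t <= b -> t < c + r -> P t.
  by move=> ctb tc; apply: (Hr x t) => //; rewrite ?ax.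
have [bc|bc] := ltP b (c + r); first by apply: Pt => //; rewrite cb lexx.
exfalso; have : c + r / 2 <= c.
  apply: ub_le_sup; first by case: supS.
  split; last by apply: Pt; lra.
  by apply/andP; split; lra.
lra.
Qed.

Lemma is_derive_right_derivative a f x l : is_derive x 1 f l ->
  right_derivative a f x l.
Proof.
move=> -[df <-].
have {}df : h^-1 *: ((f \o shift x) (h *: 1) - f x) @[h --> 0^'] --> 'D_1 f x by [].
apply/cvgrPdist_le => e e0; move/cvgrPdist_le: df => /(_ _ e0).
move=> /nbhs_ballP[r r0 rH].
apply/nbhs_ballP; exists r => // t xt tx _.
have := rH (t - x); rewrite /ball/= sub0r opprB => /(_ xt).
rewrite subr_eq0 => /(_ tx); rewrite [_%:A]mulr1 subrK.
by rewrite [_ *: _]mulrC.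
Qed.

(** The intervals are half-open so that those sharing only an endpoint are disjoint. *)
Definition ocs I : set R := \big[setU/set0]_(u <- I) `]u.1, u.2]%classic.

Lemma measurable_ocs I : measurable (ocs I).
Proof. by rewrite /ocs; apply: bigsetU_measurable. Qed.

Lemma ocsP I x : ocs I x <-> exists2 u, u \in I & u.1 < x <= u.2.
Proof.
rewrite /ocs; elim: I => [|u I IH]; first by rewrite big_nil; split => // -[].
rewrite big_cons; split => [[xu|/IH[v vI xv]]|[v]].
- by exists u; rewrite ?mem_head//; move: xu; rewrite /= in_itv.
- by exists v => //; rewrite inE vI orbT.
rewrite inE => /predU1P[->|vI] xv; first by left; rewrite /= in_itv.
by right; apply/IH; exists v.
Qed.

Lemma ocs_disjoint u I :
  all (fun v => (u.2 <= v.1) || (v.2 <= u.1)) I ->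
  [disjoint `]u.1, u.2]%classic & ocs I].
Proof.
move=> /allP uI; rewrite disj_set2E; apply/eqP; rewrite -subset0 => x [] /=.
rewrite in_itv/= => /andP[ux xu] /ocsP[v /uI /orP[] vu /andP[vx xv]].
  by move: (lt_le_trans vx xu); rewrite ltNge vu.
by move: (lt_le_trans ux xv); rewrite ltNge vu.
Qed.

Lemma measure_ocs I : all (fun u => u.1 <= u.2) I ->
  pairwise (fun u v => (u.2 <= v.1) || (v.2 <= u.1)) I ->
  mu (ocs I) = (\sum_(u <- I) (u.2 - u.1))%:E.
Proof.
elim: I => [|u I IH]; first by rewrite /ocs !big_nil measure0.
move=> /= /andP[uu Iu] /andP[uI pI].
rewrite /ocs !big_cons measureU//; last 2 first.
  exact: measurable_ocs.
  by apply/eqP; rewrite -disj_set2E; exact: ocs_disjoint.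
rewrite [X in (_ + X)%E](IH Iu pI) EFinD; congr (_ + _)%E.
rewrite /= lebesgue_measure_itv/= lte_fin; case: ltP => // uu'.
by rewrite (@le_anti _ _ u.1 u.2) ?subrr// uu uu'.
Qed.

Lemma integral_ocs (f : measurableTypeR R -> \bar R) I : all (fun u => u.1 <= u.2) I ->
  pairwise (fun u v => (u.2 <= v.1) || (v.2 <= u.1)) I ->
  (forall x, (0 <= f x)%E) -> measurable_fun setT f ->
  (\int[mu]_(x in ocs I) f x = \sum_(u <- I) \int[mu]_(x in `]u.1, u.2]) f x)%E.
Proof.
move=> + + f0 mf; elim: I => [|u I IH].
  by rewrite /ocs !big_nil integral_set0.
move=> /= /andP[uu Iu] /andP[uI pI].
rewrite /ocs !big_cons ge0_integral_setU//; last 3 first.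
  exact: measurable_ocs.
  exact: measurable_funTS.
  exact: ocs_disjoint.
by rewrite -IH.
Qed.

(** The exceptional null set is enclosed in an open set [O] of measure less than [d]. Outside it the
    increments of [f] have small slope; inside it absolute continuity makes their sum small. *)
Lemma real_ac_const f a b : a <= b -> real_ac f a b ->
  {ae mu, forall x, a <= x <= b -> right_derivative a f x 0} -> f b = f a.
Proof.
move=> ab acf [N [mN N0 subN]].
apply/eqP; rewrite -subr_eq0 -normr_eq0 eq_le normr_ge0 andbT.
apply/ler_addgt0Pr => e e0; rewrite add0r.
(* The slope allowed at good points: over the whole segment it costs at most [e / 2]. The added 1
   covers [a = b]. *)
have e10 : 0 < e / 2 / (b - a + 1) by rewrite !divr_gt0//; lra.
have [d d0 Hd] := acf _ (divr_gt0 e0 (ltr0Sn _ 1)).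
have [|O [oO NO O_d]] := lebesgue_regularity_outer mN _ d0.
  by rewrite [X in (X < _)%E]N0.
have muO : (mu O < d%:E)%E.
  rewrite -(setDUK NO) measureU//; last 2 first.
    by apply: measurableD => //; exact: open_measurable.
    by rewrite setDE setICA setICr setI0.
  by rewrite [X in (X + _)%E]N0 add0e.
(* The family [I] collects the steps taken across points of [N]; all other steps are charged to the
   slope term. *)
pose P x := exists I, [/\ all (fun u => (a <= u.1) && (u.1 <= u.2) && (u.2 <= x)) I,
    pairwise (fun u v => (u.2 <= v.1) || (v.2 <= u.1)) I, ocs I `<=` O &
    `|f x - f a| <= e / 2 / (b - a + 1) * (x - a) +
      \sum_(u <- I) `|f u.2 - f u.1|].
suff [I [aI pI IO fI]] : P b.
  apply: (le_trans fI).
  have : e / 2 / (b - a + 1) * (b - a) <= e / 2.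
    by rewrite mulrAC ler_pdivrMr; [nra|lra].
  suff : \sum_(u <- I) `|f u.2 - f u.1| < e / 2 by lra.
  apply: Hd => //; rewrite -lte_fin -measure_ocs//; last first.
    by apply: sub_all aI => u /andP[/andP[]].
  by apply: le_lt_trans muO; apply: le_measure => //; rewrite inE;
    [exact: measurable_ocs|exact: open_measurable].
apply: (@real_segment_ind P a b) => //.
  exists [::]; split => //; first by move=> x /ocsP[].
  by rewrite big_nil !subrr normr0 mulr0 addr0.
(* At a point of [N] the step from [x] to [t] stays in [O] and is added to [I]. At any other point
   the derivative is 0 and [I] is kept. *)
move=> c acb; have [cN|cN] := boolP (c \in N).
  have : nbhs c O by apply: open_nbhs_nbhs; split => //; apply: NO; rewrite inE in cN.
  move=> /nbhs_ballP[r r0 rO]; exists r => // x t /andP[ax xc] /andP[ct tb].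
  move=> xr tr [I [aI pI IO fI]]; exists ((x, t) :: I); split.
  - rewrite /= ax (le_trans xc ct) lexx/=; apply: sub_all aI => u.
    by move=> /andP[->/= /le_trans]; apply; exact: le_trans ct.
  - rewrite /= pI andbT; apply: sub_all aI => u.
    by move=> /andP[_ ->]; rewrite orbT.
  - move=> z /ocsP[u]; rewrite inE => /predU1P[->/= /andP[xz zt]|uI zu].
      by apply: rO; rewrite /ball/= ltr_norml; apply/andP; split; lra.
    by apply: IO; apply/ocsP; exists u.
  - rewrite big_cons/= addrCA.
    have -> : f t - f a = (f t - f x) + (f x - f a) by ring.
    apply: (le_trans (ler_normD _ _)); rewrite lerD2l (le_trans fI)// lerD2r.
    by rewrite ler_pM2l//; lra.
have : right_derivative a f c 0.
  apply: contrapT => nd; move/negP: cN; apply; rewrite inE; apply: subN => /=.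
  by move=> H; apply: nd; exact: H.
move=> /cvgrPdist_le /(_ _ e10); move=> /nbhs_ballP[r r0 rH].
exists r => // x t /andP[ax xc] /andP[ct tb].
have key y : a <= y -> `|c - y| < r -> `|f y - f c| <= e / 2 / (b - a + 1) * `|y - c|.
  move=> ay cy; have [->|yc] := eqVneq y c; first by rewrite !subrr !normr0 mulr0.
  have := rH y cy yc; rewrite /= in_itv/= andbT sub0r normrN => /(_ ay).
  by rewrite normrM normfV ler_pdivrMr// normr_gt0 subr_eq0.
move=> xr tr [I [aI pI IO fI]]; exists I; split => //.
  apply: sub_all aI => u.
  by move=> /andP[->/= /le_trans]; apply; exact: le_trans ct.
have -> : f t - f a = (f t - f c) - (f x - f c) + (f x - f a) by ring.
apply: (le_trans (ler_normD _ _)).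
have -> : e / 2 / (b - a + 1) * (t - a) + \sum_(u <- I) `|f u.2 - f u.1| =
  e / 2 / (b - a + 1) * (t - x) +
  (e / 2 / (b - a + 1) * (x - a) + \sum_(u <- I) `|f u.2 - f u.1|) by ring.
apply: lerD fI; apply: (le_trans (ler_normB _ _)).
have := key t; have := key x; rewrite !ler_norml !ltr_norml => kx kt.
have -> : t - x = (t - c) + (c - x) by ring.
rewrite mulrDr -(@ger0_norm _ (t - c)); last lra.
rewrite -(@ger0_norm _ (c - x)); last lra.
apply: lerD.
  by apply: key; [lra|rewrite ltr_norml; apply/andP; split; lra].
rewrite (distrC c x).
by apply: key; [lra|rewrite ltr_norml; apply/andP; split; lra].
Qed.

Lemma real_ac_sub f g a b : real_ac f a b -> real_ac g a b ->
  real_ac (fun x => f x - g x) a b.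
Proof.
move=> acf acg e e0.
have [d1 d10 H1] := acf _ (divr_gt0 e0 (ltr0Sn _ 1)).
have [d2 d20 H2] := acg _ (divr_gt0 e0 (ltr0Sn _ 1)).
exists (Num.min d1 d2) => [|I aI pI]; first by rewrite lt_min d10.
rewrite lt_min => /andP[/(H1 I aI pI) h1 /(H2 I aI pI) h2].
apply: (@le_lt_trans _ _ (\sum_(u <- I) `|f u.2 - f u.1| +
    \sum_(u <- I) `|g u.2 - g u.1|)); last lra.
rewrite -big_split/=; apply: ler_sum => u _.
rewrite [X in `|X|](_ : _ = (f u.2 - f u.1) - (g u.2 - g u.1)); last ring.
exact: ler_normB.
Qed.

Lemma real_ac_integral g a b : mu.-integrable setT (EFin \o g) ->
  real_ac (fun x => \int[mu]_(t in `]-oo, x]) g t) a b.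
Proof.
move=> ig e e0.
have [d [d0 Hd]] := integral_normr_continuous ig (divr_gt0 e0 (ltr0Sn _ 1)).
exists d => // I aI pI Id.
have aI' : all (fun u : R * R => u.1 <= u.2) I.
  by apply: sub_all aI => u /andP[/andP[]].
have := Hd (ocs I) (measurable_ocs I).
rewrite [X in (X < _)%E](measure_ocs aI' pI) lte_fin => /(_ Id).
move=> h; apply: (@le_lt_trans _ _ (e / 2)); last lra.
apply: le_trans (ltW h).
have ign A : measurable A -> mu.-integrable A (EFin \o (fun x => `|g x|)).
  move=> mA; apply: (@integrableS _ _ _ _ setT) => //.
  exact: integrable_norm.
rewrite /Rintegral integral_ocs//; last first.
  by have /integrableP[] := ign setT measurableT.
have -> : (\sum_(u <- I) \int[mu]_(x in `]u.1, u.2]) (`|g x|)%:E)%E =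
   (\sum_(u <- I) \int[mu]_(x in `]u.1, u.2]) `|g x|)%:E.
  rewrite -sumEFin; apply: eq_bigr => u _; rewrite /Rintegral fineK//.
  exact: integrable_fin_num (ign _ _).
rewrite /= big_seq [leRHS]big_seq; apply: ler_sum => u uI.
rewrite Rintegral_itvB ?bnd_simp//; last 2 first.
  exact: (@integrableS _ _ _ _ setT).
  by move/allP: aI' => /(_ _ uI).
apply: le_normr_Rintegral => //; exact: (@integrableS _ _ _ _ setT).
Qed.

(** The difference of [f] and a primitive of [g] is absolutely continuous with derivative 0 almost
    everywhere, so it is constant. *)
Lemma real_ac_FTC f g a b : a <= b -> real_ac f a b ->
  mu.-integrable `[a, b] (EFin \o g) ->
  {ae mu, forall x, a <= x <= b -> right_derivative a f x (g x)} ->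
  \int[mu]_(x in `[a, b]) g x = f b - f a.
Proof.
move=> ab acf ig df.
(* Extension by 0 allows the primitive to start at [-oo], where it vanishes up to [a]. *)
pose g' := g \_ `[a, b].
have ig' : mu.-integrable setT (EFin \o g').
  by rewrite -restrict_EFin; apply/integrable_restrict => //=; rewrite setTI.
pose G x := \int[mu]_(t in `]-oo, x]) g' t.
have dG : {ae mu, forall x, derivable G x 1 /\ derive1 G x = g' x}.
  apply: FTC1Ny => [y|]; first exact: (@integrableS _ _ _ _ setT).
  by apply: open_integrable_locally => //; exact: openT.
have Ga : G a = 0.
  rewrite /G -Rintegral_itv_bndo_bndc; last exact: (@integrableS _ _ _ _ setT).
  rewrite (_ : Rintegral _ _ _ = \int[mu]_(t in `]-oo, a[) (cst 0 t)).
    by rewrite Rintegral_cst// mul0r.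
  apply: eq_Rintegral => x; rewrite inE/= in_itv/= => xa.
  by rewrite /g' patchE memNset//= in_itv/= leNgt xa.
have Gb : G b = \int[mu]_(x in `[a, b]) g x.
  rewrite -[LHS]subr0 -Ga Rintegral_itvB ?bnd_simp//; last first.
    exact: (@integrableS _ _ _ _ setT).
  rewrite Rintegral_itv_obnd_cbnd; last exact: (@integrableS _ _ _ _ setT).
  by apply: eq_Rintegral => x xab; rewrite /g' patchE xab.
suff : f b - G b = f a - G a by rewrite Ga Gb; lra.
apply: (@real_ac_const (fun x => f x - G x)) => //.
  by apply: real_ac_sub => //; exact: real_ac_integral.
apply: (@filterS2 _ _ (ae_filter_ringOfSetsType mu)) df dG => x fx [dGx Gx] axb.
rewrite /right_derivative (_ : 0 = g x - g' x); last first.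
  by rewrite /g' patchE mem_set ?subrr//= in_itv.
rewrite (_ : (fun t => _) = (fun t => (f t - f x) / (t - x)) \-
    (fun t => (G t - G x) / (t - x))); last first.
  by apply/funext => t/=; rewrite -mulrBl; congr (_ * _); ring.
apply: cvgB; first exact: fx.
apply: is_derive_right_derivative; rewrite -Gx derive1E.
exact/derivableP.
Qed.
End AbsolutelyContinuous.

(** * Real parts, imaginary parts and moduli of complex numbers *)

Section ComplexNumbers.
Context {R : realType}.
Implicit Types x y z : R[i].
Local Notation Re := complex.Re.
Local Notation Im := complex.Im.

Lemma complex_ext x y : Re x = Re y -> Im x = Im y -> x = y.
Proof. by case: x => ? ?; case: y => ? ? /= -> ->. Qed.

Lemma ReD x y : Re (x + y) = Re x + Re y. Proof. by case: x; case: y. Qed.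
Lemma ImD x y : Im (x + y) = Im x + Im y. Proof. by case: x; case: y. Qed.
Lemma ReN x : Re (- x) = - Re x. Proof. by case: x. Qed.
Lemma ImN x : Im (- x) = - Im x. Proof. by case: x. Qed.
Lemma ReM x y : Re (x * y) = Re x * Re y - Im x * Im y.
Proof. by case: x; case: y. Qed.
Lemma ImM x y : Im (x * y) = Re x * Im y + Im x * Re y.
Proof. by case: x; case: y. Qed.
Lemma ReJ x : Re x^*%C = Re x. Proof. by case: x. Qed.
Lemma ImJ x : Im x^*%C = - Im x. Proof. by case: x. Qed.
Definition ReImE := (ReD, ImD, ReN, ImN, ReM, ImM, ReJ, ImJ).

Lemma conjcD x y : (x + y)^*%C = x^*%C + y^*%C. Proof. exact: rmorphD. Qed.
Lemma conjcB x y : (x - y)^*%C = x^*%C - y^*%C. Proof. exact: rmorphB. Qed.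
Lemma conjcN x : (- x)^*%C = - x^*%C. Proof. exact: rmorphN. Qed.
Lemma conjcM x y : (x * y)^*%C = x^*%C * y^*%C. Proof. exact: rmorphM. Qed.
Definition conjE := (conjcD, conjcN, conjcM, @conjcK R, @conjc_real R).

Lemma sqr_normcE z : normc z ^+ 2 = Re z ^+ 2 + Im z ^+ 2.
Proof. by case: z => u v; rewrite /normc sqr_sqrtr// addr_ge0// sqr_ge0. Qed.

Lemma mul_conjc z : z * z^*%C = (normc z ^+ 2)%:C.
Proof.
rewrite sqr_normcE; apply: complex_ext; rewrite !ReImE/= ?mulr0 ?mul0r; ring.
Qed.

Lemma normc_ge0 z : 0 <= normc z.
Proof. by case: z => u v; exact: sqrtr_ge0. Qed.

Lemma normr_Re z : `|Re z| <= normc z.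
Proof.
rewrite -(ler_pXn2r (ltn0Sn 1)) ?nnegrE ?normc_ge0//.
by rewrite real_normK ?num_real// sqr_normcE lerDl sqr_ge0.
Qed.

Lemma normr_Im z : `|Im z| <= normc z.
Proof.
rewrite -(ler_pXn2r (ltn0Sn 1)) ?nnegrE ?normc_ge0//.
by rewrite real_normK ?num_real// sqr_normcE lerDr sqr_ge0.
Qed.

Lemma normcJ z : normc z^*%C = normc z.
Proof. by case: z => u v; rewrite /= sqrrN. Qed.

Lemma normc_real (u : R) : normc u%:C = `|u|.
Proof. by rewrite /= expr0n addr0 sqrtr_sqr. Qed.

Lemma normcD x y : normc (x + y) <= normc x + normc y.
Proof. exact: le_normcD. Qed.

Lemma normcB_sym x y : normc (x - y) = normc (y - x).
Proof. by rewrite -opprB; exact: normcN. Qed.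

Lemma ler_dist_normc x y : `|normc x - normc y| <= normc (x - y).
Proof.
rewrite ler_norml; apply/andP; split.
  rewrite lerNl opprB lerBlDr normcB_sym.
  by apply: le_trans (normcD _ _); rewrite subrK.
by rewrite lerBlDr; apply: le_trans (normcD _ _); rewrite subrK.
Qed.

Lemma normc_eq0 z : (normc z == 0) = (z == 0).
Proof.
by apply/eqP/eqP => [/eq0_normc//|->]; exact: normc0.
Qed.

End ComplexNumbers.

(** * Complex-valued absolutely continuous functions and one-sided derivatives *)

Section ComplexAbsolutelyContinuous.
Context {R : realType}.
Implicit Types (f g h : R -> R[i]) (a b s t x : R).
Local Notation Re := complex.Re.
Local Notation Im := complex.Im.
Local Notation mu := (@lebesgue_measure R).

(* All closure properties of absolute continuity are instances of this one. *)
Lemma ac_controlled f g h a b (C : R) : 0 <= C ->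
  absolutely_continuous f a b -> absolutely_continuous g a b ->
  (forall s t, a <= s <= b -> a <= t <= b ->
    normc (h t - h s) <= C * (normc (f t - f s) + normc (g t - g s))) ->
  absolutely_continuous h a b.
Proof.
move=> C0 acf acg hC e e0.
have C1 : 0 < e / (2 * (C + 1)) by rewrite divr_gt0// mulr_gt0//; lra.
have [d1 d10 H1] := acf _ C1; have [d2 d20 H2] := acg _ C1.
exists (Num.min d1 d2) => [|I aI pI]; first by rewrite lt_min d10.
rewrite lt_min => /andP[/(H1 I aI pI) h1 /(H2 I aI pI) h2].
apply: (@le_lt_trans _ _ (C * (\sum_(u <- I) normc (f u.2 - f u.1) +
    \sum_(u <- I) normc (g u.2 - g u.1)))).
  rewrite -big_split/= mulr_sumr big_seq [leRHS]big_seq.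
  apply: ler_sum => u /(allP aI)/andP[/andP[au uu] ub].
  by apply: hC; apply/andP; split => //; [exact: le_trans ub|exact: le_trans uu].
apply: (@le_lt_trans _ _ (C * (e / (C + 1)))).
  rewrite ler_wpM2l//; move: h1 h2; have -> : e / (2 * (C + 1)) = e / (C + 1) / 2.
    by field; lra.
  lra.
rewrite mulrA ltr_pdivrMr; [nra|lra].
Qed.

Lemma ac_Re f a b : absolutely_continuous f a b -> real_ac (fun x => Re (f x)) a b.
Proof.
move=> acf e /acf[d d0 H]; exists d => // I aI pI /(H I aI pI).
apply: le_lt_trans; apply: ler_sum => u _.
by apply: le_trans (normr_Re _); rewrite !ReImE.
Qed.

Lemma ac_Im f a b : absolutely_continuous f a b -> real_ac (fun x => Im (f x)) a b.
Proof.
move=> acf e /acf[d d0 H]; exists d => // I aI pI /(H I aI pI).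
apply: le_lt_trans; apply: ler_sum => u _.
by apply: le_trans (normr_Im _); rewrite !ReImE.
Qed.

Lemma real_ac_dist (f : R -> R) a b x e : real_ac f a b -> a <= x <= b -> 0 < e ->
  exists2 d, 0 < d & forall t, a <= t <= b -> `|x - t| < d -> `|f x - f t| < e.
Proof.
move=> acf /andP[ax xb] /acf[d d0 H]; exists d => // t /andP[at_ tb] xt.
have [xt'|tx] := leP x t.
  have := H [:: (x, t)]; rewrite !big_seq1/= ax xt' tb/= distrC => -> //.
  by rewrite -(ger0_norm (_ : 0 <= t - x)) ?subr_ge0// distrC.
have := H [:: (t, x)]; rewrite !big_seq1/= xb at_ (ltW tx)/= => -> //.
by rewrite -(ger0_norm (_ : 0 <= x - t)) ?subr_ge0// ltW.
Qed.

Lemma real_ac_continuous (f : R -> R) a b : real_ac f a b ->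
  {within `[a, b], continuous f}.
Proof.
move=> acf; apply/subspace_continuousP => x; rewrite /= in_itv/= => axb.
apply/cvgrPdist_lt => e e0; have [d d0 H] := real_ac_dist acf axb e0.
by apply/nbhs_ballP; exists d => // t xt; rewrite /= in_itv/= => tab; exact: H.
Qed.

Lemma locally_real_ac_continuous (f : R -> R) a : (forall b, real_ac f a b) ->
  {within `[a, +oo[, continuous f}.
Proof.
move=> acf; apply/subspace_continuousP => x; rewrite /= in_itv/= andbT => ax.
apply/cvgrPdist_lt => e e0.
have [|d d0 H] := real_ac_dist (acf (x + 1)) _ e0 (x := x); first by rewrite ax/=; lra.
apply/nbhs_ballP; exists (Num.min d 1) => [|t xt]; first by rewrite /= lt_min d0/=.
rewrite /= in_itv/= andbT => ta; move: xt; rewrite /ball/= lt_min => /andP[xt xt1].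
by apply: H => //; rewrite ta/=; move: xt1; rewrite ltr_norml => /andP[]; lra.
Qed.

Lemma ac_bounded f a b : absolutely_continuous f a b ->
  exists2 C, 0 <= C & forall t, a <= t <= b -> normc (f t) <= C.
Proof.
move=> acf; have [ab|ba] := leP a b; last first.
  by exists 0 => // t /andP[ta tb]; have := le_trans ta tb; rewrite leNgt ba.
have : real_ac (fun x => normc (f x)) a b.
  move=> e /acf[d d0 H]; exists d => // I aI pI /(H I aI pI).
  by apply: le_lt_trans; apply: ler_sum => u _; exact: ler_dist_normc.
move=> /real_ac_continuous /(EVT_max ab)[c _ H].
exists (normc (f c)); first exact: normc_ge0.
by move=> t tab; apply: H; rewrite in_itv.
Qed.

Lemma ac_lin (c : R[i]) f g a b :
  absolutely_continuous f a b -> absolutely_continuous g a b ->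
  absolutely_continuous (fun x => c * f x + g x) a b.
Proof.
move=> acf acg; apply: (ac_controlled (C := normc c + 1) _ acf acg) => [|s t _ _].
  by rewrite addr_ge0// normc_ge0.
have -> : c * f t + g t - (c * f s + g s) = c * (f t - f s) + (g t - g s) by ring.
apply: le_trans (normcD _ _) _; rewrite normcM.
have := normc_ge0 c; have := normc_ge0 (f t - f s); have := normc_ge0 (g t - g s).
nra.
Qed.

Lemma acM f g a b :
  absolutely_continuous f a b -> absolutely_continuous g a b ->
  absolutely_continuous (fun x => f x * g x) a b.
Proof.
move=> acf acg; have [C1 C10 fC] := ac_bounded acf; have [C2 C20 gC] := ac_bounded acg.
apply: (ac_controlled (C := C1 + C2) _ acf acg) => [|s t sab tab].
  by rewrite addr_ge0.
have -> : f t * g t - f s * g s = f t * (g t - g s) + (f t - f s) * g s by ring.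
apply: le_trans (normcD _ _) _; rewrite !normcM.
have := normc_ge0 (f t - f s); have := normc_ge0 (g t - g s).
have := fC _ tab; have := gC _ sab; nra.
Qed.

Lemma acJ f a b : absolutely_continuous f a b ->
  absolutely_continuous (fun x => (f x)^*%C) a b.
Proof.
move=> acf; apply: (ac_controlled (C := 1) _ acf acf) => // s t _ _.
by rewrite -conjcB normcJ; have := normc_ge0 (f t - f s); lra.
Qed.

Lemma ac_lipschitz (f : R -> R) a b (C : R) : 0 <= C ->
  (forall s t, `|f t - f s| <= C * `|t - s|) ->
  absolutely_continuous (fun x => (f x)%:C) a b.
Proof.
move=> C0 fC e e0; exists (e / (C + 1)) => [|I aI _ Id].
  by rewrite divr_gt0//; lra.
apply: (@le_lt_trans _ _ (C * \sum_(u <- I) (u.2 - u.1))); last first.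
  apply: (@le_lt_trans _ _ (C * (e / (C + 1)))).
    by rewrite ler_wpM2l// ltW.
  by rewrite mulrA ltr_pdivrMr; [nra|lra].
rewrite mulr_sumr big_seq [leRHS]big_seq; apply: ler_sum => u /(allP aI).
move=> /andP[/andP[_ uu] _]; rewrite -rmorphB normc_real.
by apply: le_trans (fC _ _) _; rewrite ger0_norm// subr_ge0.
Qed.

Lemma right_derivative_continuous a (f : R -> R) x l : right_derivative a f x l ->
  f @ within `[a, +oo[ x^' --> f x.
Proof.
move=> df.
have idx : (fun t : R => t - x) @ within `[a, +oo[ x^' --> (0 : R).
  apply/cvgrPdist_lt => e e0; apply/nbhs_ballP; exists e => // t xt _ _.
  by rewrite /= sub0r opprB.
have := cvgD (cvgM df idx) (cvg_cst (f x)); rewrite mulr0 add0r.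
have F1 : Filter (within `[a, +oo[ x^') by exact: within_filter.
move=> /(_ F1 F1 F1) /cvgrPdist_le => H; apply/cvgrPdist_le => e /H; move=> /nbhs_ballP[r r0 rH].
apply/nbhs_ballP; exists r => // t xt tx at_; have h := rH t xt tx at_.
suff E : (f t - f x) / (t - x) * (t - x) + f x = f t by rewrite -E; exact: h.
by rewrite divfK ?subrK// subr_eq0.
Qed.

Lemma right_derivativeD a (f g : R -> R) x l m :
  right_derivative a f x l -> right_derivative a g x m ->
  right_derivative a (fun t => f t + g t) x (l + m).
Proof.
move=> df dg; rewrite /right_derivative (_ : (fun t => _) =
  (fun t => (f t - f x) / (t - x)) \+ (fun t => (g t - g x) / (t - x))).
  exact: cvgD.
by apply/funext => t /=; rewrite -mulrDl; congr (_ * _); ring.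
Qed.

Lemma right_derivativeM a (f g : R -> R) x l m :
  right_derivative a f x l -> right_derivative a g x m ->
  right_derivative a (fun t => f t * g t) x (l * g x + f x * m).
Proof.
move=> df dg; rewrite /right_derivative (_ : (fun t => _) =
  (fun t => (f t - f x) / (t - x)) \* g \+ cst (f x) \* (fun t => (g t - g x) / (t - x))).
  apply: cvgD; apply: cvgM => //; last exact: cvg_cst.
  exact: right_derivative_continuous dg.
by apply/funext => t /=; rewrite /cst/=; ring.
Qed.

Lemma right_derivativeN a (f : R -> R) x l :
  right_derivative a f x l -> right_derivative a (fun t => - f t) x (- l).
Proof.
move=> df; rewrite /right_derivative (_ : (fun t => _) =
  \- (fun t => (f t - f x) / (t - x))); first exact: cvgN.
by apply/funext => t /=; ring.
Qed.

Lemma right_derivative_cst a (c x : R) : right_derivative a (cst c) x 0.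
Proof.
rewrite /right_derivative (_ : (fun t => _) = cst 0); first exact: cvg_cst.
by apply/funext => t /=; rewrite subrr mul0r.
Qed.

(** A test by inequalities only, suited to truncations such as [max 0 (1 - s) ^ 2], whose formula
    changes at a point. *)
Lemma right_derivative_quadratic a (f : R -> R) x l (C : R) : 0 <= C ->
  (forall t, `|f t - f x - l * (t - x)| <= C * (t - x) ^+ 2) ->
  right_derivative a f x l.
Proof.
move=> C0 H; apply/cvgrPdist_le => e e0.
apply/nbhs_ballP; exists (e / (C + 1)) => [|t xt tx _].
  by rewrite /= divr_gt0//; lra.
have tx0 : 0 < `|t - x| by rewrite normr_gt0 subr_eq0.
have -> : l - (f t - f x) / (t - x) = - (f t - f x - l * (t - x)) / (t - x).
  by field; rewrite subr_eq0.
rewrite normrM normrN normfV ler_pdivrMr//; apply: (le_trans (H t)).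
rewrite -real_normK ?num_real// expr2 mulrA ler_pM2r//.
move: xt; rewrite /ball/= distrC ltr_pdivlMr => [|]; [nra|lra].
Qed.

Lemma has_derivative_lin a (c : R[i]) f g x l m :
  has_derivative a f x l -> has_derivative a g x m ->
  has_derivative a (fun t => c * f t + g t) x (c * l + m).
Proof.
move=> [f1 f2] [g1 g2].
have dc := right_derivative_cst a _ x; split.
  have := right_derivativeD (right_derivativeD (right_derivativeM (dc (Re c)) f1)
    (right_derivativeN (right_derivativeM (dc (Im c)) f2))) g1.
  suff -> : Re (c * l + m) = 0 * Re (f x) + cst (Re c) x * Re l -
      (0 * Im (f x) + cst (Im c) x * Im l) + Re m.
    by congr right_derivative; apply/funext => t; rewrite !ReImE.
  by rewrite !ReImE/=; ring.
have := right_derivativeD (right_derivativeD (right_derivativeM (dc (Re c)) f2)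
    (right_derivativeM (dc (Im c)) f1)) g2.
suff -> : Im (c * l + m) = 0 * Im (f x) + cst (Re c) x * Im l +
      (0 * Re (f x) + cst (Im c) x * Re l) + Im m.
  by congr right_derivative; apply/funext => t; rewrite !ReImE.
by rewrite !ReImE/=; ring.
Qed.

Lemma has_derivativeM a f g x l m :
  has_derivative a f x l -> has_derivative a g x m ->
  has_derivative a (fun t => f t * g t) x (l * g x + f x * m).
Proof.
move=> [f1 f2] [g1 g2]; split.
  have := right_derivativeD (right_derivativeM f1 g1)
    (right_derivativeN (right_derivativeM f2 g2)).
  suff -> : Re (l * g x + f x * m) = Re l * Re (g x) + Re (f x) * Re m +
      - (Im l * Im (g x) + Im (f x) * Im m).
    by congr right_derivative; apply/funext => t; rewrite !ReImE.
  by rewrite !ReImE; ring.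
have := right_derivativeD (right_derivativeM f1 g2) (right_derivativeM f2 g1).
suff -> : Im (l * g x + f x * m) = Re l * Im (g x) + Re (f x) * Im m +
    (Im l * Re (g x) + Im (f x) * Re m).
  by congr right_derivative; apply/funext => t; rewrite !ReImE.
by rewrite !ReImE; ring.
Qed.

Lemma has_derivativeJ a f x l :
  has_derivative a f x l -> has_derivative a (fun t => (f t)^*%C) x l^*%C.
Proof.
move=> [f1 f2]; split.
  have : right_derivative a (fun t => Re (f t)) x (Re l) by [].
  by rewrite (ReJ l); congr right_derivative; apply/funext => t; rewrite ReJ.
rewrite (ImJ l); have := right_derivativeN f2.
by congr right_derivative; apply/funext => t; rewrite ImJ.
Qed.

Lemma has_derivative_real a (f : R -> R) x l :
  right_derivative a f x l -> has_derivative a (fun t => (f t)%:C) x l%:C.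
Proof. by move=> df; split => //; exact: (right_derivative_cst a 0 x). Qed.

Lemma ac_FTC f g a b : a <= b -> absolutely_continuous f a b ->
  mu.-integrable `[a, b] (EFin \o (fun x => Re (g x))) ->
  mu.-integrable `[a, b] (EFin \o (fun x => Im (g x))) ->
  {ae mu, forall x, a <= x -> has_derivative a f x (g x)} ->
  cintegral mu `[a, b] g = f b - f a.
Proof.
move=> ab acf ig1 ig2 df; apply: complex_ext => /=; rewrite !ReImE.
  apply: (real_ac_FTC ab (ac_Re acf) ig1).
  apply: (@filterS _ _ (ae_filter_ringOfSetsType mu)) df => x H /andP[ax _].
  by have [] := H ax.
apply: (real_ac_FTC ab (ac_Im acf) ig2).
apply: (@filterS _ _ (ae_filter_ringOfSetsType mu)) df => x H /andP[ax _].
by have [] := H ax.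
Qed.

End ComplexAbsolutelyContinuous.

(** * Complex integrals and L^2 *)

Section ComplexIntegral.
Context {R : realType}.
Variables (m : {measure set (measurableTypeR R) -> \bar R}) (D : set R).
Hypothesis mD : measurable (D : set (measurableTypeR R)).
Local Notation Re := complex.Re.
Local Notation Im := complex.Im.
Implicit Types (f g h : R -> R[i]) (u v : R -> R).

Lemma Rintegrable_lin (c : R) u v : m.-integrable D (EFin \o u) ->
  m.-integrable D (EFin \o v) -> m.-integrable D (EFin \o (fun x => c * u x + v x)).
Proof.
move=> iu iv; have := integrableD mD (integrableZl mD c iu) iv.
by apply: eq_integrable => // x _ /=; rewrite -EFinM -EFinD.
Qed.

Lemma Rintegral_lin (c : R) u v : m.-integrable D (EFin \o u) ->
  m.-integrable D (EFin \o v) ->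
  \int[m]_(x in D) (c * u x + v x) = c * \int[m]_(x in D) u x + \int[m]_(x in D) v x.
Proof.
move=> iu iv; rewrite -RintegralZl// -RintegralD//.
have := integrableZl mD c iu.
by apply: eq_integrable => // x _ /=; rewrite -EFinM.
Qed.

Definition cmeasurable f :=
  measurable_fun (D : set (measurableTypeR R)) (fun x => Re (f x)) /\
  measurable_fun (D : set (measurableTypeR R)) (fun x => Im (f x)).

Definition cintegrable f := m.-integrable D (EFin \o (fun x => Re (f x))) /\
  m.-integrable D (EFin \o (fun x => Im (f x))).

Lemma cmeasurable_lin (c : R[i]) f g : cmeasurable f -> cmeasurable g ->
  cmeasurable (fun x => c * f x + g x).
Proof.
move=> [f1 f2] [g1 g2].
have mZ (k : R) u : measurable_fun (D : set (measurableTypeR R)) u ->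
    measurable_fun (D : set (measurableTypeR R)) (fun x => k * u x).
  by move=> mu; apply: measurable_funM => //; exact: measurable_cst.
split.
  apply: (eq_measurable_fun (fun x => Re c * Re (f x) - Im c * Im (f x) + Re (g x))).
    by move=> x _; rewrite !ReImE.
  by apply: measurable_funD => //; apply: measurable_funB; exact: mZ.
apply: (eq_measurable_fun (fun x => Re c * Im (f x) + Im c * Re (f x) + Im (g x))).
  by move=> x _; rewrite !ReImE.
by apply: measurable_funD => //; apply: measurable_funD; exact: mZ.
Qed.

Lemma cmeasurableM f g : cmeasurable f -> cmeasurable g ->
  cmeasurable (fun x => f x * g x).
Proof.
move=> [f1 f2] [g1 g2]; split.
  apply: (eq_measurable_fun (fun x => Re (f x) * Re (g x) - Im (f x) * Im (g x))).
    by move=> x _; rewrite !ReImE.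
  by apply: measurable_funB; exact: measurable_funM.
apply: (eq_measurable_fun (fun x => Re (f x) * Im (g x) + Im (f x) * Re (g x))).
  by move=> x _; rewrite !ReImE.
by apply: measurable_funD; exact: measurable_funM.
Qed.

Lemma cmeasurableJ f : cmeasurable f -> cmeasurable (fun x => (f x)^*%C).
Proof.
move=> [f1 f2]; split.
  by apply: (eq_measurable_fun (fun x => Re (f x))) => // x _; rewrite ReJ.
apply: (eq_measurable_fun (fun x => - Im (f x))); last exact: measurable_funN.
by move=> x _; rewrite ImJ.
Qed.

Lemma cmeasurable_real u : measurable_fun (D : set (measurableTypeR R)) u ->
  cmeasurable (fun x => (u x)%:C).
Proof. by move=> mu; split => //; exact: measurable_cst. Qed.

Lemma cmeasurable_cst (c : R[i]) : cmeasurable (fun=> c).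
Proof. by split; exact: measurable_cst. Qed.

Lemma cmeasurable_normc2 f : cmeasurable f ->
  measurable_fun (D : set (measurableTypeR R)) (fun x => normc (f x) ^+ 2).
Proof.
move=> [f1 f2].
apply: (eq_measurable_fun (fun x => Re (f x) ^+ 2 + Im (f x) ^+ 2)).
  by move=> x _; rewrite sqr_normcE.
by apply: measurable_funD; exact: measurable_funX.
Qed.

Lemma Rintegrable_le u v : measurable_fun (D : set (measurableTypeR R)) u ->
  (forall x, D x -> `|u x| <= v x) -> m.-integrable D (EFin \o v) ->
  m.-integrable D (EFin \o u).
Proof.
move=> mu uv; apply: le_integrable => //; first exact/measurable_EFinP.
by move=> x Dx /=; rewrite lee_fin; apply: le_trans (uv x Dx) (ler_norm _).
Qed.

Lemma cintegrable_le f v : cmeasurable f ->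
  (forall x, D x -> normc (f x) <= v x) -> m.-integrable D (EFin \o v) ->
  cintegrable f.
Proof.
move=> [f1 f2] fv iv; split; apply: Rintegrable_le iv => // x Dx.
  exact: le_trans (normr_Re _) (fv x Dx).
exact: le_trans (normr_Im _) (fv x Dx).
Qed.

Lemma cintegrable_lin (c : R[i]) f g : cintegrable f -> cintegrable g ->
  cintegrable (fun x => c * f x + g x).
Proof.
move=> [f1 f2] [g1 g2]; split.
  have := Rintegrable_lin (Re c) f1 (Rintegrable_lin (- Im c) f2 g1).
  by apply: eq_integrable => // x _ /=; rewrite !ReImE; congr EFin; ring.
have := Rintegrable_lin (Re c) f2 (Rintegrable_lin (Im c) f1 g2).
by apply: eq_integrable => // x _ /=; rewrite !ReImE; congr EFin; ring.
Qed.

Lemma cintegral_lin (c : R[i]) f g : cintegrable f -> cintegrable g ->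
  cintegral m D (fun x => c * f x + g x) = c * cintegral m D f + cintegral m D g.
Proof.
move=> [f1 f2] [g1 g2]; apply: complex_ext => /=; rewrite !ReImE/=.
  have := Rintegral_lin (Re c) f1 (Rintegrable_lin (- Im c) f2 g1).
  rewrite (Rintegral_lin (- Im c))// addrA mulNr => <-.
  by apply: eq_Rintegral => x _; rewrite !ReImE; ring.
have := Rintegral_lin (Re c) f2 (Rintegrable_lin (Im c) f1 g2).
rewrite (Rintegral_lin (Im c))// addrA => <-.
by apply: eq_Rintegral => x _; rewrite !ReImE; ring.
Qed.

Lemma cintegrableJ f : cintegrable f -> cintegrable (fun x => (f x)^*%C).
Proof.
move=> [f1 f2]; split.
  by apply: eq_integrable f1 => // x _ /=; rewrite ReJ.
have := integrableN f2.
by apply: eq_integrable => // x _ /=; rewrite ImJ.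
Qed.

Lemma cintegralJ f : cintegrable f ->
  cintegral m D (fun x => (f x)^*%C) = (cintegral m D f)^*%C.
Proof.
move=> [f1 f2]; apply: complex_ext => /=.
  by apply: eq_Rintegral => x _; rewrite ReJ.
rewrite -mulN1r -RintegralZl//.
by apply: eq_Rintegral => x _; rewrite ImJ mulN1r.
Qed.

Lemma cintegral_eq f g : (forall x, D x -> f x = g x) ->
  cintegral m D f = cintegral m D g.
Proof.
by move=> fg; apply: complex_ext => /=; apply: eq_Rintegral => x;
  rewrite inE => /fg ->.
Qed.

Lemma cintegral_aeq f g : cintegrable f -> cintegrable g -> aeq m D f g ->
  cintegral m D f = cintegral m D g.
Proof.
move=> [f1 f2] [g1 g2] fg.
have H u v : m.-integrable D (EFin \o u) -> m.-integrable D (EFin \o v) ->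
    {ae m, forall x, D x -> u x = v x} ->
    \int[m]_(x in D) u x = \int[m]_(x in D) v x.
  move=> /integrableP[iu _] /integrableP[iv _] uv.
  rewrite /Rintegral; congr fine; apply: ae_eq_integral => //.
  by apply: (@filterS _ _ (ae_filter_ringOfSetsType m)) uv => x H Dx /=; rewrite H.
apply: complex_ext; apply: H => //=;
  by apply: (@filterS _ _ (ae_filter_ringOfSetsType m)) fg => x H Dx; rewrite H.
Qed.

Lemma aeq_trans f g h : aeq m D f g -> aeq m D g h -> aeq m D f h.
Proof.
apply: (@filterS2 _ _ (ae_filter_ringOfSetsType m)) => x fg gh Dx.
by rewrite fg ?gh.
Qed.

Lemma aeq_sym f g : aeq m D f g -> aeq m D g f.
Proof.
by apply: (@filterS _ _ (ae_filter_ringOfSetsType m)) => x fg Dx; rewrite fg.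
Qed.

Lemma aeq_eq f g : (forall x, D x -> f x = g x) -> aeq m D f g.
Proof.
by move=> fg; apply: (@filterE _ _ (ae_filter_ringOfSetsType m)) => x /fg.
Qed.

Lemma aeq_refl f : aeq m D f f. Proof. exact: aeq_eq. Qed.

Lemma aeq_lin (c : R[i]) f f' g g' : aeq m D f f' -> aeq m D g g' ->
  aeq m D (fun x => c * f x + g x) (fun x => c * f' x + g' x).
Proof.
apply: (@filterS2 _ _ (ae_filter_ringOfSetsType m)) => x ff gg Dx.
by rewrite ff ?gg.
Qed.

Lemma L2_measurable f : L2 m D f -> cmeasurable f.
Proof. by case. Qed.

Lemma L2_integrable f : L2 m D f ->
  m.-integrable D (EFin \o (fun x => normc (f x) ^+ 2)).
Proof.
move=> [f1 f2 f3]; apply/integrableP; split.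
  by apply/measurable_EFinP; apply: cmeasurable_normc2.
apply: le_lt_trans f3; rewrite le_eqVlt; apply/orP; left; apply/eqP.
by apply: eq_integral => x _ /=; rewrite ger0_norm// sqr_ge0.
Qed.

Lemma L2_intro f v : cmeasurable f ->
  (forall x, D x -> normc (f x) ^+ 2 <= v x) -> m.-integrable D (EFin \o v) ->
  L2 m D f.
Proof.
move=> [f1 f2] fv iv; split => //.
have /integrableP[_] : m.-integrable D (EFin \o (fun x => normc (f x) ^+ 2)).
  apply: Rintegrable_le iv; first exact: cmeasurable_normc2.
  by move=> x Dx; rewrite ger0_norm ?sqr_ge0// fv.
apply: le_lt_trans; rewrite le_eqVlt; apply/orP; left; apply/eqP.
by apply: eq_integral => x _ /=; rewrite ger0_norm// sqr_ge0.
Qed.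

Lemma L2_le (C : R) f g : cmeasurable f -> 0 <= C ->
  (forall x, D x -> normc (f x) <= C * normc (g x)) -> L2 m D g -> L2 m D f.
Proof.
move=> mf C0 fg Lg.
apply: (@L2_intro _ (fun x => C ^+ 2 * normc (g x) ^+ 2 + 0)) => //.
  move=> x Dx; rewrite addr0 -exprMn; have := normc_ge0 (f x).
  by move=> f0; apply: lerXn2r (fg x Dx); rewrite nnegrE// mulr_ge0// normc_ge0.
apply: Rintegrable_lin; first exact: L2_integrable.
exact: integrable0.
Qed.

Lemma L2_lin (c : R[i]) f g : L2 m D f -> L2 m D g ->
  L2 m D (fun x => c * f x + g x).
Proof.
move=> Lf Lg.
apply: (@L2_intro _ (fun x => 2 * normc c ^+ 2 * normc (f x) ^+ 2 +
    (2 * normc (g x) ^+ 2 + 0))).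
- by apply: cmeasurable_lin; exact: L2_measurable.
- move=> x _; have := normcD (c * f x) (g x); rewrite normcM.
  have := normc_ge0 (c * f x + g x).
  move: (normc _) (normc c) (normc (f x)) (normc (g x)) => a b p q a0 ab.
  have : a ^+ 2 <= (b * p + q) ^+ 2 by rewrite lerXn2r// nnegrE// (le_trans a0).
  have := sqr_ge0 (b * p - q); nra.
- apply: Rintegrable_lin; first exact: L2_integrable.
  apply: Rintegrable_lin; first exact: L2_integrable.
  exact: integrable0.
Qed.

Lemma L2_0 : L2 m D (fun=> 0).
Proof.
apply: (@L2_intro _ (fun=> 0)); [exact: cmeasurable_cst| |exact: integrable0].
by move=> x _; rewrite normc0 expr0n.
Qed.

Lemma L2Z (c : R[i]) f : L2 m D f -> L2 m D (fun x => c * f x).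
Proof.
move=> Lf; have := L2_lin c Lf L2_0.
by congr (L2 m D); apply/funext => x; rewrite addr0.
Qed.

Lemma ip_integrable f g : L2 m D f -> L2 m D g ->
  cintegrable (fun x => f x * (g x)^*%C).
Proof.
move=> Lf Lg; apply: (@cintegrable_le _
    (fun x => 2^-1 * normc (f x) ^+ 2 + (2^-1 * normc (g x) ^+ 2 + 0))).
- by apply: cmeasurableM; [|apply: cmeasurableJ]; exact: L2_measurable.
- move=> x _; rewrite normcM normcJ; have := sqr_ge0 (normc (f x) - normc (g x)).
  move: (normc (f x)) (normc (g x)) => p q; nra.
- apply: Rintegrable_lin; first exact: L2_integrable.
  apply: Rintegrable_lin; first exact: L2_integrable.
  exact: integrable0.
Qed.

Lemma ip_linl (c : R[i]) f g h : L2 m D f -> L2 m D g -> L2 m D h ->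
  ip m D (fun x => c * f x + g x) h = c * ip m D f h + ip m D g h.
Proof.
move=> Lf Lg Lh; rewrite -cintegral_lin; try exact: ip_integrable.
by apply: cintegral_eq => x _; ring.
Qed.

Lemma ip_conj f g : L2 m D f -> L2 m D g -> ip m D g f = (ip m D f g)^*%C.
Proof.
move=> Lf Lg; rewrite -cintegralJ; last exact: ip_integrable.
by apply: cintegral_eq => x _; rewrite !conjE mulrC.
Qed.

Lemma ip_linr (c : R[i]) f g h : L2 m D f -> L2 m D g -> L2 m D h ->
  ip m D h (fun x => c * f x + g x) = c^*%C * ip m D h f + ip m D h g.
Proof.
move=> Lf Lg Lh; rewrite ip_conj//; last exact: L2_lin.
by rewrite ip_linl// !conjE -!ip_conj.
Qed.

Lemma ip_aeq f f' g g' : L2 m D f -> L2 m D f' -> L2 m D g -> L2 m D g' ->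
  aeq m D f f' -> aeq m D g g' -> ip m D f g = ip m D f' g'.
Proof.
move=> Lf Lf' Lg Lg' ff gg; apply: cintegral_aeq; try exact: ip_integrable.
move: ff gg; apply: (@filterS2 _ _ (ae_filter_ringOfSetsType m)) => x ff gg Dx.
by rewrite ff ?gg.
Qed.

Definition sqnorm f : R := \int[m]_(x in D) (normc (f x) ^+ 2).

Lemma ip_self f : ip m D f f = (sqnorm f)%:C.
Proof.
apply: complex_ext => /=.
  by apply: eq_Rintegral => x _; rewrite mul_conjc.
rewrite (_ : Rintegral _ _ _ = \int[m]_(x in D) (0 * 0)).
  by rewrite RintegralZl ?mul0r//; exact: integrable0.
by apply: eq_Rintegral => x _; rewrite mul_conjc mulr0.
Qed.

Lemma sqnorm_ge0 f : 0 <= sqnorm f.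
Proof. by apply: Rintegral_ge0 => x _; exact: sqr_ge0. Qed.

Lemma EFin_sqnorm f : L2 m D f ->
  (\int[m]_(x in D) (normc (f x) ^+ 2)%:E)%E = (sqnorm f)%:E.
Proof.
by move=> Lf; rewrite /sqnorm /Rintegral fineK//; apply: integrable_fin_num (L2_integrable Lf).
Qed.

Lemma sqnorm_eq0 f : L2 m D f -> sqnorm f = 0 -> aeq m D f (fun=> 0).
Proof.
move=> Lf f0; have := EFin_sqnorm Lf; rewrite f0 => f0'.
have /(ae_eq_integral_abs m mD) [+ _] : measurable_fun D
    (EFin \o (fun x => normc (f x) ^+ 2)).
  by apply/measurable_EFinP; apply: cmeasurable_normc2; exact: L2_measurable.
rewrite (_ : integral _ _ _ = 0%E) => [/(_ erefl)|]; last first.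
  by rewrite -[RHS]f0'; apply: eq_integral => x _ /=; rewrite ger0_norm// sqr_ge0.
apply: (@filterS _ _ (ae_filter_ringOfSetsType m)) => x H Dx.
have /eqP := H Dx; rewrite eqe sqrf_eq0 => /eqP.
exact: eq0_normc.
Qed.

Lemma Re_ip_le f g : L2 m D f -> L2 m D g ->
  Re (ip m D f g) <= 2^-1 * sqnorm f + 2^-1 * sqnorm g.
Proof.
move=> Lf Lg.
have h : 0 <= sqnorm (fun x => (-1) * g x + f x) := sqnorm_ge0 _.
have := ip_self (fun x => (-1) * g x + f x).
rewrite ip_linl//; last exact: L2_lin.
rewrite !ip_linr// (ip_conj Lg Lf) !ip_self => E.
have /(congr1 (@complex.Re R)) := esym E; rewrite !ReImE/= ?oppr0; move: h; lra.
Qed.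

(** For [y] in the domain close to [f], orthogonality gives [||f||^2 = (f, f - y)], and [Re_ip_le]
    turns this into [||f||^2 <= ||f - y||^2]. *)
Lemma dense_orthogonal0 T f : densely_defined m D T ->
  (forall y g, T y g -> L2 m D y) -> L2 m D f ->
  (forall y g, T y g -> ip m D f y = 0) -> aeq m D f (fun=> 0).
Proof.
move=> dT LT Lf f0; apply: sqnorm_eq0 => //; apply/eqP.
rewrite eq_le sqnorm_ge0 andbT; apply/ler_addgt0Pr => e e0; rewrite add0r.
have [y [g [Tyg fy]]] := dT _ Lf _ e0.
have Ly := LT _ _ Tyg.
have Lfy : L2 m D (fun x => (-1) * y x + f x) by exact: L2_lin.
have := Re_ip_le Lf Lfy; rewrite ip_linr// (f0 _ _ Tyg) mulr0 add0r ip_self/=.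
have : sqnorm (fun x => (-1) * y x + f x) < e.
  rewrite -lte_fin -EFin_sqnorm//; apply: le_lt_trans fy.
  rewrite le_eqVlt; apply/orP; left; apply/eqP.
  by apply: eq_integral => x _; rewrite mulN1r addrC.
lra.
Qed.

End ComplexIntegral.

(** * Scalar multiples, null functions and almost everywhere equal integrands *)

Section IntegralScaling.
Context {R : realType}.
Variables (m : {measure set (measurableTypeR R) -> \bar R}) (D : set R).
Hypothesis mD : measurable (D : set (measurableTypeR R)).

Lemma ipZl (c : R[i]) f g : L2 m D f -> L2 m D g ->
  ip m D (fun x => c * f x) g = c * ip m D f g.
Proof.
move=> Lf Lg; have -> : (fun x => c * f x) = (fun x => (c - 1) * f x + f x).
  by apply/funext => x; ring.
by rewrite (ip_linl mD)//; ring.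
Qed.

Lemma ipZr (c : R[i]) f g : L2 m D f -> L2 m D g ->
  ip m D f (fun x => c * g x) = c^*%C * ip m D f g.
Proof.
move=> Lf Lg; rewrite (ip_conj mD (L2Z mD c Lg) Lf) ipZl// conjcM.
by rewrite -(ip_conj mD Lg Lf).
Qed.

Lemma ip0l f g : L2 m D f -> L2 m D g -> aeq m D f (fun=> 0) -> ip m D f g = 0.
Proof.
move=> Lf Lg f0; rewrite (ip_aeq mD Lf (L2Z mD 0 Lf) Lg Lg _ (aeq_refl _ _ _)).
  by rewrite ipZl// mul0r.
by apply: aeq_trans f0 _; apply: aeq_eq => x _; rewrite mul0r.
Qed.

Lemma cintegrableZ (c : R[i]) f : cintegrable m D f ->
  cintegrable m D (fun x => c * f x).
Proof.
move=> If; have := cintegrable_lin mD (c - 1) If If.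
by congr cintegrable; apply/funext => x; ring.
Qed.

Lemma cintegralZ (c : R[i]) f : cintegrable m D f ->
  cintegral m D (fun x => c * f x) = c * cintegral m D f.
Proof.
move=> If; have := cintegral_lin mD (c - 1) If If.
have -> : (fun x => (c - 1) * f x + f x) = (fun x => c * f x) by apply/funext => x; ring.
by move=> ->; ring.
Qed.

Lemma cintegrable_aeq f g : cmeasurable D f -> cintegrable m D g -> aeq m D f g ->
  cintegrable m D f.
Proof.
move=> [f1 f2] [g1 g2] fg.
have H (u v : R -> R) : measurable_fun (D : set (measurableTypeR R)) u ->
    m.-integrable D (EFin \o v) -> {ae m, forall x, D x -> u x = v x} ->
    m.-integrable D (EFin \o u).
  move=> mu iv uv; have mu' : measurable_fun D (EFin \o u) by exact/measurable_EFinP.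
  have /integrableP[mv fv] := iv; apply/integrableP; split => //.
  rewrite (@ae_eq_integral _ _ _ m D (abse \o (EFin \o v)) (abse \o (EFin \o u)))//;
    try exact: measurableT_comp.
  by apply: (@filterS _ _ (ae_filter_ringOfSetsType m)) uv => x E Dx /=; rewrite E.
by split; [apply: H f1 g1 _|apply: H f2 g2 _];
  apply: (@filterS _ _ (ae_filter_ringOfSetsType m)) fg => x E Dx; rewrite E.
Qed.

Lemma measurable_fun_inv (h : R -> R) : continuous h -> (forall x, D x -> h x != 0) ->
  measurable_fun (D : set (measurableTypeR R)) (fun x => (h x)^-1).
Proof.
move=> ch h0; apply: subspace_continuous_measurable_fun => //.
apply/subspace_continuousP => x Dx; apply: cvg_within_filter.
by apply: cvgV; [exact: h0|exact: ch].
Qed.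

End IntegralScaling.

(** * The maximal domain and Green's formula *)

Section MaximalDomain.
Context {R : realType} (a : R) (q : R -> R).
Local Notation mu := (@lebesgue_measure R).
Local Notation H := `[a, +oo[%classic.
Local Notation Dst := (Dstar a q).
Implicit Types (Y Z : Dst).

Lemma measurable_halfline : measurable (H : set (measurableTypeR R)).
Proof. exact: measurable_itv. Qed.
Local Notation mH := measurable_halfline.

Program Definition Dlin (c : R[i]) Y Z : Dst :=
  @MkDstar R a q (fun x => c * Y x + Z x) (fun x => c * dval' Y x + dval' Z x)
    (fun x => c * dval'' Y x + dval'' Z x) _ _ _ _ _ _.
Next Obligation. by move=> c Y Z; apply: (L2_lin mH); exact: dstar_L2. Qed.
Next Obligation. by move=> c Y Z b; apply: ac_lin; exact: dstar_ac. Qed.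
Next Obligation. by move=> c Y Z x ax; apply: has_derivative_lin; exact: dstar_deriv. Qed.
Next Obligation. by move=> c Y Z b; apply: ac_lin; exact: dstar_ac'. Qed.
Next Obligation.
move=> c Y Z; have := dstar_deriv' Z; have := dstar_deriv' Y.
apply: (@filterS2 _ _ (ae_filter_ringOfSetsType mu)) => x HY HZ ax.
by apply: has_derivative_lin; [exact: HY|exact: HZ].
Qed.
Next Obligation.
move=> c Y Z; have := L2_lin mH c (dstar_lL2 Y) (dstar_lL2 Z).
by congr (L2 _ _); apply/funext => x; rewrite /lexpr; ring.
Qed.

Lemma lexpr_Dlin c Y Z x : lexpr (Dlin c Y Z) x = c * lexpr Y x + lexpr Z x.
Proof. by rewrite /lexpr/=; ring. Qed.

(** Multipliers that preserve the maximal domain. The value and slope at [a] are left open: slope 0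
    serves Green's formula and the concentrated elements, a nonzero slope produces an element with
    [Y a = 0] and [wdata Y = 1]. *)
Record cutoff (b : R) := Cutoff {
  cut :> R -> R ;
  cut' : R -> R ;
  cut'' : R -> R ;
  cut_deriv : forall x, right_derivative a cut x (cut' x) ;
  cut_deriv' : forall x, right_derivative a cut' x (cut'' x) ;
  cut_ac : locally_absolutely_continuous a (fun x => (cut x)%:C) ;
  cut_ac' : locally_absolutely_continuous a (fun x => (cut' x)%:C) ;
  cut_meas'' : measurable_fun (H : set (measurableTypeR R)) cut'' ;
  cut_bound : exists2 C, 0 <= C & forall x, a <= x ->
    [/\ `|cut x| <= C, `|cut' x| <= C & `|cut'' x| <= C] ;
  cut_zero : forall x, b <= x -> [/\ cut x = 0, cut' x = 0 & cut'' x = 0] }.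

Lemma locally_ac_measurable (f : R -> R[i]) : locally_absolutely_continuous a f ->
  cmeasurable H f.
Proof.
move=> acf; split; apply: subspace_continuous_measurable_fun;
  try exact: mH; apply: locally_real_ac_continuous => b.
  exact: ac_Re.
exact: ac_Im.
Qed.

Lemma L2_compact_support (f : R -> R[i]) b (C : R) : cmeasurable H f ->
  (forall x, a <= x <= b -> normc (f x) <= C) ->
  (forall x, b <= x -> f x = 0) -> L2 mu H f.
Proof.
move=> mf fC f0.
apply: (@L2_intro _ mu H mH _ (fun x => C ^+ 2 * \1_(`[a, b]%classic) x + 0)) => //.
  move=> x; rewrite /= in_itv/= andbT => ax; rewrite addr0.
  have [xb|bx] := leP x b; last first.
    by rewrite f0 ?(ltW bx)// normc0 expr0n mulr_ge0// sqr_ge0.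
  rewrite indicE mem_set/= ?in_itv/= ?ax// mulr1.
  have fx : normc (f x) <= C by apply: fC; rewrite ax.
  by rewrite lerXn2r// nnegrE ?normc_ge0// (le_trans _ fx)// normc_ge0.
apply: (Rintegrable_lin mH); last exact: integrable0.
apply: (@integrableS _ _ _ _ setT) => //.
exact: integrable_indic_itv.
Qed.

Lemma Dst_bounded' Y b : exists2 C, 0 <= C & forall x, a <= x <= b -> normc (dval' Y x) <= C.
Proof. exact: ac_bounded (dstar_ac' Y b). Qed.

(** These are the cut element and the terms of its image under [l]. Only [m' * Y'] lacks a square
    integrable factor; there the support of [m'] is compact and [Y'] is bounded on it. The others
    are bounded multiples of [Y] or [lexpr Y]. *)
Lemma L2_cut b (m : cutoff b) Y :
  [/\ L2 mu H (fun x => (m x)%:C * Y x),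
      L2 mu H (fun x => (m x)%:C * lexpr Y x),
      L2 mu H (fun x => (cut' m x)%:C * dval' Y x) &
      L2 mu H (fun x => (cut'' m x)%:C * Y x)].
Proof.
have [C C0 mC] := cut_bound m.
have mm : cmeasurable H (fun x => (m x)%:C) := locally_ac_measurable (cut_ac m).
have mm' : cmeasurable H (fun x => (cut' m x)%:C) := locally_ac_measurable (cut_ac' m).
have mm'' : cmeasurable H (fun x => (cut'' m x)%:C).
  exact: cmeasurable_real (cut_meas'' m).
split.
- apply: (L2_le mH (cmeasurableM mm (L2_measurable (dstar_L2 Y))) C0) (dstar_L2 Y).
  move=> x; rewrite /= in_itv/= andbT => ax; rewrite normcM normc_real ler_wpM2r ?normc_ge0//.
  by have [] := mC x ax.
- apply: (L2_le mH (cmeasurableM mm (L2_measurable (dstar_lL2 Y))) C0) (dstar_lL2 Y).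
  move=> x; rewrite /= in_itv/= andbT => ax; rewrite normcM normc_real ler_wpM2r ?normc_ge0//.
  by have [] := mC x ax.
- have [C' C0' YC'] := Dst_bounded' Y b.
  apply: (@L2_compact_support _ b (C * C')).
  + by apply: (cmeasurableM mm'); apply: locally_ac_measurable; exact: dstar_ac'.
  + move=> x axb; rewrite normcM normc_real ler_pM ?normc_ge0//; last exact: YC'.
    by have [] := mC x; [case/andP: axb|].
  + by move=> x bx; have [_ -> _] := cut_zero m bx; rewrite mul0r.
- apply: (L2_le mH (cmeasurableM mm'' (L2_measurable (dstar_L2 Y))) C0) (dstar_L2 Y).
  move=> x; rewrite /= in_itv/= andbT => ax; rewrite normcM normc_real ler_wpM2r ?normc_ge0//.
  by have [] := mC x ax.
Qed.

Program Definition Dcut b (m : cutoff b) Y : Dst :=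
  @MkDstar R a q (fun x => (m x)%:C * Y x)
    (fun x => (cut' m x)%:C * Y x + (m x)%:C * dval' Y x)
    (fun x => (cut'' m x)%:C * Y x + (cut' m x)%:C * dval' Y x +
      ((cut' m x)%:C * dval' Y x + (m x)%:C * dval'' Y x)) _ _ _ _ _ _.
Next Obligation. by move=> b m Y; have [] := L2_cut m Y. Qed.
Next Obligation.
by move=> b m Y c; apply: acM; [exact: cut_ac|exact: dstar_ac].
Qed.
Next Obligation.
move=> b m Y x ax; apply: has_derivativeM; last exact: dstar_deriv.
by apply: has_derivative_real; exact: cut_deriv.
Qed.
Next Obligation.
move=> b m Y c.
have : absolutely_continuous (fun x => 1 * ((cut' m x)%:C * Y x) + (m x)%:C * dval' Y x) a c.
  apply: ac_lin; apply: acM; [exact: cut_ac'|exact: dstar_ac|exact: cut_ac|exact: dstar_ac'].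
by congr absolutely_continuous; apply/funext => x; rewrite mul1r.
Qed.
Next Obligation.
move=> b m Y; have := dstar_deriv' Y.
apply: (@filterS _ _ (ae_filter_ringOfSetsType mu)) => x HY ax.
have : has_derivative a (fun x => 1 * ((cut' m x)%:C * Y x) + (m x)%:C * dval' Y x) x
    (1 * ((cut'' m x)%:C * Y x + (cut' m x)%:C * dval' Y x) +
    ((cut' m x)%:C * dval' Y x + (m x)%:C * dval'' Y x)).
  apply: has_derivative_lin; apply: has_derivativeM; try exact: HY;
    try exact: dstar_deriv; apply: has_derivative_real; [exact: cut_deriv'|exact: cut_deriv].
by rewrite mul1r; congr has_derivative; apply/funext => t; rewrite mul1r.
Qed.
Next Obligation.
move=> b m Y; have [_ L1 L2 L3] := L2_cut m Y.
have := L2_lin mH (-1) L3 (L2_lin mH (-2) L2 L1).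
by congr (Defs.L2 _ _); apply/funext => x; rewrite /lexpr; ring.
Qed.

Lemma lexpr_Dcut b (m : cutoff b) Y x : lexpr (Dcut m Y) x =
  (m x)%:C * lexpr Y x - 2 * ((cut' m x)%:C * dval' Y x) - (cut'' m x)%:C * Y x.
Proof. by rewrite /lexpr/=; ring. Qed.

Definition gform Y Z : R[i] := ipa a (lexpr Y) Z - ipa a Y (lexpr Z).

(** The boundary term at [a] of two integrations by parts; [gform = bform] says that infinity
    contributes nothing. *)
Definition bform Y Z : R[i] := dval' Y a * (Z a)^*%C - Y a * (dval' Z a)^*%C.

Lemma lexpr_DlinE c Y Z : lexpr (Dlin c Y Z) = (fun x => c * lexpr Y x + lexpr Z x).
Proof. by apply/funext => x; exact: lexpr_Dlin. Qed.

Lemma gform_linl c X Y Z : gform (Dlin c X Y) Z = c * gform X Z + gform Y Z.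
Proof.
rewrite /gform /ipa lexpr_DlinE !(ip_linl mH)//; try exact: dstar_L2; try exact: dstar_lL2.
by ring.
Qed.

Lemma gform_conj Y Z : gform Z Y = - (gform Y Z)^*%C.
Proof.
rewrite /gform /ipa (ip_conj mH (dstar_L2 Y)) ?(ip_conj mH (dstar_lL2 Y));
  try exact: dstar_L2; try exact: dstar_lL2.
by rewrite conjcB opprB.
Qed.

Lemma bform_conj Y Z : bform Z Y = - (bform Y Z)^*%C.
Proof. by rewrite /bform conjcB !conjE; ring. Qed.

Lemma green_compact_support b Y Z :
  (forall x, b <= x -> [/\ Z x = 0, dval' Z x = 0 & lexpr Z x = 0]) ->
  gform Y Z = bform Y Z.
Proof.
wlog ab : b / a <= b => [WL bZ|bZ].
  apply: (WL (Num.max a b)); first by rewrite le_max lexx.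
  by move=> x; rewrite ge_max => /andP[_ /bZ].
(* [W] is the Wronskian of [Y] and the conjugate of [Z]. Its derivative is [g], because the terms in
   the real function [q] cancel. *)
pose W x := -1 * (Y x * (dval' Z x)^*%C) + dval' Y x * (Z x)^*%C.
pose g x := -1 * (lexpr Y x * (Z x)^*%C) + Y x * (lexpr Z x)^*%C.
have ig : cintegrable mu H g.
  apply: (cintegrable_lin mH); apply: (ip_integrable mH);
    by [exact: dstar_L2|exact: dstar_lL2].
have Hb : `[a, b]%classic `<=` H.
  by move=> x /=; rewrite !in_itv/= => /andP[->].
have WE : cintegral mu `[a, b] g = W b - W a.
  apply: ac_FTC => //.
  - apply: ac_lin; apply: acM; try (apply: acJ);
      by [exact: dstar_ac|exact: dstar_ac'].
  - by case: ig => ig _; apply: integrableS ig => //; exact: mH.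
  - by case: ig => _ ig; apply: integrableS ig => //; exact: mH.
  - have := dstar_deriv' Z; have := dstar_deriv' Y.
    apply: (@filterS2 _ _ (ae_filter_ringOfSetsType mu)) => x HY HZ ax.
    have dY := dstar_deriv Y ax; have dZ := dstar_deriv Z ax.
    have := has_derivative_lin (-1)
      (has_derivativeM dY (has_derivativeJ (HZ ax)))
      (has_derivativeM (HY ax) (has_derivativeJ dZ)).
    congr has_derivative.
    by rewrite /g /lexpr !conjE; ring.
have gE : cintegral mu H g = - gform Y Z.
  rewrite (cintegral_lin mH); try (apply: (ip_integrable mH);
    by [exact: dstar_L2|exact: dstar_lL2]).
  by rewrite /gform /ipa /ip; ring.
have gb : cintegral mu H g = cintegral mu `[a, b] g.
  have H2 u : (forall x, b <= x -> u x = 0) ->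
      \int[mu]_(x in H) u x = \int[mu]_(x in `[a, b]) u x.
    move=> u0; rewrite Rintegral_mkcond [RHS]Rintegral_mkcond.
    apply: eq_Rintegral => x _; rewrite !patchE.
    have [xb|bx] := leP x b; last first.
      by rewrite u0 ?ltW//; do 2 case: ifP.
    congr (if _ then _ else _); apply/idP/idP; rewrite !inE/= !in_itv/= ?andbT.
      by move=> ->.
    by case/andP.
  apply: complex_ext => /=; apply: H2 => x /bZ[Zx _ lZx];
    by rewrite /g lZx Zx conjc0 !mulr0 addr0.
move: gE; rewrite gb WE /W; have [-> -> _] := bZ b (lexx b).
rewrite conjc0 !mulr0 addr0 => E; rewrite -[LHS]opprK -E /bform; ring.
Qed.

Lemma Dcut_support b (m : cutoff b) Y x : b <= x ->
  [/\ Dcut m Y x = 0, dval' (Dcut m Y) x = 0 & lexpr (Dcut m Y) x = 0].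
Proof.
move=> /(cut_zero m)[m0 m1 m2].
by rewrite lexpr_Dcut /= m0 m1 m2 !mul0r mulr0 !subr0 addr0.
Qed.

Lemma Btilde_Dst Y : Y a = 0 -> dval' Y a = 0 -> Btilde a q Y (lexpr Y).
Proof.
move=> Ya Y'a; split; [exact: dstar_L2|exact: dstar_lL2|].
by exists Y; split => //; exact: aeq_refl.
Qed.

(* The behaviour at infinity is controlled by the symmetry of [Btilde] alone: a
   cutoff near [a] splits both arguments into a compactly supported part, where
   integration by parts applies, and a part in the domain of [Btilde]. *)
Lemma green b (m : cutoff b) Y Z : symmetric_op mu H (Btilde a q) ->
  m a = 1 -> cut' m a = 0 -> gform Y Z = bform Y Z.
Proof.
move=> [_ sB] ma m'a.
pose rest X := Dlin (-1) (Dcut m X) X.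
have rest0 X : rest X a = 0 /\ dval' (rest X) a = 0.
  by rewrite /= ma m'a; split; ring.
have green_cut X X' : gform X (Dcut m X') = bform X (Dcut m X').
  apply: (@green_compact_support b) => x; exact: Dcut_support.
have split2 X X' : gform (Dcut m X') X + gform (rest X') X = gform X' X.
  by rewrite gform_linl; ring.
rewrite -split2 gform_conj green_cut -bform_conj.
rewrite gform_conj -split2 (gform_conj (rest Y)) green_cut -bform_conj.
have -> : gform (rest Z) (rest Y) = 0.
  have [rZ r'Z] := rest0 Z; have [rY r'Y] := rest0 Y.
  have [_ _ /(_ _ _ (Btilde_Dst rZ r'Z)) E] := sB _ _ (Btilde_Dst rY r'Y).
  by rewrite /gform /ipa E subrr.
rewrite addr0; have [rY r'Y] := rest0 Y.
rewrite -bform_conj /bform rY r'Y /= ma m'a; ring.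
Qed.

End MaximalDomain.

(** * Explicit cutoffs at distance [d] *)

Section Cutoffs.
Context {R : realType} (a : R) (d k : R).
Hypotheses (d0 : 0 < d) (k0 : 0 <= k).
Local Notation mu := (@lebesgue_measure R).

Let dn0 : d != 0 := lt0r_neq0 d0.

Let s x := (x - a) / d.
Let p x := Num.max 0 (1 - s x).

Let pM x : p x * (1 - s x) = p x * p x.
Proof. by rewrite /p; case: (leP 0 (1 - s x)) => //; rewrite !mul0r. Qed.

Let p0 x : 0 <= p x. Proof. by rewrite /p le_max lexx. Qed.

Let p_lip x t : `|p t - p x| <= d^-1 * `|t - x|.
Proof.
have -> : d^-1 * `|t - x| = `|s t - s x|.
  by rewrite /s -mulrBl normrM normfV (gtr0_norm d0) mulrC; congr (`|_| * _); ring.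
rewrite /p; have [h1|h1] := leP 0 (1 - s t); have [h2|h2] := leP 0 (1 - s x);
  rewrite ler_norml; case: (ler0P (s t - s x)); lra.
Qed.

(** This is [p^3 * (1 + k * s)]: the cube makes the second derivative continuous at the end of the
    support, and the slope at [a] is [(k - 3) / d], so [k = 3] gives a flat start. One factor [p] is
    written [1 - s], so that [p^2] is the only truncated function to differentiate. *)
Let cut0 x := p x * p x * ((1 - s x) * (1 + k * s x)).
Let cut1 x := p x * p x * ((k - 3 - 4 * k * s x) / d).
Let cut2 x := (-2 * p x * (k - 3 - 4 * k * s x) - 4 * k * (p x * p x)) / d ^+ 2.

Let deriv_s x : right_derivative a s x d^-1.
Proof.
apply: (@right_derivative_quadratic _ _ _ _ _ 0) => // t.
rewrite mul0r normr_le0; apply/eqP; rewrite /s; field; exact: dn0.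
Qed.

(** The convex function [max 0 A ^ 2] stays within [(A - B) ^ 2] of its tangent at [B]. The eight
    goals are the two bounds in each of the four sign cases. *)
Let deriv_pp x : right_derivative a (fun t => p t * p t) x (-2 * p x / d).
Proof.
apply: (@right_derivative_quadratic _ _ _ _ _ (d ^- 2)) => [|t].
  by rewrite invr_ge0 sqr_ge0.
have -> : -2 * p x / d * (t - x) = -2 * p x * (s t - s x) by rewrite /s; field; exact: dn0.
have -> : d ^- 2 * (t - x) ^+ 2 = (s t - s x) ^+ 2 by rewrite /s; field; exact: dn0.
have -> : s t - s x = (1 - s x) - (1 - s t) by ring.
rewrite /p; move: (1 - s x) (1 - s t) => B A.
case: (leP 0 A) => A0; case: (leP 0 B) => B0; rewrite ler_norml; apply/andP; split.
- have := sqr_ge0 (A - B); nra.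
- have := sqr_ge0 (A - B); nra.
- have := sqr_ge0 A; have := sqr_ge0 (B - A); nra.
- have := sqr_ge0 B; nra.
- have := sqr_ge0 B; have := sqr_ge0 (B - A); nra.
- have := sqr_ge0 A; nra.
- have := sqr_ge0 (B - A); nra.
- have := sqr_ge0 (B - A); nra.
Qed.

Let deriv_lin (c e x : R) : right_derivative a (fun t => c + e * s t) x (e / d).
Proof.
have := right_derivativeD (right_derivative_cst a c x)
  (right_derivativeM (right_derivative_cst a e x) (@deriv_s x)).
by rewrite mul0r !add0r.
Qed.

Let cut_d x : right_derivative a cut0 x (cut1 x).
Proof.
have h1 : right_derivative a (fun t => 1 - s t) x (- d^-1).
  have := @deriv_lin 1 (-1) x; rewrite mulN1r.
  by congr right_derivative; apply/funext => t; rewrite mulN1r.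
have := right_derivativeM (@deriv_pp x) (right_derivativeM h1 (@deriv_lin 1 k x)).
congr right_derivative; rewrite /cut1.
have -> : -2 * p x / d * ((1 - s x) * (1 + k * s x)) =
  -2 / d * (p x * p x) * (1 + k * s x) by rewrite -pM; field; exact: dn0.
by field; exact: dn0.
Qed.

Let cut_d' x : right_derivative a cut1 x (cut2 x).
Proof.
have h1 : right_derivative a (fun t => (k - 3 - 4 * k * s t) / d) x (- (4 * k / d) / d).
  have := @deriv_lin ((k - 3) / d) (- (4 * k / d)) x.
  by congr right_derivative; apply/funext => t; field; exact: dn0.
have := right_derivativeM (@deriv_pp x) h1.
by congr right_derivative; rewrite /cut2; field; exact: dn0.
Qed.

Let ac_p b : absolutely_continuous (fun x => (p x)%:C) a b.
Proof.
apply: (@ac_lipschitz _ p _ _ d^-1) => [|x t]; first by rewrite invr_ge0 ltW.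
exact: p_lip.
Qed.

Let ac_aff (c e b : R) : absolutely_continuous (fun x => (c + e * s x)%:C) a b.
Proof.
apply: (@ac_lipschitz _ (fun x => c + e * s x) _ _ (`|e| / d)) => [|x t].
  by rewrite divr_ge0// ltW.
have -> : c + e * s t - (c + e * s x) = e * ((t - x) / d) by rewrite /s; field; exact: dn0.
by rewrite !normrM normfV (gtr0_norm d0) mulrA mulrAC.
Qed.

Let cut_ac0 : locally_absolutely_continuous a (fun x => (cut0 x)%:C).
Proof.
move=> b; have := acM (acM (@ac_p b) (@ac_p b))
  (acM (@ac_aff 1 (-1) b) (@ac_aff 1 k b)).
congr absolutely_continuous; apply/funext => x.
by rewrite -!rmorphM; congr (_%:C); rewrite /cut0; ring.
Qed.

Let cut_ac1 : locally_absolutely_continuous a (fun x => (cut1 x)%:C).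
Proof.
move=> b; have := acM (acM (@ac_p b) (@ac_p b))
  (@ac_aff ((k - 3) / d) (- (4 * k / d)) b).
congr absolutely_continuous; apply/funext => x.
by rewrite -!rmorphM; congr (_%:C); rewrite /cut1; field; exact: dn0.
Qed.

Let cut_m2 : measurable_fun (`[a, +oo[%classic : set (measurableTypeR R)) cut2.
Proof.
have acl : locally_absolutely_continuous a (fun x => (cut2 x)%:C).
  move=> b; have := ac_lin (- (4 * k / d ^+ 2))%:C (acM (@ac_p b) (@ac_p b))
    (acM (@ac_p b) (@ac_aff (-2 * (k - 3) / d ^+ 2) (8 * k / d ^+ 2) b)).
  congr absolutely_continuous; apply/funext => x.
  by rewrite -!rmorphM -rmorphD; congr (_%:C); rewrite /cut2; field; exact: dn0.
by have [] := locally_ac_measurable acl.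
Qed.

(** The sum of the absolute values of the coefficients in [- 2 k p + 6 p + 8 k p s - 4 k p^2], the
    numerator of [cut2]; it also bounds [cut0] and the numerator of [cut1]. *)
Let C := 6 + 14 * k.

Let cut_b x : a <= x ->
  [/\ `|cut0 x| <= C, `|cut1 x| <= C / d & `|cut2 x| <= C / d ^+ 2].
Proof.
move=> ax; have s0 : 0 <= s x by rewrite divr_ge0 ?subr_ge0// ltW.
have p1 : p x <= 1 by rewrite /p ge_max ler01/= gerBl.
have ps : p x * s x <= 1.
  by rewrite /p; have [h|h] := leP 0 (1 - s x); nra.
have pps : 0 <= p x * s x by rewrite mulr_ge0.
have pp1 : p x * p x <= 1 by have := p0 x; nra.
have pps1 : p x * p x * s x <= 1 by rewrite -mulrA; have := p0 x; nra.
have pps0 : 0 <= p x * p x * s x by rewrite mulr_ge0// mulr_ge0.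
have kps : k * (p x * s x) <= k by rewrite -[leRHS]mulr1 ler_wpM2l.
have kps0 : 0 <= k * (p x * s x) by rewrite mulr_ge0.
have kpps : k * (p x * p x * s x) <= k by rewrite -[leRHS]mulr1 ler_wpM2l.
have kpps0 : 0 <= k * (p x * p x * s x) by rewrite mulr_ge0.
have kp : k * p x <= k by rewrite -[leRHS]mulr1 ler_wpM2l.
have kp0 : 0 <= k * p x by rewrite mulr_ge0.
have kpp : k * (p x * p x) <= k by rewrite -[leRHS]mulr1 ler_wpM2l.
have kpp0 : 0 <= k * (p x * p x) by rewrite mulr_ge0// mulr_ge0.
split.
- have -> : cut0 x = p x * (p x * (p x + k * (p x * s x))).
    have -> : cut0 x = p x * (p x * (1 - s x)) * (1 + k * s x) by rewrite /cut0; ring.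
    by rewrite pM; ring.
  rewrite !normrM (ger0_norm (p0 x)) ger0_norm ?addr_ge0//.
  have h : p x + k * (p x * s x) <= 1 + k by lra.
  have h0 : 0 <= p x + k * (p x * s x) by rewrite addr_ge0.
  have := p0 x; rewrite /C; move: (p x) (p x + _) p1 h h0 => P Q P1 Q1 Q0 P0.
  have h1 : P * P * Q <= 1 * Q by rewrite ler_wpM2r//; nra.
  by rewrite mulrA; lra.
- rewrite /cut1 mulrA normrM normfV (gtr0_norm d0) ler_wpM2r ?invr_ge0 ?(ltW d0)//.
  have -> : p x * p x * (k - 3 - 4 * k * s x) =
    k * (p x * p x) - 3 * (p x * p x) - 4 * (k * (p x * p x * s x)) by ring.
  have := mulr_ge0 (p0 x) (p0 x); rewrite ler_norml /C => h; apply/andP; split; lra.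
- rewrite /cut2 normrM normfV (@gtr0_norm _ (d ^+ 2)) ?exprn_gt0//.
  rewrite ler_wpM2r ?invr_ge0 ?sqr_ge0//.
  have -> : -2 * p x * (k - 3 - 4 * k * s x) - 4 * k * (p x * p x) =
    - 2 * (k * p x) + 6 * p x + 8 * (k * (p x * s x)) - 4 * (k * (p x * p x)) by ring.
  have := p0 x; rewrite ler_norml /C => h; apply/andP; split; lra.
Qed.

Lemma cutoff_exists : exists m : cutoff a (a + d),
  [/\ m a = 1, cut' m a = (k - 3) / d & forall x, a <= x ->
    [/\ `|m x| <= C, `|cut' m x| <= C / d & `|cut'' m x| <= C / d ^+ 2]].
Proof.
have cb : exists2 C' : R, 0 <= C' & forall x, a <= x ->
    [/\ `|cut0 x| <= C', `|cut1 x| <= C' & `|cut2 x| <= C'].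
  have C0 : 0 <= C by rewrite /C addr_ge0 ?mulr_ge0.
  have C1 : 0 <= C / d by rewrite divr_ge0// ltW.
  have C2 : 0 <= C / d ^+ 2 by rewrite divr_ge0// sqr_ge0.
  exists (C + (C / d + C / d ^+ 2)) => [|x /cut_b[]]; first exact: (addr_ge0 C0 (addr_ge0 C1 C2)).
  by split; lra.
have cz x : a + d <= x -> [/\ cut0 x = 0, cut1 x = 0 & cut2 x = 0].
  move=> adx; have px : p x = 0.
    rewrite /p; apply/max_idPl; rewrite subr_le0 /s ler_pdivlMr// mul1r.
    by rewrite lerBrDl.
  by rewrite /cut0 /cut1 /cut2 px; split; ring.
exists (Cutoff cut_d cut_d' cut_ac0 cut_ac1 cut_m2 cb cz); split => //=.
- rewrite /cut0 /p /s subrr mul0r subr0 max_r//; ring.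
- rewrite /cut1 /p /s subrr mul0r subr0 max_r//; ring.
Qed.

End Cutoffs.

(** * Elements of the maximal domain concentrated near [a] *)

Section Concentration.
Context {R : realType} (a : R) (q : R -> R).
Local Notation mu := (@lebesgue_measure R).
Local Notation H := `[a, +oo[%classic.
Local Notation Dst := (Dstar a q).
Local Notation mH := (measurable_halfline a).
Implicit Types (Y Z : Dst).

(** Integration of the derivative from [a]. Bounding real and imaginary parts separately costs the
    factor 2. *)
Lemma Dst_linear_bound Z (B : R) b : Z a = 0 ->
  (forall x, a <= x <= b -> normc (dval' Z x) <= B) ->
  forall x, a <= x <= b -> normc (Z x) <= 2 * (B * (x - a)).
Proof.
move=> Za ZB x /andP[ax xb].
have sub : `[a, x]%classic `<=` H by move=> t /=; rewrite !in_itv/= => /andP[->].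
have [m1 m2] := locally_ac_measurable (dstar_ac' Z).
have icst : mu.-integrable `[a, x] (EFin \o (fun=> B)).
  have i1 : mu.-integrable `[a, x] (EFin \o \1_(`[a, x]%classic)).
    by apply: (@integrableS _ _ _ _ setT) => //; exact: integrable_indic_itv.
  have := Rintegrable_lin (measurable_itv _) B i1 (integrable0 _ _).
  apply: eq_integrable => // t tax /=.
  by rewrite addr0 indicE tax mulr1.
have bnd (u : R -> R) (v : R -> R) : (forall t, `|v t| <= normc (dval' Z t)) ->
    measurable_fun (H : set (measurableTypeR R)) v ->
    real_ac u a x -> u a = 0 ->
    (forall t, a <= t -> right_derivative a u t (v t)) -> `|u x| <= B * (x - a).
  move=> vZ mv acu ua du.
  have vB t : `[a, x]%classic t -> `|v t| <= B.
    rewrite /= in_itv/= => /andP[at_ tx]; apply: le_trans (vZ t) _; apply: ZB.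
    by rewrite at_ (le_trans tx).
  have iv : mu.-integrable `[a, x] (EFin \o v).
    apply: (Rintegrable_le _ _ vB icst) => //.
    exact: measurable_funS mv.
  have := real_ac_FTC ax acu iv; rewrite ua subr0 => <-; last first.
    apply: (@filterE _ _ (ae_filter_ringOfSetsType mu)) => t /andP[at_ _].
    exact: du.
  apply: le_trans (le_normr_Rintegral _ iv) _ => //.
  apply: (@le_trans _ _ (\int[mu]_(t in `[a, x]) B)).
    by apply: le_Rintegral => //; exact: integrable_norm.
  rewrite Rintegral_cst//= lebesgue_measure_itv/= lte_fin.
  move: ax; rewrite le_eqVlt => /predU1P[->|ax]; first by rewrite ltxx subrr mulr0.
  by rewrite ax.
have dZ t : a <= t -> has_derivative a Z t (dval' Z t) := @dstar_deriv _ _ _ Z t.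
have h1 : `|complex.Re (Z x)| <= B * (x - a).
  apply: (bnd (fun t => complex.Re (Z t)) (fun t => complex.Re (dval' Z t))) => //.
  - by move=> t; exact: normr_Re.
  - exact: ac_Re (dstar_ac Z x).
  - by rewrite Za.
  - by move=> t /dZ[].
have h2 : `|complex.Im (Z x)| <= B * (x - a).
  apply: (bnd (fun t => complex.Im (Z t)) (fun t => complex.Im (dval' Z t))) => //.
  - by move=> t; exact: normr_Im.
  - exact: ac_Im (dstar_ac Z x).
  - by rewrite Za.
  - by move=> t /dZ[].
rewrite (complexE (Z x)); apply: le_trans (normcD _ _) _.
rewrite normcM !normc_real.
have -> : normc 'i%C = 1 :> R by rewrite /= expr0n expr1n add0r sqrtr1.
lra.
Qed.

(* [Y] is [Z] cut off at distance [d] from [a]: the terms [m'] and [m''] of size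
   [1/d] and [1/d^2] are balanced by [Z = O(d)] and the length [d] of the support. *)
Lemma concentrated_elements Z e : Z a = 0 -> 0 < e ->
  exists Y, [/\ Y a = 0, dval' Y a = dval' Z a, sqnorm mu H Y <= e &
    complex.Re (ipa a (lexpr Y) Y) <= e].
Proof.
move=> Za e0.
have [B B0 ZB] := Dst_bounded' Z (a + 1).
have ZB2 := Dst_linear_bound Za ZB.
(* The bound of [cutoff_exists] at [k = 3], where the cutoff is flat at [a]. *)
pose C : R := 6 + 14 * 3.
(* Chosen so that [d * K] bounds both the norm and the form of the cut element. With
   [L = |lexpr Z|], the integrand of the form is at most [(C L + 4 C B / d) (2 B C d)] on the
   support; [2 L <= L^2 + 1] gives the first two terms of [K], and the product of the two constants
   the last. *)
pose K := B * C ^+ 2 * sqnorm mu H (lexpr Z) + B * C ^+ 2 + 8 * B ^+ 2 * C ^+ 2.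
have C0 : 0 <= C by rewrite /C; lra.
have N0 : 0 <= sqnorm mu H (lexpr Z) by exact: sqnorm_ge0.
have K0 : 0 <= K.
  by rewrite /K !addr_ge0// !mulr_ge0// ?sqr_ge0.
pose d := Num.min 1 (e / (K + 1)).
have d0 : 0 < d by rewrite lt_min ltr01 divr_gt0//; lra.
have d1 : d <= 1 by rewrite ge_min lexx.
have dK : d * (K + 1) <= e.
  by rewrite -ler_pdivlMr; [rewrite ge_min lexx orbT|lra].
have [m [ma m'a mC]] := cutoff_exists a d0 (ler0n R 3).
pose ind : R -> R := \1_(`[a, a + d]%classic).
have i1 : mu.-integrable H (EFin \o ind).
  by apply: (@integrableS _ _ _ _ setT) => //; exact: integrable_indic_itv.
have int1 : \int[mu]_(x in H) ind x = d.
  rewrite /Rintegral integral_indic//.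
  rewrite (_ : `[a, a + d]%classic `&` H = `[a, a + d]%classic); last first.
    by apply/setIidPl => x /=; rewrite !in_itv/= => /andP[->].
  by rewrite /= lebesgue_measure_itv/= lte_fin ltrDl d0/= addrAC subrr add0r.
have indE x : a <= x <= a + d -> ind x = 1.
  by move=> ax; rewrite /ind indicE mem_set//= in_itv.
have ind0 x : 0 <= ind x by rewrite /ind indicE.
have mZ x : a <= x <= a + d -> normc (Dcut m Z x) <= 2 * B * C * d.
  move=> /andP[ax xd]; have [m0 _ _] := mC x ax.
  rewrite /= normcM normc_real.
  apply: (@le_trans _ _ (C * (2 * (B * (x - a))))).
    by rewrite ler_pM ?normc_ge0// ZB2// ax/=; lra.
  by rewrite [leRHS](_ : _ = C * (2 * (B * d))); [rewrite !ler_wpM2l//; lra|ring].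
have lmZ x : a <= x <= a + d ->
    normc (lexpr (Dcut m Z) x) <= C * normc (lexpr Z x) + 4 * C * B / d.
  move=> /andP[ax xd]; have [m0 m1 m2] := mC x ax.
  rewrite lexpr_Dcut -addrA; apply: le_trans (normcD _ _) _; apply: lerD.
    by rewrite normcM normc_real ler_wpM2r// normc_ge0.
  rewrite -opprD (normcN (_ : R[i])); apply: le_trans (normcD _ _) _.
  have n2 : normc (2 : R[i]) = 2.
    by rewrite -[2 : R[i]](rmorph_nat (real_complex R)) normc_real normr_nat.
  rewrite !normcM !normc_real n2.
  have h1 : 2 * (`|cut' m x| * normc (dval' Z x)) <= 2 * (C / d * B).
    by rewrite ler_wpM2l// ler_pM ?normc_ge0// ZB// ax/=; lra.
  have h2 : `|cut'' m x| * normc (Z x) <= C / d ^+ 2 * (2 * (B * d)).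
    rewrite ler_pM ?normc_ge0//; apply: (@le_trans _ _ (2 * (B * (x - a)))).
      by apply: ZB2; rewrite ax/=; lra.
    by rewrite !ler_wpM2l//; lra.
  rewrite [leRHS](_ : _ = 2 * (C / d * B) + C / d ^+ 2 * (2 * (B * d))); first exact: lerD.
  by field; exact: lt0r_neq0.
have out x : a + d < x -> Dcut m Z x = 0.
  by move=> dx; have [] := Dcut_support m Z (ltW dx).
exists (Dcut m Z); split.
- by rewrite /= Za mulr0.
- by rewrite /= Za mulr0 ma mul1r add0r.
- apply: (@le_trans _ _ ((2 * B * C * d) ^+ 2 * d)); last first.
    have -> : (2 * B * C * d) ^+ 2 * d = 4 * B ^+ 2 * C ^+ 2 * (d * d) * d by ring.
    apply: le_trans dK; rewrite mulrC ler_wpM2l//; first lra.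
    have h : 0 <= 4 * B ^+ 2 * C ^+ 2 by rewrite !mulr_ge0// sqr_ge0.
    have h' : 4 * B ^+ 2 * C ^+ 2 * (d * d) <= 4 * B ^+ 2 * C ^+ 2 * 1.
      by rewrite ler_wpM2l//; nra.
    have h2 : 0 <= B * C ^+ 2 * sqnorm mu H (lexpr Z) + B * C ^+ 2.
      by rewrite !addr_ge0 ?mulr_ge0// sqr_ge0.
    by rewrite /K; lra.
  rewrite [leRHS](_ : _ = \int[mu]_(x in H) ((2 * B * C * d) ^+ 2 * ind x)); last first.
    by rewrite RintegralZl// int1.
  apply: le_Rintegral => //.
  + exact: (L2_integrable (dstar_L2 (Dcut m Z))).
  + have := Rintegrable_lin mH ((2 * B * C * d) ^+ 2) i1 (integrable0 _ _).
    by apply: eq_integrable => // x _ /=; rewrite addr0.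
  + move=> x; rewrite /= in_itv/= andbT => ax; have [xd|dx] := leP x (a + d).
      rewrite indE ?ax// mulr1 lerXn2r ?nnegrE ?normc_ge0//.
        by rewrite !mulr_ge0// ltW.
      by apply: mZ; rewrite ax.
    by move: (out _ dx) => /= ->; rewrite normc0 expr0n/= mulr_ge0// sqr_ge0.
- pose V x := B * C ^+ 2 * d * normc (lexpr Z x) ^+ 2 +
    ((B * C ^+ 2 * d + 8 * B ^+ 2 * C ^+ 2) * ind x + 0).
  have i2 := L2_integrable (dstar_lL2 Z).
  have iV : mu.-integrable H (EFin \o V).
    apply: (Rintegrable_lin mH) => //; apply: (Rintegrable_lin mH) => //.
    exact: integrable0.
  apply: (@le_trans _ _ (\int[mu]_(x in H) V x)).
    have [iR _] := ip_integrable mH (dstar_lL2 (Dcut m Z)) (dstar_L2 (Dcut m Z)).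
    apply: (le_Rintegral mH iR iV) => x; rewrite /= in_itv/= andbT => ax.
    apply: le_trans (ler_norm _) _; apply: le_trans (normr_Re _) _.
    rewrite normcM normcJ /V addr0; have L0 := normc_ge0 (lexpr Z x).
    have hBC : 0 <= B * C ^+ 2 by rewrite mulr_ge0// sqr_ge0.
    have [xd|dx] := leP x (a + d); last first.
      move: (out _ dx) => /= ->; rewrite normc0 mulr0 !addr_ge0 ?mulr_ge0//
        ?addr_ge0 ?mulr_ge0 ?sqr_ge0//; exact: ltW.
    have axd : a <= x <= a + d by rewrite ax.
    rewrite indE// mulr1.
    apply: (@le_trans _ _ ((C * normc (lexpr Z x) + 4 * C * B / d) * (2 * B * C * d))).
      by rewrite ler_pM ?normc_ge0//; [exact: lmZ|exact: mZ].
    rewrite [leLHS](_ : _ = B * C ^+ 2 * d * (2 * normc (lexpr Z x)) + 8 * B ^+ 2 * C ^+ 2);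
      last by field; exact: lt0r_neq0.
    have hL : 2 * normc (lexpr Z x) <= normc (lexpr Z x) ^+ 2 + 1.
      by have := sqr_ge0 (normc (lexpr Z x) - 1); lra.
    have hd : 0 <= B * C ^+ 2 * d by rewrite mulr_ge0// ltW.
    have := ler_wpM2l hd hL; rewrite mulrDr mulr1; lra.
  rewrite (Rintegral_lin mH)//; last first.
    by apply: (Rintegrable_lin mH) => //; exact: integrable0.
  rewrite (Rintegral_lin mH) ?int1//; last exact: integrable0.
  rewrite Rintegral_cst// mul0r addr0 -/(sqnorm mu H (lexpr Z)).
  apply: le_trans dK.
  have -> : B * C ^+ 2 * d * sqnorm mu H (lexpr Z) +
      (B * C ^+ 2 * d + 8 * B ^+ 2 * C ^+ 2) * d =
    d * (B * C ^+ 2 * sqnorm mu H (lexpr Z) + B * C ^+ 2 * d + 8 * B ^+ 2 * C ^+ 2) by ring.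
  rewrite ler_wpM2l ?(ltW d0)//.
  have hh : B * C ^+ 2 * d <= B * C ^+ 2.
    by rewrite -[leRHS]mulr1 ler_wpM2l// mulr_ge0// sqr_ge0.
  apply: (@le_trans _ _ K); last by rewrite lerDl.
  by rewrite /K lerD2r lerD2l.
Qed.

End Concentration.

(** * Boundary data *)

Section BoundaryData.
Context {R : realType} (a : R) (q : R -> R) (theta : R).
Local Notation mu := (@lebesgue_measure R).
Local Notation H := `[a, +oo[%classic.
Local Notation Dst := (Dstar a q).
Local Notation mH := (measurable_halfline a).
Local Notation Bt := (Btilde a q).
Local Notation Bth := (Btheta a q theta).
Local Notation theta' := theta%:C.
Implicit Types (Y Z : Dst).

Hypothesis B_symmetric : symmetric_op mu H Bt.
Hypothesis B_deficiency : deficiency_indices_1_1 mu H Bt.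
Hypothesis Btheta_positive : nonneg_sa_extension mu H Bt Bth.

Definition wdata Y : R[i] := dval' Y a - theta' * Y a.

Lemma wdata_Dlin c Y Z : wdata (Dlin c Y Z) = c * wdata Y + wdata Z.
Proof. by rewrite /wdata/=; ring. Qed.

Lemma bform_wdata Y Z : bform Y Z = wdata Y * (Z a)^*%C - Y a * (wdata Z)^*%C.
Proof. by rewrite /bform /wdata !conjE; ring. Qed.

Lemma greenE Y Z : gform Y Z = bform Y Z.
Proof.
have [m [ma m'a _]] := cutoff_exists a (@ltr01 R) (ler0n R 3).
by apply: (green (m := m)) => //; rewrite m'a subrr mul0r.
Qed.

Lemma Btilde_L2 y f : Bt y f -> L2 mu H y. Proof. by case. Qed.

Lemma orthogonal_Btilde f : L2 mu H f ->
  (forall Y, Y a = 0 -> dval' Y a = 0 -> ip mu H f Y = 0) -> aeqa a f (fun=> 0).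
Proof.
move=> Lf f0; have [dB _] := B_symmetric.
apply: (dense_orthogonal0 mH dB Btilde_L2 Lf) => y g [Ly _ [Y [[Ya Y'a] yY _]]].
by rewrite -(f0 Y Ya Y'a); apply: (ip_aeq mH) => //;
  [exact: dstar_L2|exact: aeq_refl].
Qed.

(** Otherwise [Btheta] would have no more elements than [Btilde]. A deficiency vector at ['i] would
    then lie in the adjoint of [Btheta], hence in [Btheta], as an eigenvector for [- 'i], against
    nonnegativity. *)
Lemma exists_Btheta_nonzero : exists Y, Y a != 0 /\ wdata Y = 0.
Proof.
apply: contrapT => noY.
have Ya0 Y : wdata Y = 0 -> Y a = 0.
  by move=> wY; apply/eqP; apply: contrapT => /negP Ya; apply: noY; exists Y.
have [[e [Le e0 /(_ _ Le)[_ He]]] _] := B_deficiency.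
have [_ De] : defect_space mu H Bt 'i%C e.
  by apply: He; exists 1; apply: aeq_eq => x _; rewrite mul1r.
have [[_ saB] nnB _] := Btheta_positive.
have Le' : L2 mu H (fun x => - 'i%C * e x) by exact: (L2Z mH).
have : Bth e (fun x => - 'i%C * e x).
  apply/saB; split => // y f [Ly Lf [Y [bY yY fY]]].
  have wY : wdata Y = 0 by rewrite /wdata bY subrr.
  have /De : Bt y f.
    split => //; exists Y; split => //; rewrite bY; split; last rewrite Ya0 ?mulr0//.
    exact: Ya0.
  have -> : (fun x => f x - 'i%C * y x) = (fun x => - 'i%C * y x + f x).
    by apply/funext => x; ring.
  rewrite (ip_linl mH)// => E.
  rewrite (ipZr mH)// conjcN.
  have -> : ('i%C : R[i])^*%C = - 'i%C by apply: complex_ext => /=; rewrite ?oppr0.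
  by rewrite opprK; apply/eqP; rewrite -subr_eq0 addrC -mulNr E.
move=> /nnB; rewrite (ipZl mH)// (ip_self _ mH).
rewrite lecE !ReImE/= => /andP[+ _].
rewrite !(mul0r, mulr0, oppr0, mul1r, mulN1r, add0r, addr0) oppr_eq0 => /eqP n0.
exact/e0/(sqnorm_eq0 mH).
Qed.

Lemma exists_Y0 : exists Y, Y a = 1 /\ wdata Y = 0.
Proof.
have [Y [Ya wY]] := exists_Btheta_nonzero.
(* A multiple [c * Y] is encoded as [Dlin (c - 1) Y Y], here with [c = (Y a)^-1]. *)
exists (Dlin ((Y a)^-1 - 1) Y Y); rewrite wdata_Dlin wY/=; split; last by ring.
by field.
Qed.

Lemma exists_Y1 : exists Y, Y a = 0 /\ wdata Y = 1.
Proof.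
have [Y [Ya wY]] := exists_Y0.
(* With [k = 0] and [d = 1] the cutoff has slope -3 at [a], so [Y - m * Y] has value 0 and slope 3
   there. *)
have [m [ma m'a _]] := cutoff_exists a (@ltr01 R) (lexx (0 : R)).
pose X := Dlin (-1) (Dcut m Y) Y.
exists (Dlin (3^-1 - 1) X X); rewrite !wdata_Dlin wY /wdata /= ma m'a Ya.
have -> : dval' Y a = theta' by move: wY; rewrite /wdata Ya => /eqP; rewrite subr_eq0 mulr1 => /eqP.
have -> : ((0 - 3) / 1)%:C = - 3 :> R[i].
  by rewrite sub0r divr1 rmorphN; congr (- _); exact: rmorph_nat.
by split; field.
Qed.

Lemma exists_data u w : exists Y, Y a = u /\ wdata Y = w.
Proof.
have [Y0 [Y0a wY0]] := exists_Y0; have [Y1 [Y1a wY1]] := exists_Y1.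
pose Z := Dlin (-1) Y0 Y0.
exists (Dlin u Y0 (Dlin w Y1 Z)); rewrite !wdata_Dlin /= Y0a Y1a wY0 wY1.
by split; ring.
Qed.

(** This makes [lexpr] and the boundary data functions of the almost everywhere class. Green's
    formula shows that [lexpr Y] is orthogonal to the dense domain of [Btilde]; then [bform Y Z = 0]
    for every [Z], and the data of [Z] are arbitrary. *)
Lemma aeq0_data Y : aeqa a Y (fun=> 0) ->
  [/\ aeqa a (lexpr Y) (fun=> 0), Y a = 0 & wdata Y = 0].
Proof.
move=> Y0.
have L1 Z := dstar_L2 Z; have L2 Z := dstar_lL2 Z.
have YlZ Z : ip mu H Y (lexpr Z) = 0 := ip0l mH (L1 Y) (L2 Z) Y0.
have lY0 : aeqa a (lexpr Y) (fun=> 0).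
  apply: (orthogonal_Btilde (L2 Y)) => Z Za Z'a.
  have := greenE Y Z; rewrite /gform /bform /ipa YlZ subr0 => ->.
  by rewrite Za Z'a conjc0; ring.
have b0 Z : bform Y Z = 0.
  by rewrite -greenE /gform /ipa YlZ (ip0l mH (L2 Y) (L1 Z) lY0) subrr.
split => //.
  have [Z [Za wZ]] := exists_Y1; have := b0 Z.
  by rewrite bform_wdata Za wZ conjc0 conjc1 mulr0 mulr1 sub0r => /eqP; rewrite oppr_eq0 => /eqP.
have [Z [Za wZ]] := exists_Y0; have := b0 Z.
by rewrite bform_wdata Za wZ conjc0 conjc1 mulr0 mulr1 subr0.
Qed.

Lemma aeq_data Y Z : aeqa a Y Z ->
  [/\ aeqa a (lexpr Y) (lexpr Z), Y a = Z a & wdata Y = wdata Z].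
Proof.
move=> YZ; have [|h1 h2 h3] := @aeq0_data (Dlin (-1) Z Y).
  apply: (aeq_trans (aeq_lin (-1) (aeq_refl _ _ Z) YZ)).
  by apply: aeq_eq => x _; ring.
split.
- have := aeq_lin 1 h1 (aeq_refl _ _ (lexpr Z)) => h.
  apply: (aeq_trans _ (aeq_trans h _)); apply: aeq_eq => x _; rewrite ?lexpr_Dlin; ring.
- by move: h2 => /= /eqP; rewrite mulN1r addrC subr_eq0 => /eqP.
- by move: h3; rewrite wdata_Dlin => /eqP; rewrite mulN1r addrC subr_eq0 => /eqP.
Qed.

Lemma Btheta_wdata Y : Bth Y (lexpr Y) <-> wdata Y = 0.
Proof.
split=> [[_ _ [Z [bZ YZ _]]]|wY].
  by have [_ _ ->] := aeq_data YZ; rewrite /wdata bZ subrr.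
split; [exact: dstar_L2|exact: dstar_lL2|exists Y; split; try exact: aeq_refl].
by move: wY => /eqP; rewrite subr_eq0 => /eqP.
Qed.

Lemma Btilde_data Y : Bt Y (lexpr Y) <-> Y a = 0 /\ wdata Y = 0.
Proof.
split=> [[_ _ [Z [[Za Z'a] YZ _]]]|[Ya wY]].
  by have [_ -> ->] := aeq_data YZ; rewrite /wdata Za Z'a; split => //; ring.
apply: Btilde_Dst => //; move: wY; rewrite /wdata Ya mulr0 subr0//.
Qed.

End BoundaryData.

(** * The spectral model *)

Section Stieltjes.
Context {R : realType} (M : {measure set (measurableTypeR R) -> \bar R}).
Local Notation S := `[0, +oo[%classic.
Local Notation Re := complex.Re.
Local Notation Im := complex.Im.

Hypothesis M_fin : (\int[M]_(t in `[0%R, +oo[) ((1 + t)^-1)%:E < +oo)%E.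

Lemma measurable_spectrum : measurable (S : set (measurableTypeR R)).
Proof. exact: measurable_itv. Qed.
Local Notation mS := measurable_spectrum.

Lemma spectrumP (t : R) : S t -> 0 <= t.
Proof. by rewrite /= in_itv/= andbT. Qed.

Lemma measurable_inv_shift (x : R) : 0 < x ->
  measurable_fun (S : set (measurableTypeR R)) (fun t => (t + x)^-1).
Proof.
move=> x0; apply: (measurable_fun_inv mS) => [t|t /spectrumP t0].
  by apply: cvgD; [exact: cvg_id|exact: cvg_cst].
by rewrite gt_eqF// ltr_wpDl.
Qed.

Lemma integrable_inv1 : M.-integrable S (EFin \o (fun t => (t + 1)^-1)).
Proof.
apply/integrableP; split.
  by apply/measurable_EFinP; apply: measurable_inv_shift; exact: ltr01.
apply: le_lt_trans M_fin; rewrite le_eqVlt; apply/orP; left; apply/eqP.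
apply: eq_integral => t; rewrite inE => /spectrumP t0 /=.
by rewrite addrC ger0_norm// invr_ge0 addr_ge0.
Qed.

Lemma integrable_inv_shift (x : R) : 0 < x ->
  M.-integrable S (EFin \o (fun t => (t + x)^-1)).
Proof.
move=> x0; have iv := Rintegrable_lin mS (1 + x^-1) integrable_inv1 (integrable0 _ _).
apply: (Rintegrable_le mS (measurable_inv_shift x0) _ iv) => t /spectrumP t0.
rewrite addr0 ger0_norm; last by rewrite invr_ge0 addr_ge0// ltW.
have -> : (1 + x^-1) * (t + 1)^-1 = (x + 1) / (x * (t + 1)) by field; rewrite !gt_eqF; lra.
rewrite ler_pdivlMr ?mulr_gt0//; last lra.
by rewrite ler_pdivrMl; [nra|lra].
Qed.

(** Dominated convergence along [x = n + 1], with majorant [1 / (t + 1)]. *)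
Lemma integral_inv_shift_small (e : R) : 0 < e ->
  exists2 x, 0 < x & \int[M]_(t in S) (t + x)^-1 <= e.
Proof.
move=> e0; pose f_ (n : nat) t := ((t + n.+1%:R)^-1)%:E : \bar R.
have n0 n : 0 < n.+1%:R :> R by [].
have h1 n : measurable_fun (S : set (measurableTypeR R)) (f_ n).
  by apply/measurable_EFinP; exact: measurable_inv_shift.
have h2 : {ae M, forall t, S t -> f_ ^~ t @ \oo --> 0%E}.
  apply: (@filterE _ _ (ae_filter_ringOfSetsType M)) => t /spectrumP t0.
  apply: cvg_EFin; first exact: nearW.
  apply: (@squeeze_cvgr _ _ _ _ (cst 0) (@harmonic R)).
  - apply: nearW => n /=; apply/andP; split; first by rewrite invr_ge0 addr_ge0.
    by rewrite lef_pV2 ?posrE// ?lerDr// ltr_wpDl.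
  - exact: cvg_cst.
  - exact: cvg_harmonic.
have h3 : {ae M, forall (t : R) n, S t -> (`|f_ n t| <= ((t + 1)^-1)%:E)%E}.
  apply: (@filterE _ _ (ae_filter_ringOfSetsType M)) => t n /spectrumP t0 /=.
  rewrite lee_fin ger0_norm ?invr_ge0 ?addr_ge0// lef_pV2 ?posrE ?ltr_wpDl//.
  by rewrite lerD2l ler1n.
have [_ _] := dominated_convergence mS h1 (measurable_cst _) h2 integrable_inv1 h3.
rewrite (_ : (\int[M]_(x in S) cst 0%E x)%E = 0%E); last by rewrite integral0.
move=> /fine_cvgP[_ /cvgrPdist_le /(_ _ e0)[N _ /(_ N (leqnn N))]].
rewrite /= sub0r normrN => h; exists N.+1%:R => //.
exact: le_trans (ler_norm _) h.
Qed.

Lemma cintegrable_realmul (u : R -> R) (c : R[i]) : M.-integrable S (EFin \o u) ->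
  cintegrable M S (fun t => c * (u t)%:C).
Proof.
move=> iu; have i0 : cintegrable M S (fun t => (u t)%:C).
  by split => //; exact: integrable0.
have := cintegrable_lin mS (c - 1) i0 i0.
by congr cintegrable; apply/funext => t; ring.
Qed.

Lemma cmeasurable_id : cmeasurable S (fun t : R => t%:C).
Proof. by apply: cmeasurable_real; exact: measurable_id. Qed.

(** The resolvent of multiplication at -1. It is square integrable since [rr^2 <= rr], and
    multiplication by it maps L^2 into the domain of multiplication by [t]. *)
Definition rr (t : R) : R[i] := ((t + 1)^-1)%:C.

Lemma rrE t : S t -> (t%:C + 1) * rr t = 1.
Proof.
move=> /spectrumP t0; rewrite /rr -[1 in X in X * _](rmorph1 (real_complex R)).
by rewrite -rmorphD -rmorphM divff// gt_eqF// ltr_wpDl.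
Qed.

Lemma normc_rr t : S t -> normc (rr t) <= 1 /\ normc (t%:C * rr t) <= 1.
Proof.
move=> /spectrumP t0; rewrite normcM !normc_real ger0_norm; last first.
  by rewrite invr_ge0 addr_ge0.
rewrite (ger0_norm t0) invf_le1 ?ltr_wpDl// lerDr; split => //.
by rewrite ler_pdivrMr ?ltr_wpDl// mul1r lerDl.
Qed.

Lemma cmeasurable_rr : cmeasurable S rr.
Proof. by apply: cmeasurable_real; apply: measurable_inv_shift; exact: ltr01. Qed.

Lemma L2_rr : L2 M S rr.
Proof.
apply: (L2_intro mS cmeasurable_rr _ integrable_inv1) => t St.
have t0 := spectrumP St; rewrite /rr normc_real.
have h : 0 <= (t + 1)^-1 by rewrite invr_ge0 addr_ge0.
rewrite ger0_norm// expr2 ler_piMr// invf_le1 ?ltr_wpDl// lerDr//.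
Qed.

Lemma L2_rrM f : L2 M S f -> L2 M S (fun t => rr t * f t).
Proof.
move=> Lf; apply: (L2_le mS (C := 1) _ _ _ Lf) => //.
  by apply: cmeasurableM; [exact: cmeasurable_rr|exact: L2_measurable Lf].
move=> t /normc_rr[h _]; rewrite normcM ler_wpM2r ?normc_ge0//.
Qed.

Lemma L2_trrM f : L2 M S f -> L2 M S (fun t => t%:C * rr t * f t).
Proof.
move=> Lf; apply: (L2_le mS (C := 1) _ _ _ Lf) => //.
  apply: cmeasurableM; last exact: L2_measurable Lf.
  by apply: cmeasurableM; [exact: cmeasurable_id|exact: cmeasurable_rr].
move=> t /normc_rr[_ h]; rewrite normcM ler_wpM2r ?normc_ge0//.
Qed.

(* Since [f = (f + g - k) / (1 + t)] and [1 / (1 + t)] is square integrable. *)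
Lemma spectral_integrable f g (k : R[i]) : L2 M S f -> L2 M S g ->
  aeq M S g (fun t => t%:C * f t + k) -> cintegrable M S f.
Proof.
move=> Lf Lg gE.
pose h t := (- k) * ((t + 1)^-1)%:C + (1 * (f t * (rr t)^*%C) + g t * (rr t)^*%C).
have ih : cintegrable M S h.
  have i1 := ip_integrable mS Lf L2_rr; have i2 := ip_integrable mS Lg L2_rr.
  have i3 := cintegrable_realmul (- k) integrable_inv1.
  have := cintegrable_lin mS 1 i3 (cintegrable_lin mS 1 i1 i2).
  by congr cintegrable; apply/funext => t; rewrite /h; ring.
apply: (cintegrable_aeq mS (L2_measurable Lf) ih).
apply: (@filterS _ _ (ae_filter_ringOfSetsType M)) gE => t E St.
rewrite /h E// -/(rr t) /rr !conjc_real -/(rr t).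
have := rrE St => r1; rewrite -[LHS]mul1r -[X in X * _ = _]r1; ring.
Qed.

Definition spectral_dom (f g : R -> R[i]) :=
  [/\ L2 M S f, L2 M S g & aeq M S g (fun t => t%:C * f t)].

(** The function [g - t f - k] need not be square integrable, but [Hr = rr * (g - t f - k)] is.
    Testing against [phi = rr * Hr], which lies in the domain, gives [||Hr||^2 = 0]. *)
Lemma spectral_test f g (k : R[i]) : L2 M S f -> L2 M S g ->
  (forall phi psi, spectral_dom phi psi ->
    ip M S g phi - ip M S f psi = k * (cintegral M S phi)^*%C) ->
  aeq M S g (fun t => t%:C * f t + k).
Proof.
move=> Lf Lg test.
pose Hr t := (-1) * (t%:C * rr t * f t) + ((- k) * rr t + rr t * g t).
have LHr : L2 M S Hr.
  apply: (L2_lin mS); first exact: L2_trrM.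
  by apply: (L2_lin mS); [exact: L2_rr|exact: L2_rrM].
pose phi t := rr t * Hr t; pose psi t := t%:C * rr t * Hr t.
have Lphi : L2 M S phi by exact: L2_rrM.
have Lpsi : L2 M S psi by exact: L2_trrM.
have dphi : spectral_dom phi psi.
  by split => //; apply: aeq_eq => t _; rewrite /psi /phi; ring.
have iphi : cintegrable M S phi.
  by apply: (@spectral_integrable _ psi 0) => //; apply: aeq_eq => t _; rewrite /psi /phi; ring.
have ig := ip_integrable mS Lg Lphi; have jf := ip_integrable mS Lf Lpsi.
have Hr0 : aeq M S Hr (fun=> 0).
  apply: (sqnorm_eq0 mS) => //; apply: complexI; rewrite -(ip_self _ mS).
  rewrite (_ : ip M S Hr Hr = cintegral M S (fun t => (- k) * (phi t)^*%C +
      ((-1) * (f t * (psi t)^*%C) + g t * (phi t)^*%C))); last first.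
    apply: cintegral_eq => t _; rewrite /phi /psi !conjcM conjc_real.
    by rewrite {1}/Hr /rr !conjc_real; ring.
  rewrite (cintegral_lin mS) ?(cintegral_lin mS)//; last 2 first.
    exact: cintegrableJ.
    exact: cintegrable_lin.
  rewrite cintegralJ//; have := test _ _ dphi; rewrite /ip => E.
  by rewrite mulN1r (addrC _ (cintegral _ _ _)) E rmorph0; ring.
apply: (@filterS _ _ (ae_filter_ringOfSetsType M)) Hr0 => t E St.
have := rrE St => r1; rewrite -[LHS]mul1r -r1.
have /eqP := E St; rewrite /Hr => /eqP E'.
have -> : (t%:C + 1) * rr t * g t = (t%:C + 1) * (rr t * g t) by ring.
have -> : rr t * g t = t%:C * rr t * f t + k * rr t.
  by apply/eqP; rewrite -subr_eq0 -E'; apply/eqP; ring.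
have -> : (t%:C + 1) * (t%:C * rr t * f t + k * rr t) =
  ((t%:C + 1) * rr t) * (t%:C * f t + k) by ring.
by rewrite r1 mul1r.
Qed.

End Stieltjes.

(** * The Stieltjes transform of the measure off the real axis *)

Section Resolvent.
Context {R : realType} (M : {measure set (measurableTypeR R) -> \bar R}).
Local Notation S := `[0, +oo[%classic.
Local Notation mS := (@measurable_spectrum R).
Hypothesis M_fin : (\int[M]_(t in `[0%R, +oo[) ((1 + t)^-1)%:E < +oo)%E.

Lemma normc_resolvent_ge (z : R[i]) (t : R) :
  `|complex.Im z| <= normc (t%:C - z) /\ `|t| <= normc (t%:C - z) + normc z.
Proof.
split; first by apply: le_trans (normr_Im _); rewrite !ReImE/= add0r normrN.
by rewrite -normc_real; apply: le_trans (normcD _ _); rewrite subrK.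
Qed.

Lemma cintegrable_resolvent (z : R[i]) : complex.Im z != 0 ->
  cintegrable M S (fun t => (t%:C - z)^-1).
Proof.
move=> z0; set x := complex.Re z; set y := complex.Im z.
have y0 : 0 < y ^+ 2 by rewrite exprn_even_gt0.
have N0 (t : R) : 0 < (t - x) ^+ 2 + y ^+ 2 by rewrite ltr_wpDl// sqr_ge0.
have kE (t : R) : (t%:C - z)^-1 = (((t - x) ^+ 2 + y ^+ 2)^-1)%:C * ((-1) * z^*%C + t%:C).
  have tz : t%:C - z != 0.
    apply/eqP => /(congr1 (@complex.Im R)); rewrite !ReImE/= add0r => /eqP.
    by rewrite oppr_eq0 (negbTE z0).
  have E : (t%:C - z) * ((-1) * z^*%C + t%:C) = ((t - x) ^+ 2 + y ^+ 2)%:C.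
    have -> : (-1) * z^*%C + t%:C = (t%:C - z)^*%C by rewrite conjcB conjc_real; ring.
    by rewrite mul_conjc sqr_normcE !ReImE/= add0r sqrrN.
  apply: (mulfI tz); rewrite divff// mulrCA E -rmorphM mulVf ?gt_eqF//.
have mk : cmeasurable S (fun t => (t%:C - z)^-1).
  rewrite (_ : (fun t => _) = (fun t => (((t - x) ^+ 2 + y ^+ 2)^-1)%:C *
      ((-1) * z^*%C + t%:C))); last by apply/funext => t; exact: kE.
  apply: cmeasurableM.
    apply: cmeasurable_real; apply: (measurable_fun_inv mS) => [t|t _]; last by rewrite gt_eqF.
    apply: cvgD; last exact: cvg_cst.
    by apply: cvgM; apply: cvgB; by [exact: cvg_id|exact: cvg_cst].
  by apply: (cmeasurable_lin _ (cmeasurable_cst _ _) (@cmeasurable_id R)).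
have iM := integrable_inv1 M_fin.
(* Comes from [t + 1 <= |t - z| + (|z| + 1)] and [|y| <= |t - z|]. *)
pose C := 1 + (normc z + 1) / `|y|.
have iv := Rintegrable_lin mS C iM (integrable0 _ _).
apply: (cintegrable_le mS mk _ iv) => t /spectrumP t0; rewrite addr0 normcV.
have [h1 h2] := normc_resolvent_ge z t; rewrite -/y in h1.
have ya : 0 < `|y| by rewrite normr_gt0.
have n0 : 0 < normc (t%:C - z) by exact: lt_le_trans h1.
have t1 : 0 < t + 1 by rewrite ltr_wpDl.
rewrite ler_pdivlMr// mulrC ler_pdivrMr// /C.
rewrite ger0_norm// in h2.
have h3 : normc z + 1 <= (normc z + 1) / `|y| * normc (t%:C - z).
  rewrite mulrAC ler_pdivlMr// ler_wpM2l// addr_ge0// normc_ge0//.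
by rewrite mulrDl mul1r; lra.
Qed.

Lemma normc_cintegral_le (f : R -> R[i]) (v : R -> R) : cintegrable M S f ->
  M.-integrable S (EFin \o v) -> (forall t, S t -> normc (f t) <= v t) ->
  normc (cintegral M S f) <= 2 * \int[M]_(t in S) v t.
Proof.
move=> [i1 i2] iv fv.
have bnd (u : R -> R) : M.-integrable S (EFin \o u) -> (forall t, S t -> `|u t| <= v t) ->
    `|\int[M]_(t in S) u t| <= \int[M]_(t in S) v t.
  move=> iu uv; apply: le_trans (le_normr_Rintegral mS iu) _.
  by apply: (le_Rintegral mS) => //; exact: integrable_norm.
have h1 := bnd _ i1 (fun t St => le_trans (normr_Re (f t)) (fv t St)).
have h2 := bnd _ i2 (fun t St => le_trans (normr_Im (f t)) (fv t St)).
rewrite (complexE (cintegral M S f)); apply: le_trans (normcD _ _) _.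
rewrite normcM !normc_real.
have -> : normc 'i%C = 1 :> R by rewrite /= expr0n expr1n add0r sqrtr1.
by rewrite mul1r; move: h1 h2 => /=; lra.
Qed.

Lemma resolvent_small (e : R) : 0 < e -> exists2 z : R[i], complex.Im z != 0 &
  normc (cintegral M S (fun t => (t%:C - z)^-1)) <= e.
Proof.
(* The tolerance is [e / 4]: one factor 2 from [(t + x) / 2 <= |t - z|] with [z] equal to [x] times
   the imaginary unit, one from bounding real and imaginary parts separately. *)
move=> e0; have [x x0 Mx] := integral_inv_shift_small M_fin (divr_gt0 e0 (ltr0Sn R 3)).
pose z : R[i] := (0 +i* x)%C.
have z0 : complex.Im z != 0 by rewrite /= gt_eqF.
exists z => //; have ik := cintegrable_resolvent z0.
have iM := integrable_inv_shift M_fin x0.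
have iv := Rintegrable_lin mS 2 iM (integrable0 _ _).
apply: le_trans (normc_cintegral_le ik iv _) _ => [t /spectrumP t0|]; last first.
  rewrite (Rintegral_lin mS)//; last exact: integrable0.
  rewrite Rintegral_cst// mul0r addr0; lra.
rewrite addr0 normcV.
have h1 : x <= normc (t%:C - z).
  by have [+ _] := normc_resolvent_ge z t; rewrite /= gtr0_norm.
have h2 : t <= normc (t%:C - z).
  by have := normr_Re (t%:C - z); rewrite !ReImE/= subr0 ger0_norm.
have n0 : 0 < normc (t%:C - z) by exact: lt_le_trans h1.
by rewrite ler_pdivlMr ?ltr_wpDl// mulrC ler_pdivrMr//; lra.
Qed.

End Resolvent.

(** * The weighted Young inequality behind the vanishing of [r] *)

Section YoungInequality.
Context {R : realType}.
Implicit Types s t x p N c r e A K M : R.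

(** Completing the square in [((t + x) N - |s| c)^2 / (t + x)]. It is used with [N = |U Y|],
    [c = |rho|] and [p] the real part of [rho * U Y]; the free multiplier [s] allows both signs. *)
Lemma young_shift s t x p N c : 0 < t + x -> s * p <= `|s| * (c * N) ->
  0 <= -2 * s * p + (x * N ^+ 2 + (s ^+ 2 * c ^+ 2 * (t + x)^-1 + t * N ^+ 2)).
Proof.
move=> tx h3; have h5 : 0 <= ((t + x) * N - `|s| * c) ^+ 2 / (t + x).
  by rewrite divr_ge0 ?sqr_ge0// ltW.
have h6 : ((t + x) * N - `|s| * c) ^+ 2 / (t + x) =
    (t + x) * N ^+ 2 - 2 * (`|s| * (c * N)) + `|s| ^+ 2 * c ^+ 2 * (t + x)^-1.
  by field; rewrite gt_eqF.
by move: h5; rewrite h6 real_normK ?num_real//; lra.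
Qed.

(** Here [A] is the form of [Y] and [A - r] its spectral part [\int t |U Y|^2], whence the
    coefficient [2 * s + 1]. *)
Lemma young_shift_integrated s r x e N K M A : A <= e -> x * N <= x * e ->
  0 <= -2 * s * r + (x * N + (K * M + (A - r))) ->
  (2 * s + 1) * r <= e + x * e + K * M.
Proof. lra. Qed.

End YoungInequality.

(** * Boundary data and the maximal operator under the isometry [U] *)

Section SpectralModel.
Context {R : realType} (a : R) (q : R -> R) (theta : R) (sigma : nondecr_halfline R).
Variable U : (R -> R[i]) -> R -> R[i].
Local Notation mu := (@lebesgue_measure R).
Local Notation H := `[a, +oo[%classic.
Local Notation S := `[0, +oo[%classic.
Local Notation M := (stieltjes_measure sigma).
Local Notation Dst := (Dstar a q).
Local Notation mH := (measurable_halfline a).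
Local Notation mS := (@measurable_spectrum R).
Local Notation Bt := (Btilde a q).
Local Notation Bth := (Btheta a q theta).
Local Notation w := (wdata theta).
Local Notation I := (cintegral M S).
Implicit Types (Y Z : Dst).

Hypothesis B_symmetric : symmetric_op mu H Bt.
Hypothesis B_deficiency : deficiency_indices_1_1 mu H Bt.
Hypothesis Btheta_positive : nonneg_sa_extension mu H Bt Bth.
Hypothesis M_fin : (\int[M]_(t in `[0%R, +oo[) ((1 + t)^-1)%:E < +oo)%E.
Hypothesis U_iso : isometric_correspondence a sigma U.
Hypothesis U_theta : equivalent_under a U Bth (mult_op sigma).
Hypothesis U_tilde : equivalent_under a U Bt (mult_op0 sigma).

Let data_surj := exists_data B_deficiency Btheta_positive.
Let same_data := aeq_data B_symmetric B_deficiency Btheta_positive.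
Let green := greenE B_symmetric.

Let UL2 f : L2 mu H f -> L2 M S (U f).
Proof. by case: U_iso => h _ _ _; exact: h. Qed.

Let Ulin c f g : L2 mu H f -> L2 mu H g ->
  aeq M S (U (fun x => c * f x + g x)) (fun t => c * U f t + U g t).
Proof. by case: U_iso => _ h _ _; exact: h. Qed.

Let Uip f g : L2 mu H f -> L2 mu H g -> ip M S (U f) (U g) = ip mu H f g.
Proof. by case: U_iso => _ _ h _; exact: h. Qed.

Let Usurj phi : L2 M S phi -> exists2 f, L2 mu H f & aeq M S (U f) phi.
Proof. by case: U_iso => _ _ _ h; exact: h. Qed.

(** [U] acts on functions rather than classes; that it is compatible with almost everywhere equality
    follows from the isometry. *)
Lemma U_aeq0 f : L2 mu H f -> aeq mu H f (fun=> 0) <-> aeq M S (U f) (fun=> 0).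
Proof.
move=> Lf; have E := Uip Lf Lf; rewrite !(ip_self _ mS) !(ip_self _ mH) in E.
have LU := UL2 Lf; split => f0.
  apply: (sqnorm_eq0 mS LU); apply: complexI; rewrite E -(ip_self _ mH).
  by rewrite (ip0l mH Lf Lf f0) rmorph0.
apply: (sqnorm_eq0 mH Lf); apply: complexI; rewrite -E -(ip_self _ mS).
by rewrite (ip0l mS LU LU f0) rmorph0.
Qed.

Lemma U_aeq f g : L2 mu H f -> L2 mu H g -> aeq mu H f g <-> aeq M S (U f) (U g).
Proof.
move=> Lf Lg; have L : L2 mu H (fun x => (-1) * g x + f x) by exact: (L2_lin mH).
have E := Ulin (-1) Lg Lf.
have subE (m : {measure set (measurableTypeR R) -> \bar R}) D (u v : R -> R[i]) :
    aeq m D u v <-> aeq m D (fun x => (-1) * v x + u x) (fun=> 0).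
  split; apply: (@filterS _ _ (ae_filter_ringOfSetsType m)) => x h Dx.
    by rewrite h//; ring.
  by have /eqP := h Dx; rewrite mulN1r addrC subr_eq0 => /eqP.
split=> [/subE/(U_aeq0 L) h|/subE h].
  by apply/subE; exact: aeq_trans (aeq_sym E) h.
by apply/subE/(U_aeq0 L); exact: aeq_trans E h.
Qed.

Lemma spectral_domP phi psi : spectral_dom M phi psi ->
  exists Y, [/\ w Y = 0, aeq M S (U Y) phi & aeq M S (U (lexpr Y)) psi].
Proof.
move=> [Lphi Lpsi E]; have [y Ly yphi] := Usurj Lphi; have [f Lf fpsi] := Usurj Lpsi.
have /(U_theta Ly Lf)[_ _ [Y [bY yY fY]]] : mult_op sigma (U y) (U f).
  split; [exact: UL2|exact: UL2|].
  apply: (aeq_trans fpsi (aeq_trans E _)).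
  by apply: (@filterS _ _ (ae_filter_ringOfSetsType M)) yphi => t h St; rewrite h.
exists Y; split; first by rewrite /wdata bY subrr.
  by apply: aeq_trans yphi; apply: aeq_sym; apply/(U_aeq Ly (dstar_L2 Y)).
by apply: aeq_trans fpsi; apply: aeq_sym; apply/(U_aeq Lf (dstar_lL2 Y)).
Qed.

Lemma spectral_dom_U Y : w Y = 0 -> spectral_dom M (U Y) (U (lexpr Y)).
Proof.
move=> /(Btheta_wdata B_symmetric B_deficiency Btheta_positive).
by move=> /(U_theta (dstar_L2 Y) (dstar_lL2 Y))[].
Qed.

Lemma spectral_dom_integrable phi psi : spectral_dom M phi psi -> cintegrable M S phi.
Proof.
move=> [L1 L2 E]; apply: (spectral_integrable M_fin (k := 0) L1 L2).
by apply: aeq_trans E _; apply: aeq_eq => t _; rewrite addr0.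
Qed.

(** Inside the domain of [Btheta] both conditions single out the domain of [Btilde], one on the
    spectral side and one on the differential side. *)
Lemma I_data0 Y : w Y = 0 -> (I (U Y) = 0 <-> Y a = 0).
Proof.
move=> wY.
have D := Btilde_data B_symmetric B_deficiency Btheta_positive Y.
have E := U_tilde (dstar_L2 Y) (dstar_lL2 Y).
split=> [I0|Ya].
  have /E/D[//] : mult_op0 sigma (U Y) (U (lexpr Y)).
  split => //; have [L1 L2 L3] := spectral_dom_U wY.
  by split.
have /E[_ //] : Bt Y (lexpr Y) by apply/D.
Qed.

Lemma I_U_lin c Y Z : cintegrable M S (U Y) -> cintegrable M S (U Z) ->
  I (U (Dlin c Y Z)) = c * I (U Y) + I (U Z).
Proof.
move=> iY iZ; rewrite -(cintegral_lin mS)//.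
have E := Ulin c (dstar_L2 Y) (dstar_L2 Z).
have i1 := cintegrable_lin mS c iY iZ.
apply: (cintegral_aeq mS) => //; apply: (cintegrable_aeq mS _ i1 E).
exact: L2_measurable (UL2 (dstar_L2 (Dlin c Y Z))).
Qed.

(** Two linear functionals with the same kernel are proportional; [rho] is read off at an element
    with [Y0 a = 1]. *)
Lemma exists_rho : exists2 rho : R[i], rho != 0 &
  forall Y, w Y = 0 -> Y a = rho * I (U Y).
Proof.
have [Y0 [Y0a wY0]] := data_surj 1 0.
have I0 : I (U Y0) != 0.
  by apply/eqP => /(I_data0 wY0); rewrite Y0a => /eqP; rewrite oner_eq0.
exists (I (U Y0))^-1 => [|Y wY]; first by rewrite invr_eq0.
have iY := spectral_dom_integrable (spectral_dom_U wY).
have iY0 := spectral_dom_integrable (spectral_dom_U wY0).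
have wX : w (Dlin (- Y a) Y0 Y) = 0 by rewrite wdata_Dlin wY0 wY; ring.
have : Dlin (- Y a) Y0 Y a = 0 by rewrite /= Y0a; ring.
move=> /(I_data0 wX); rewrite I_U_lin// => E.
have -> : I (U Y) = Y a * I (U Y0) by rewrite -[LHS]subr0 -E; ring.
by field.
Qed.

Section Rho.
Variable rho : R[i].
Hypothesis rho0 : rho != 0.
Hypothesis rhoP : forall Y, w Y = 0 -> Y a = rho * I (U Y).
Local Notation rho' := (rho^*%C).

(** Against [Z] with [w Z = 0] Green's form is [w Y] times the conjugate of [Z a = rho * I (U Z)].
    This is the hypothesis of [spectral_test] with [k = rho' * w Y]. *)
Lemma U_lexpr Y : aeq M S (U (lexpr Y)) (fun t => t%:C * U Y t + rho' * w Y).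
Proof.
apply: (spectral_test M_fin) => [||phi psi D].
- exact: UL2 (dstar_L2 Y).
- exact: UL2 (dstar_lL2 Y).
have [Z [wZ Zphi Zpsi]] := spectral_domP D.
have DZ := spectral_dom_U wZ; have [LZ LlZ _] := DZ; have [Lphi Lpsi _] := D.
have LY := UL2 (dstar_L2 Y); have LlY := UL2 (dstar_lL2 Y).
rewrite -(ip_aeq mS LlY LlY LZ Lphi (aeq_refl _ _ _) Zphi).
rewrite -(ip_aeq mS LY LY LlZ Lpsi (aeq_refl _ _ _) Zpsi).
rewrite !Uip; try exact: dstar_L2; try exact: dstar_lL2.
have := green Y Z; rewrite /gform /ipa => ->.
rewrite (bform_wdata theta) wZ (rhoP wZ) conjc0 mulr0 subr0.
rewrite -(cintegral_aeq mS (spectral_dom_integrable DZ) (spectral_dom_integrable D) Zphi).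
by rewrite conjcM; ring.
Qed.

Lemma U_integrable Y : cintegrable M S (U Y).
Proof.
exact: (spectral_integrable M_fin (UL2 (dstar_L2 Y)) (UL2 (dstar_lL2 Y)) (U_lexpr Y)).
Qed.

(** The terms in [t] cancel because [t] is real; the constants of [U_lexpr] remain. *)
Lemma gform_spectral Y Z :
  gform Y Z = rho' * w Y * (I (U Z))^*%C - rho * (w Z)^*%C * I (U Y).
Proof.
have LY := UL2 (dstar_L2 Y); have LlY := UL2 (dstar_lL2 Y).
have LZ := UL2 (dstar_L2 Z); have LlZ := UL2 (dstar_lL2 Z).
have iY := U_integrable Y; have iZ := U_integrable Z.
rewrite /gform /ipa -!Uip; try exact: dstar_L2; try exact: dstar_lL2.
have i1 := ip_integrable mS LlY LZ; have i2 := ip_integrable mS LY LlZ.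
have -> : ip M S (U (lexpr Y)) (U Z) - ip M S (U Y) (U (lexpr Z)) =
   I (fun t => (-1) * (U Y t * (U (lexpr Z) t)^*%C) + U (lexpr Y) t * (U Z t)^*%C).
  by rewrite (cintegral_lin mS)// /ip; ring.
have iZ' := cintegrableJ mS iZ.
have -> : rho' * w Y * (I (U Z))^*%C - rho * (w Z)^*%C * I (U Y) =
   I (fun t => (rho' * w Y) * (U Z t)^*%C + (- (rho * (w Z)^*%C)) * U Y t).
  rewrite (cintegral_lin mS) ?(cintegralZ mS)//; last exact: (cintegrableZ mS).
  by rewrite cintegralJ//; ring.
apply: (cintegral_aeq mS).
- exact: (cintegrable_lin mS).
- by apply: (cintegrable_lin mS) => //; exact: (cintegrableZ mS).
have := U_lexpr Z; have := U_lexpr Y.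
apply: (@filterS2 _ _ (ae_filter_ringOfSetsType M)) => t EY EZ St.
by rewrite EY// EZ// !conjE; ring.
Qed.

(** Comparing the two expressions of Green's form makes the defect [d] proportional to [w]. Taking
    both arguments equal to an element with [w = 1] shows that the factor is real. *)
Lemma data_spectral : exists r : R, forall Y, Y a = rho * I (U Y) - r%:C * w Y.
Proof.
pose d Y := Y a - rho * I (U Y).
have dYZ Y Z : w Y * (d Z)^*%C = (w Z)^*%C * d Y.
  have := gform_spectral Y Z; rewrite green (bform_wdata theta) /d (conjcB (Z a)) (conjcM rho) => E.
  apply/eqP; rewrite -subr_eq0; apply/eqP.
  have -> : w Y * ((Z a)^*%C - rho' * (I (U Z))^*%C) - (w Z)^*%C * (Y a - rho * I (U Y)) =
    (w Y * (Z a)^*%C - Y a * (w Z)^*%C) -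
    (rho' * w Y * (I (U Z))^*%C - rho * (w Z)^*%C * I (U Y)) by ring.
  by rewrite E subrr.
have [Y1 [_ wY1]] := data_surj 0 1.
have d1 : (d Y1)^*%C = d Y1 by have := dYZ Y1 Y1; rewrite wY1 conjc1 !mul1r.
exists (- complex.Re (d Y1)) => Y.
have dE : (complex.Re (d Y1))%:C = d Y1.
  apply: complex_ext => //=; have := congr1 (@complex.Im R) d1.
  rewrite ImJ; lra.
have := dYZ Y Y1; rewrite wY1 conjc1 mul1r d1 => E.
have -> : (- complex.Re (d Y1))%:C = - d Y1.
  by rewrite -dE; apply: complex_ext => /=; rewrite ?oppr0.
have -> : rho * I (U Y) - - d Y1 * w Y = rho * I (U Y) + w Y * d Y1 by ring.
by rewrite E /d; ring.
Qed.

Lemma form_spectral Y : ipa a (lexpr Y) Y - w Y * (rho * I (U Y))^*%C =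
  I (fun t => t%:C * (normc (U Y t) ^+ 2)%:C) /\ cintegrable M S (fun t => t%:C * (normc (U Y t) ^+ 2)%:C).
Proof.
have LY := UL2 (dstar_L2 Y); have LlY := UL2 (dstar_lL2 Y).
have iY := U_integrable Y; have iYJ := cintegrableJ mS iY.
have iG := ip_integrable mS LlY LY.
have mT : cmeasurable S (fun t => t%:C * (normc (U Y t) ^+ 2)%:C).
  apply: cmeasurableM; first exact: cmeasurable_id.
  by apply: cmeasurable_real; apply: cmeasurable_normc2; exact: L2_measurable LY.
have iR := cintegrable_lin mS (- (rho' * w Y)) iYJ iG.
have E : aeq M S (fun t => t%:C * (normc (U Y t) ^+ 2)%:C)
    (fun t => - (rho' * w Y) * (U Y t)^*%C + U (lexpr Y) t * (U Y t)^*%C).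
  apply: (@filterS _ _ (ae_filter_ringOfSetsType M)) (U_lexpr Y) => t EY St.
  by rewrite EY// -mul_conjc; ring.
have iT := cintegrable_aeq mS mT iR E.
split => //; rewrite (cintegral_aeq mS iT iR E) (cintegral_lin mS)// cintegralJ//.
rewrite /ipa -Uip ?/ip ?conjcM; [ring|exact: dstar_lL2|exact: dstar_L2].
Qed.

(** Young's inequality is integrated for a concentrated element with [Y a = 0] and [w Y = 1], for
    which [rho * I (U Y) = r]. *)
Lemma data_shift_bound (r s x e : R) : (forall Y, Y a = rho * I (U Y) - r%:C * w Y) ->
  0 < x -> 0 < e ->
  (2 * s + 1) * r <= e + x * e + s ^+ 2 * normc rho ^+ 2 * \int[M]_(t in S) (t + x)^-1.
Proof.
move=> Yr x0 e0; have [Y1 [Y1a wY1]] := data_surj 0 1.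
have [Y [Ya Y'a nY fY]] := concentrated_elements Y1a e0.
have wY : w Y = 1 by rewrite -wY1 /wdata Ya Y1a Y'a.
have LY := UL2 (dstar_L2 Y).
have IY : rho * I (U Y) = r%:C.
  by have := Yr Y; rewrite Ya wY mulr1 => /eqP; rewrite eq_sym subr_eq0 => /eqP.
have [E iT] := form_spectral Y; rewrite wY mul1r IY conjc_real in E.
have sY : sqnorm M S (U Y) <= e.
  suff -> : sqnorm M S (U Y) = sqnorm mu H Y by [].
  have := Uip (dstar_L2 Y) (dstar_L2 Y); rewrite (ip_self _ mS) (ip_self _ mH).
  exact: complexI.
have [iT1 _] := iT; have [iI _] := cintegrableZ mS rho (U_integrable Y).
have iN := L2_integrable LY; have iM := integrable_inv_shift M_fin x0.
have {IY} r1 : \int[M]_(t in S) complex.Re (rho * U Y t) = r.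
  transitivity (complex.Re (I (fun t => rho * U Y t))); first by [].
  by rewrite (cintegralZ mS) ?IY//; exact: U_integrable.
have {E} r2 : \int[M]_(t in S) complex.Re (t%:C * (normc (U Y t) ^+ 2)%:C) =
    complex.Re (ipa a (lexpr Y) Y) - r.
  transitivity (complex.Re (I (fun t => t%:C * (normc (U Y t) ^+ 2)%:C))); first by [].
  by rewrite -E ReD ReN.
have i3 := Rintegrable_lin mS (s ^+ 2 * normc rho ^+ 2) iM iT1.
have i2 := Rintegrable_lin mS x iN i3.
have : 0 <= \int[M]_(t in S) ((-2 * s) * complex.Re (rho * U Y t) +
  (x * normc (U Y t) ^+ 2 + (s ^+ 2 * normc rho ^+ 2 * (t + x)^-1 +
    complex.Re (t%:C * (normc (U Y t) ^+ 2)%:C)))).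
  apply: Rintegral_ge0 => t /spectrumP t0.
  have -> : complex.Re (t%:C * (normc (U Y t) ^+ 2)%:C) = t * normc (U Y t) ^+ 2.
    by rewrite ReM/= mul0r subr0.
  have h2 := ler_norm (s * complex.Re (rho * U Y t)).
  have h1 := normr_Re (rho * U Y t); rewrite normcM in h1; rewrite normrM in h2.
  have h3 : s * complex.Re (rho * U Y t) <= `|s| * (normc rho * normc (U Y t)).
    by apply: le_trans h2 _; rewrite ler_wpM2l.
  have tx : 0 < t + x by rewrite ltr_wpDl.
  exact: young_shift.
rewrite (Rintegral_lin mS)// (Rintegral_lin mS)// (Rintegral_lin mS)// r1 r2.
apply: young_shift_integrated fY _.
by rewrite ler_wpM2l ?sY// ltW.
Qed.

(* Elements of the maximal domain with [u = 0], [w = 1] and arbitrarily small norm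
   and form exclude a shift [r]: this is where [int dsigma / (1 + t) < oo] is used. *)
Lemma data_shift0 (r : R) : (forall Y, Y a = rho * I (U Y) - r%:C * w Y) -> r = 0.
Proof.
move=> Yr.
(* For fixed [s], a large [x] makes the integral term at most [e / 2]; the concentration
   [e / 2 / (1 + x)] then handles the rest. The values [s = 0] and [s = -1] give both signs. *)
have key2 (s : R) : (2 * s + 1) * r <= 0.
  apply/ler_addgt0Pr => e e0; rewrite add0r.
  have C0 : 0 < s ^+ 2 * normc rho ^+ 2 + 1.
    by rewrite ltr_wpDl// mulr_ge0// sqr_ge0.
  have [x x0 Mx] := integral_inv_shift_small M_fin (divr_gt0 (divr_gt0 e0 (ltr0Sn R 1)) C0).
  have e1 : 0 < e / 2 / (1 + x) by rewrite !divr_gt0//; lra.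
  apply: le_trans (data_shift_bound s Yr x0 e1) _.
  have -> : e / 2 / (1 + x) + x * (e / 2 / (1 + x)) = e / 2 by field; rewrite gt_eqF//; lra.
  have M0 : 0 <= \int[M]_(t in S) (t + x)^-1.
    by apply: Rintegral_ge0 => t /spectrumP t0; rewrite invr_ge0 addr_ge0// ltW.
  have : (s ^+ 2 * normc rho ^+ 2 + 1) * \int[M]_(t in S) (t + x)^-1 <= e / 2.
    by rewrite mulrC -ler_pdivlMr.
  by rewrite mulrDl mul1r; lra.
by apply/eqP; rewrite eq_le; have := key2 0; have := key2 (-1); lra.
Qed.

Lemma data_I Y : Y a = rho * I (U Y).
Proof.
have [r Yr] := data_spectral; have r0 := data_shift0 Yr.
by rewrite Yr r0 mul0r subr0.
Qed.

Lemma form_ge0 Y : 0 <= ipa a (lexpr Y) Y - w Y * (Y a)^*%C.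
Proof.
rewrite data_I; have [-> _] := form_spectral Y.
rewrite lecE /=; apply/andP; split; last first.
  apply: Rintegral_ge0 => t /spectrumP t0; rewrite mul0r subr0.
  by rewrite mulr_ge0// sqr_ge0.
apply/eqP; rewrite (_ : Rintegral _ _ _ = \int[M]_(x in S) (0 * 0)).
  by rewrite RintegralZl ?mul0r//; exact: integrable0.
by apply: eq_Rintegral => t _; rewrite mulr0 mul0r addr0 mulr0.
Qed.

(** By [U_lexpr] the image of an eigenfunction is [- rho' * w Y / (t - z)], and integration recovers
    [Y a]. Thus the Weyl quotient [Y a / w Y] is [- |rho|^2] times the Stieltjes transform. *)
Lemma eigen_data (z : R[i]) Y : complex.Im z != 0 ->
  aeqa a (lexpr Y) (fun x => z * Y x) ->
  Y a = - (rho * rho') * w Y * I (fun t => (t%:C - z)^-1).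
Proof.
move=> z0 lY; have LY := UL2 (dstar_L2 Y).
have LzY := L2Z mH z (dstar_L2 Y).
have E1 : aeq M S (U (lexpr Y)) (fun t => z * U Y t).
  have /(U_aeq (dstar_lL2 Y) LzY) E := lY; apply: (aeq_trans E).
  have := Ulin (z - 1) (dstar_L2 Y) (dstar_L2 Y).
  have -> : (fun x => (z - 1) * Y x + Y x) = (fun x => z * Y x) by apply/funext => x; ring.
  have -> // : (fun t => (z - 1) * U Y t + U Y t) = (fun t => z * U Y t).
  by apply/funext => x; ring.
have E2 : aeq M S (U Y) (fun t => - (rho' * w Y) * (t%:C - z)^-1).
  move: E1 (U_lexpr Y); apply: (@filterS2 _ _ (ae_filter_ringOfSetsType M)) => t E1 E2 St.
  have tz : t%:C - z != 0.
    apply/eqP => /(congr1 (@complex.Im R)); rewrite !ReImE/= add0r => /eqP.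
    by rewrite oppr_eq0 (negbTE z0).
  have E : (t%:C - z) * U Y t = - (rho' * w Y).
    have E3 : z * U Y t = t%:C * U Y t + rho' * w Y by rewrite -E1// E2.
    by rewrite mulrBl E3; ring.
  by rewrite -E; field.
have ik := cintegrable_resolvent M_fin z0.
rewrite data_I (cintegral_aeq mS (U_integrable Y) (cintegrableZ mS _ ik) E2).
by rewrite (cintegralZ mS)//; ring.
Qed.

(** With [Y a = 0] Green's form of [Y] with itself vanishes, so [(z - conj z) ||Y||^2 = 0] and [Y]
    is null, against [w Y != 0]. *)
Lemma eigen_nonzero (z : R[i]) Y : complex.Im z != 0 ->
  aeqa a (lexpr Y) (fun x => z * Y x) -> w Y != 0 -> Y a != 0.
Proof.
move=> z0 lY; apply: contraNN => /eqP Ya.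
have LY := dstar_L2 Y; have LzY := L2Z mH z LY.
have := green Y Y; rewrite (bform_wdata theta) Ya conjc0 mulr0 mul0r subr0.
rewrite /gform /ipa (ip_aeq mH (dstar_lL2 Y) LzY LY LY lY (aeq_refl _ _ _)).
rewrite (ip_aeq mH LY LY (dstar_lL2 Y) LzY (aeq_refl _ _ _) lY).
rewrite (ipZl mH _ LY LY) (ipZr mH _ LY LY) (ip_self _ mH) -mulrBl => /eqP.
rewrite mulf_eq0 => /orP[/eqP/(congr1 (@complex.Im R))|/eqP n0].
  rewrite !ReImE/= opprK => /eqP; rewrite -mulr2n mulrn_eq0/=.
  by rewrite (negbTE z0).
have /(sqnorm_eq0 mH LY) Y0 : sqnorm mu H Y = 0 by apply: complexI.
have [_ _ ->] := aeq0_data B_symmetric B_deficiency Btheta_positive Y0.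
by rewrite eqxx.
Qed.

(** A converse to [U_lexpr]: subtracting the image of an element with [w = k / rho'] removes the
    constant, and the remainder lies in the domain of multiplication. *)
Lemma spectral_maximal phi psi (k : R[i]) : L2 M S phi -> L2 M S psi ->
  aeq M S psi (fun t => t%:C * phi t + k) ->
  exists Y, [/\ w Y = k / rho', aeq M S (U Y) phi & aeq M S (U (lexpr Y)) psi].
Proof.
move=> Lphi Lpsi E; have [Y1 [_ wY1]] := data_surj 0 (k / rho').
have r0 : rho' != 0 by rewrite conjc_eq0.
have LY := UL2 (dstar_L2 Y1); have LlY := UL2 (dstar_lL2 Y1).
have [|Y2 [wY2 E1 E2]] := @spectral_domP (fun t => (-1) * U Y1 t + phi t)
    (fun t => (-1) * U (lexpr Y1) t + psi t).
  split; [exact: (L2_lin mS)|exact: (L2_lin mS)|].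
  move: E (U_lexpr Y1); apply: (@filterS2 _ _ (ae_filter_ringOfSetsType M)) => t E1 E2 St.
  by rewrite E1// E2// wY1; field.
exists (Dlin 1 Y1 Y2); split.
- by rewrite wdata_Dlin wY1 wY2; ring.
- apply: (aeq_trans (Ulin 1 (dstar_L2 Y1) (dstar_L2 Y2))).
  by apply: (@filterS _ _ (ae_filter_ringOfSetsType M)) E1 => t E1 St; rewrite E1//; ring.
- rewrite lexpr_DlinE; apply: (aeq_trans (Ulin 1 (dstar_lL2 Y1) (dstar_lL2 Y2))).
  by apply: (@filterS _ _ (ae_filter_ringOfSetsType M)) E2 => t E2 St; rewrite E2//; ring.
Qed.

(** Each [Z] with [w Z = 0] is [Z a * Y0] plus an element of [Btilde], on which the defect
    [(g, Z) - (z, l Z)] vanishes. The defect therefore depends only on [Z a = rho * I (U Z)], as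
    [spectral_test] requires, and no regularity theory of weak solutions is involved. *)
Lemma adjoint_Btilde z g : adjoint mu H Bt z g ->
  exists Y, aeqa a z Y /\ aeqa a g (lexpr Y).
Proof.
move=> [Lz Lg zg]; have [Y0 [Y0a wY0]] := data_surj 1 0.
pose k := rho' * (ip mu H g Y0 - ip mu H z (lexpr Y0)).
have [|Y [_ E1 E2]] := @spectral_maximal (U z) (U g) k (UL2 Lz) (UL2 Lg); last first.
  by exists Y; split; apply: aeq_sym; [apply/(U_aeq (dstar_L2 Y) Lz)|
    apply/(U_aeq (dstar_lL2 Y) Lg)].
apply: (spectral_test M_fin (UL2 Lz) (UL2 Lg)) => phi psi D.
have [Z [wZ Zphi Zpsi]] := spectral_domP D.
have DZ := spectral_dom_U wZ; have [LZ LlZ _] := DZ; have [Lphi Lpsi _] := D.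
have Uz := UL2 Lz; have Ug := UL2 Lg.
rewrite -(ip_aeq mS Ug Ug LZ Lphi (aeq_refl _ _ _) Zphi).
rewrite -(ip_aeq mS Uz Uz LlZ Lpsi (aeq_refl _ _ _) Zpsi).
rewrite (Uip Lg (dstar_L2 Z)) (Uip Lz (dstar_lL2 Z)).
rewrite -(cintegral_aeq mS (spectral_dom_integrable DZ) (spectral_dom_integrable D) Zphi).
pose X := Dlin (- Z a) Y0 Z.
have /zg : Bt X (lexpr X).
  apply/(Btilde_data B_symmetric B_deficiency Btheta_positive).
  by rewrite wdata_Dlin wY0 wZ /= Y0a; split; ring.
rewrite /X lexpr_DlinE (ip_linl mH _ (dstar_lL2 Y0) (dstar_lL2 Z) Lz).
rewrite (ip_linl mH _ (dstar_L2 Y0) (dstar_L2 Z) Lg) => E.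
have -> : ip mu H g Z - ip mu H z (lexpr Z) =
    (Z a)^*%C * (ip mu H g Y0 - ip mu H z (lexpr Y0)).
  have := congr1 conjc E; rewrite !conjcD !conjcM conjcN.
  rewrite -(ip_conj mH (dstar_lL2 Y0) Lz) -(ip_conj mH (dstar_lL2 Z) Lz).
  rewrite -(ip_conj mH (dstar_L2 Y0) Lg) -(ip_conj mH (dstar_L2 Z) Lg) => E'.
  have -> : ip mu H g Z = (- (Z a)^*%C * ip mu H z (lexpr Y0) + ip mu H z (lexpr Z)) +
      (Z a)^*%C * ip mu H g Y0 by rewrite E'; ring.
  by ring.
by rewrite (rhoP wZ) /k conjcM; ring.
Qed.

Lemma exists_eigen_m1 : exists e : Dst,
  w e = 1 /\ aeqa a (lexpr e) (fun x => (-1) * e x).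
Proof.
have r0 : rho' != 0 by rewrite conjc_eq0.
have Lr := L2_rr M_fin.
(* [phi = - rho' / (t + 1)] satisfies [t * phi + rho' = - phi]. *)
have [|e [we E1 E2]] := @spectral_maximal (fun t => - rho' * rr t)
    (fun t => rho' * rr t) rho' (L2Z mS _ Lr) (L2Z mS _ Lr).
  apply: aeq_eq => t /rrE E.
  have -> : t%:C * (- rho' * rr t) + rho' = rho' * rr t - rho' * ((t%:C + 1) * rr t) + rho'.
    by ring.
  by rewrite E; ring.
exists e; split; first by rewrite we divff.
have Le := dstar_L2 e.
apply/(U_aeq (dstar_lL2 e) (L2Z mH _ Le)); apply: (aeq_trans E2); apply: aeq_sym.
have := Ulin (-2) Le Le.
have -> : (fun x => -2 * e x + e x) = (fun x => (-1) * e x) by apply/funext => x; ring.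
move=> h; apply: (aeq_trans h).
by apply: (@filterS _ _ (ae_filter_ringOfSetsType M)) E1 => t E1 St; rewrite E1//; ring.
Qed.

End Rho.
End SpectralModel.

(** * The system *)

Section SmallRoots.
Context {R : realType}.
Implicit Types A B C : R[i].

Definition small_roots A B C := forall e : R, 0 < e -> exists F : R[i],
  [/\ F != 0, normc F <= e & A + B * F + C * F ^+ 2 = 0].

Lemma small_roots0 A B C : small_roots A B C -> A = 0.
Proof.
move=> sr; apply/eqP; apply: contrapT => /negP A0.
have nA : 0 < normc A by rewrite lt_neqAle normc_ge0 andbT eq_sym normc_eq0.
have nB := normc_ge0 B; have nC := normc_ge0 C.
have D0 : 0 < normc B + normc C + 1 by lra.
have e0 : 0 < Num.min 1 (normc A / 2 / (normc B + normc C + 1)).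
  by rewrite lt_min ltr01 !divr_gt0.
have [F [_ Fe E]] := sr _ e0.
move: Fe; rewrite le_min => /andP[F1 F2].
have nF := normc_ge0 F.
have : normc A <= normc B * normc F + normc C * normc F ^+ 2.
  have -> : A = - (B * F + C * F ^+ 2) by apply/eqP; rewrite -subr_eq0 opprK -E; apply/eqP; ring.
  rewrite (normcN (_ : R[i])); apply: le_trans (normcD _ _) _.
  by rewrite !normcM expr2.
move: F2; rewrite ler_pdivlMr//.
move: (normc A) (normc B) (normc C) (normc F) nA nB nC nF F1 {D0 e0} => p r s t.
move=> p0 r0 s0 t0 t1 h1 h2.
have : s * t ^+ 2 <= s * t by rewrite ler_wpM2l// expr2 ler_piMr.
by lra.
Qed.

(** Once the constant term is 0, dividing by the nonzero [F] lowers the degree, so each coefficient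
    becomes a constant term in turn. *)
Lemma small_roots_all A B C : small_roots A B C -> [/\ A = 0, B = 0 & C = 0].
Proof.
move=> sr; have A0 := small_roots0 sr.
have sr1 : small_roots B C 0.
  move=> e /sr[F [F0 Fe E]]; exists F; split => //.
  apply: (mulfI F0); rewrite mulr0 -[RHS]E A0; ring.
have B0 := small_roots0 sr1.
have [F [F0 _ E]] := sr1 1 ltr01.
split => //; apply: (mulIf F0); rewrite mul0r -[RHS]E B0; ring.
Qed.

End SmallRoots.

(** * Accretivity of the realizing system *)

Section System.
Context {R : realType} (a : R) (q : R -> R) (theta : R).
Variables (Th : @schrodinger_system R) (V F : R[i] -> R[i]) (gamma : R) (c : R[i]).
Local Notation mu := (@lebesgue_measure R).
Local Notation H := `[a, +oo[%classic.
Local Notation Dst := (Dstar a q).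
Local Notation mH := (measurable_halfline a).
Local Notation w := (wdata theta).
Implicit Types (Y Z W : Dst).

Hypothesis B_symmetric : symmetric_op mu H (Btilde a q).
Hypothesis data_surj : forall u v, exists Y, Y a = u /\ w Y = v.
Hypothesis form_nonneg : forall Y, 0 <= ipa a (lexpr Y) Y - w Y * (Y a)^*%C.
Hypothesis eigen : forall z Y, complex.Im z != 0 ->
  aeqa a (lexpr Y) (fun x => z * Y x) -> Y a = - c * w Y * F z.
Hypothesis eigen_neq0 : forall z Y, complex.Im z != 0 ->
  aeqa a (lexpr Y) (fun x => z * Y x) -> w Y != 0 -> Y a != 0.
Hypothesis F_small : forall e : R, 0 < e -> exists2 z, complex.Im z != 0 & normc (F z) <= e.
Hypothesis gamma0 : 0 <= gamma.
Hypothesis VE : forall z, complex.Im z != 0 -> V z = gamma%:C + F z.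
Hypothesis V_real : realizes a q Th V.

Definition bdata (xi : R) Y : R[i] := dval' Y a - xi%:C * Y a.

Lemma bdata_w xi Y : bdata xi Y = w Y + (theta - xi)%:C * Y a.
Proof. by rewrite /bdata /wdata rmorphB; ring. Qed.

Lemma conj_bdata xi Y : (bdata xi Y)^*%C = (dval' Y a)^*%C - xi%:C * (Y a)^*%C.
Proof. by rewrite /bdata conjcB conjcM conjc_real. Qed.

Lemma ipa_lexprr Y Z : ipa a Y (lexpr Z) = ipa a (lexpr Y) Z - bform Y Z.
Proof. by rewrite -(greenE B_symmetric) /gform; ring. Qed.

Lemma sys_ReAE Y Z : sys_ReA Th Y Z = ipa a (lexpr Y) Z - 2^-1 * bform Y Z -
  2^-1 * ((dval' Y a - sys_h Th * Y a) * sys_channel Th Z +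
    ((dval' Z a - sys_h Th * Z a) * sys_channel Th Y)^*%C).
Proof.
rewrite /sys_ReA /sys_Aadj /sys_A conjcB.
rewrite -[X in _ + (X - _)](ip_conj mH (dstar_lL2 Z) (dstar_L2 Y)).
by rewrite -/(ipa a _ _) ipa_lexprr; field.
Qed.

(** Tested on elements without boundary data, the equation of the system says [l Y = z Y] against a
    dense set. For other [W] it then involves boundary terms only. *)
Lemma realized_eigen z Y :
  (forall W, W a = 0 -> dval' W a = 0 -> sys_ReA Th Y W = ipa a (lexpr Y) W) ->
  (forall W, W a = 0 -> dval' W a = 0 -> sys_g Th W = 0) ->
  (forall W, sys_ReA Th Y W - z * ipa a Y W = sys_K Th 1 W) ->
  aeqa a (lexpr Y) (fun x => z * Y x) /\ forall W, ipa a (lexpr Y) W = z * ipa a Y W.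
Proof.
move=> h1 h2 h3; have LY := dstar_L2 Y; have LlY := dstar_lL2 Y.
have E : aeqa a (lexpr Y) (fun x => z * Y x).
  have Lf := L2_lin mH (- z) LY LlY.
  have f0 := orthogonal_Btilde B_symmetric Lf.
  have /f0 : forall W, W a = 0 -> dval' W a = 0 ->
      ip mu H (fun x => - z * Y x + lexpr Y x) W = 0.
    move=> W Wa W'a; rewrite (ip_linl mH _ LY LlY (dstar_L2 W)).
    have := h3 W; rewrite h1// /sys_K h2// mulr0 /ipa => <-; ring.
  apply: (@filterS _ _ (ae_filter_ringOfSetsType mu)) => x h Hx.
  by have /eqP := h Hx; rewrite mulNr addrC subr_eq0 => /eqP.
split => // W; rewrite /ipa.
rewrite (ip_aeq mH LlY (L2Z mH z LY) (dstar_L2 W) (dstar_L2 W) E (aeq_refl _ _ _)).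
exact: (ipZl mH _ LY (dstar_L2 W)).
Qed.

(* With [mu] the parameter of the system, [xi] is the parameter of the boundary
   condition [y' a = xi * y a] of [Re A]; [mu = +oo] and [mu = -oo] give [kap = 0]. *)
Section RegularCase.
Variables (xi kap tau : R).
Hypothesis tau0 : tau != 0.
Hypothesis ReAE : forall Y Z, sys_ReA Th Y Z =
  ipa a (lexpr Y) Z - bdata xi Y * (Z a - kap%:C * bdata xi Z)^*%C.
Hypothesis gE : forall Z, sys_g Th Z = tau%:C * (Z a - kap%:C * bdata xi Z)^*%C.

Let tauC : tau%:C != 0 :> R[i]. Proof. by rewrite fmorph_eq0. Qed.

(** Elimination of [Y a] and [w Y] from [bdata xi Y = - tau], [gamma + F = tau (Y a + kap tau)] and
    [Y a = - c (w Y) F]. The result is [(A + F) (1 - c (theta - xi) F) = tau^2 c F] with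
    [A = gamma - kap tau^2]. *)
Lemma regular_small_roots : small_roots (gamma - kap * tau ^+ 2)%:C
  (1 - c * (theta - xi)%:C * (gamma - kap * tau ^+ 2)%:C - (tau ^+ 2)%:C * c)
  (- (c * (theta - xi)%:C)).
Proof.
move=> e /F_small[z z0 Fe]; have [Y [YW VY]] := V_real z0.
have [lY YE] : aeqa a (lexpr Y) (fun x => z * Y x) /\
    forall W, ipa a (lexpr Y) W = z * ipa a Y W.
  apply: (realized_eigen _ _ YW) => W Wa W'a; first rewrite ReAE; last rewrite gE;
  by rewrite /bdata Wa W'a !mulr0 subrr mulr0 subrr conjc0 mulr0 ?subr0.
(* These data give [bdata xi W = 0], so the tested equation reduces to the coefficient of [W a]. *)
have [W [Wa wW]] := data_surj 1 (xi - theta)%:C.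
have bY : bdata xi Y = - tau%:C.
  have := YW W; rewrite ReAE /sys_K gE YE.
  have -> : bdata xi W = 0.
    by rewrite bdata_w wW Wa mulr1 -rmorphD addrACA !rmorphD/= !rmorphN; ring.
  rewrite Wa mulr0 subr0 conjc1 mulr1 mul1r mulr1 addrAC subrr sub0r => /eqP.
  by rewrite eqr_oppLR => /eqP.
have VF : gamma%:C + F z = tau%:C * (Y a + kap%:C * tau%:C).
  rewrite -VE// VY /sys_Kadj gE conjcM conjcK conjc_real bY; ring.
have Yaw := eigen z0 lY; rewrite bdata_w in bY.
have w0 : w Y != 0.
  apply/eqP => wY; move: bY; rewrite Yaw wY !(mulr0, mul0r) addr0 => /eqP.
  by rewrite eq_sym oppr_eq0 (negbTE tauC).
have F0 : F z != 0.
  apply: contraNN (eigen_neq0 z0 lY w0) => /eqP F0.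
  by rewrite Yaw F0 mulr0.
exists (F z); split => //.
have wE : w Y = - tau%:C - (theta - xi)%:C * Y a by rewrite -bY; ring.
have YF : Y a * (1 - c * (theta - xi)%:C * F z) = c * F z * tau%:C.
  have : Y a = - c * (- tau%:C - (theta - xi)%:C * Y a) * F z by rewrite -wE.
  move=> E; apply/eqP; rewrite -subr_eq0.
  rewrite (_ : _ - _ = Y a - (- c * (- tau%:C - (theta - xi)%:C * Y a) * F z)); last by ring.
  by rewrite -E subrr.
have A1 : (gamma - kap * tau ^+ 2)%:C + F z = tau%:C * Y a.
  rewrite rmorphB rmorphM rmorphXn/=.
  have -> : gamma%:C - kap%:C * tau%:C ^+ 2 + F z = (gamma%:C + F z) - kap%:C * tau%:C ^+ 2 by ring.
  by rewrite VF; ring.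
have -> : (tau ^+ 2)%:C = tau%:C ^+ 2 :> R[i] by rewrite rmorphXn.
set A := (gamma - kap * tau ^+ 2)%:C in A1 *.
set d := (theta - xi)%:C in YF *.
have -> : A + (1 - c * d * A - tau%:C ^+ 2 * c) * F z + - (c * d) * F z ^+ 2 =
  (A + F z) * (1 - c * d * F z) - tau%:C * (c * F z * tau%:C) by ring.
by rewrite A1 -YF; ring.
Qed.

Lemma accretive_regular : accretive a q Th.
Proof.
have [A0 B0 C0] := small_roots_all regular_small_roots.
have gk : gamma - kap * tau ^+ 2 = 0 by apply: complexI.
have xiE : xi = theta.
  apply/eqP; rewrite eq_sym -subr_eq0; apply/eqP/(@complexI R).
  (* With [A = 0], the middle coefficient gives [tau^2 * c = 1]; hence [c != 0], and the last one
     forces [theta = xi]. *)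
  move: B0; rewrite A0 mulr0 subr0 => /eqP; rewrite subr_eq0 => /eqP tc.
  have c0 : c != 0 by apply/eqP => c0; move/eqP: tc; rewrite c0 mulr0 oner_eq0.
  by apply: (mulfI c0); rewrite mulr0; apply/eqP; rewrite -oppr_eq0; apply/eqP.
have kap0 : 0 <= kap.
  have t2 : 0 < tau ^+ 2 by rewrite exprn_even_gt0.
  by rewrite -(pmulr_lge0 _ t2); move: gamma0 gk; lra.
move=> Y; rewrite ReAE xiE.
have -> : bdata theta Y = w Y by [].
have -> : ipa a (lexpr Y) Y - w Y * (Y a - kap%:C * w Y)^*%C =
    (ipa a (lexpr Y) Y - w Y * (Y a)^*%C) + kap%:C * (w Y * (w Y)^*%C).
  rewrite (conjcB (Y a)) (conjcM kap%:C) conjc_real; ring.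
by rewrite addr_ge0// mul_conjc -rmorphM ler0c mulr_ge0// sqr_ge0.
Qed.

End RegularCase.

(* This is [mu = Re h], where the boundary condition of [Re A] is [y a = 0]. *)
Section SingularCase.
Variables (xi tau : R).
Hypothesis tau0 : tau != 0.
Hypothesis ReAE : forall Y Z, sys_ReA Th Y Z =
  ipa a (lexpr Y) Z + Y a * (bdata xi Z)^*%C.
Hypothesis gE : forall Z, sys_g Th Z = - tau%:C * (bdata xi Z)^*%C.

(** Here elimination leaves the constant term [tau^2], which [small_roots0] would force to be 0. *)
Lemma singular_absurd : False.
Proof.
have tauC : tau%:C != 0 :> R[i] by rewrite fmorph_eq0.
suff /small_roots0/eqP : small_roots (tau%:C ^+ 2)
    (c * gamma%:C - tau%:C ^+ 2 * (theta - xi)%:C * c) c.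
  by rewrite sqrf_eq0 (negbTE tauC).
move=> e /F_small[z z0 Fe]; have [Y [YW VY]] := V_real z0.
have [lY YE] : aeqa a (lexpr Y) (fun x => z * Y x) /\
    forall W, ipa a (lexpr Y) W = z * ipa a Y W.
  apply: (realized_eigen _ _ YW) => W Wa W'a; first rewrite ReAE; last rewrite gE;
  by rewrite /bdata Wa W'a !mulr0 subrr conjc0 mulr0 ?addr0.
have [W [Wa wW]] := data_surj 0 1.
have Ya : Y a = - tau%:C.
  have := YW W; rewrite ReAE /sys_K gE YE bdata_w Wa wW mulr0 addr0 conjc1 !mulr1 mul1r.
  by rewrite addrAC subrr add0r.
have VF : gamma%:C + F z = - tau%:C * (w Y + (theta - xi)%:C * Y a).
  by rewrite -VE// VY /sys_Kadj gE conjcM conjcK conjcN conjc_real bdata_w.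
have Yaw := eigen z0 lY; have cwF : c * w Y * F z = tau%:C.
  by rewrite -[RHS]opprK -Ya Yaw; ring.
have F0 : F z != 0 by apply/eqP => F0; move: tauC; rewrite -cwF F0 mulr0 eqxx.
exists (F z); split => //; rewrite Ya in VF.
have -> : tau%:C ^+ 2 + (c * gamma%:C - tau%:C ^+ 2 * (theta - xi)%:C * c) * F z + c * F z ^+ 2 =
  c * F z * (gamma%:C + F z) + tau%:C * tau%:C - tau%:C ^+ 2 * (theta - xi)%:C * c * F z by ring.
rewrite VF; transitivity (tau%:C * (tau%:C - c * w Y * F z)); first by ring.
by rewrite cwF subrr mulr0.
Qed.

End SingularCase.

Lemma accretive_system : accretive a q Th.
Proof.
set h := sys_h Th; have b0 : 0 < complex.Im h := sys_hP Th.
have s0 : Num.sqrt (complex.Im h) != 0 by rewrite gt_eqF// sqrtr_gt0.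
(* The conjugate of [h] becomes a variable, so that the identities below are rational in [h] and
   [k]. *)
have [k kE] : exists k, h^*%C = k by exists (h^*%C).
have alE : (complex.Re h)%:C = (h + k) / 2 by rewrite ReJ_add kE.
have infty_case (s : R) : s != 0 -> (forall Z, sys_channel Th Z = (Z a)^*%C) ->
    (forall Z, sys_g Th Z = s%:C * (Z a)^*%C) -> accretive a q Th.
  move=> sn0 chE gE; apply: (@accretive_regular (complex.Re h) 0 s sn0) => [Y Z|Z].
    rewrite sys_ReAE !chE /bform mul0r subr0 /bdata alE -/h.
    rewrite conjcM conjcK conjcB conjcM kE.
    by field.
  by rewrite gE mul0r subr0.
case muE : (sys_mu Th) => [m| |].
- have chE Z : sys_channel Th Z =
      (m%:C - h)^-1 * (m%:C * (Z a)^*%C - (dval' Z a)^*%C) by rewrite /sys_channel muE.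
  set s := Num.sqrt (complex.Im h) in s0; set n := normc (m%:C - h).
  have gE Z : sys_g Th Z = (s / n)%:C * (m%:C * (Z a)^*%C - (dval' Z a)^*%C).
    by rewrite /sys_g muE.
  have mh : m%:C - h != 0.
    by apply/eqP => /(congr1 (@complex.Im R)); rewrite !ReImE/= add0r; lra.
  have mk : m%:C - k != 0.
    by rewrite -kE; apply/eqP => /(congr1 (@complex.Im R)); rewrite !ReImE/= add0r; lra.
  have chJ Z : (sys_channel Th Z)^*%C = (m%:C - k)^-1 * (m%:C * Z a - dval' Z a).
    rewrite chE conjcM conjc_inv (conjcB m%:C) conjc_real kE conjcB conjcK.
    by rewrite conjcM conjcK conjc_real.
  have ReE Y Z : sys_ReA Th Y Z = ipa a (lexpr Y) Z -
      2^-1 * (dval' Y a * (Z a)^*%C - Y a * (dval' Z a)^*%C) -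
      2^-1 * ((dval' Y a - h * Y a) *
        ((m%:C - h)^-1 * (m%:C * (Z a)^*%C - (dval' Z a)^*%C)) +
        ((dval' Z a)^*%C - k * (Z a)^*%C) * ((m%:C - k)^-1 * (m%:C * Y a - dval' Y a))).
    by rewrite sys_ReAE (conjcM (_ - _)) chJ chE (conjcB (dval' Z a)) (conjcM h) kE.
  have n0 : n != 0 by rewrite normc_eq0.
  have [p0|p0] := eqVneq m (complex.Re h).
    exfalso; apply: (@singular_absurd m (s / n)) => [|Y Z|Z].
    + by rewrite mulf_neq0// invr_eq0.
    + have mE : m%:C = (h + k) / 2 by rewrite p0.
      have kh : k - h != 0.
        apply/eqP => E; move/eqP: mh; apply; rewrite mE -[RHS](mulr0 (2^-1)) -E; by field.
      have hk : h - k != 0 by rewrite -opprB oppr_eq0.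
      rewrite ReE conj_bdata mE; move: (ipa _ _ _) (Y a) (dval' Y a) => I0 y y'.
      move: (Z a)^*%C (dval' Z a)^*%C => z z'; field.
      apply/andP; split; [move: hk|move: kh]; apply: contra => /eqP E; apply/eqP;
      by rewrite -E; ring.
    + by rewrite gE conj_bdata; ring.
  pose p := m - complex.Re h; pose N := p ^+ 2 + complex.Im h ^+ 2.
  have pn0 : p != 0 by rewrite subr_eq0.
  have N0 : N != 0 by rewrite gt_eqF// ltr_wpDl ?sqr_ge0// exprn_gt0.
  (* These values satisfy [1 / kap + xi = m], which makes [m * Z a - dval' Z a] a multiple of
     [Z a - kap * bdata xi Z]. *)
  pose xi := complex.Re h - complex.Im h ^+ 2 / p; pose kap := p / N.
  have pE : p%:C = m%:C - (h + k) / 2 by rewrite -alE -rmorphB.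
  have b2E : (complex.Im h ^+ 2)%:C = - (h - k) ^+ 2 / 4.
    transitivity ((complex.Im h)%:C ^+ 2); first by rewrite -rmorphXn.
    by rewrite (ImJ_sub h) kE exprMn sqr_i; field.
  have pC : p%:C != 0 :> R[i] by rewrite fmorph_eq0.
  have NE : N%:C = (m%:C - h) * (m%:C - k).
    transitivity (p%:C ^+ 2 + (complex.Im h ^+ 2)%:C); first by rewrite -rmorphXn -rmorphD.
    by rewrite b2E pE; field.
  have kapE : kap%:C = p%:C / ((m%:C - h) * (m%:C - k)) by rewrite -NE -fmorphV -rmorphM.
  have xiE : xi%:C = (h + k) / 2 + (h - k) ^+ 2 / 4 / p%:C.
    transitivity ((complex.Re h)%:C - (complex.Im h ^+ 2)%:C / p%:C).
      by rewrite -fmorphV -rmorphM -rmorphB.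
    by rewrite alE b2E; field.
  have kap0 : kap != 0 by rewrite mulf_neq0// invr_eq0.
  (* In these variables every denominator is a product of [d1], [d2] and [d1 + d2 = 2 p]. *)
  have [d1 d1E] : exists d1, m%:C - h = d1 by exists (m%:C - h).
  have [d2 d2E] : exists d2, m%:C - k = d2 by exists (m%:C - k).
  have hE : h = m%:C - d1 by rewrite -d1E; ring.
  have k2E : k = m%:C - d2 by rewrite -d2E; ring.
  have d12 : d1 + d2 != 0.
    apply: contraNN pC => /eqP E; have -> : p%:C = (d1 + d2) / 2 by rewrite pE hE k2E; field.
    by rewrite E mul0r.
  rewrite d1E in mh; rewrite d2E in mk.
  apply: (@accretive_regular xi kap (s / n / kap)) => [|Y Z|Z].
  + by rewrite !mulf_neq0// invr_eq0.
  + rewrite ReE (conjcB (Z a)) (conjcM kap%:C) conjc_real conj_bdata /bdata.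
    rewrite xiE kapE pE hE k2E; move: (ipa _ _ _) (Y a) (dval' Y a) => I0 y y'.
    move: (Z a)^*%C (dval' Z a)^*%C => z z'.
    field; apply/and3P; split; [move: d12|move: mk|move: mh];
    by apply: contra => /eqP E; apply/eqP; rewrite -E; ring.
  + rewrite gE (conjcB (Z a)) (conjcM kap%:C) conjc_real conj_bdata.
    have -> : (s / n / kap)%:C = (s / n)%:C / kap%:C by rewrite -fmorphV -rmorphM.
    rewrite xiE kapE pE hE k2E; move: (s / n)%:C => sn.
    move: (Z a)^*%C (dval' Z a)^*%C => z z'.
    field; apply/and3P; split; [move: d12|move: mk|move: mh];
    by apply: contra => /eqP E; apply/eqP; rewrite -E; ring.
- by apply: infty_case s0 _ _ => Z; rewrite /sys_channel /sys_g muE.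
- apply: (infty_case (- Num.sqrt (complex.Im h))) => [|Z|Z].
  + by rewrite oppr_eq0.
  + by rewrite /sys_channel muE.
  + by rewrite /sys_g muE rmorphN mulNr.
Qed.

End System.

(** * The Krein-von Neumann and Friedrichs extensions *)

Section Extensions.
Context {R : realType} (a : R) (q : R -> R) (theta : R).
Local Notation mu := (@lebesgue_measure R).
Local Notation H := `[a, +oo[%classic.
Local Notation Dst := (Dstar a q).
Local Notation mH := (measurable_halfline a).
Local Notation w := (wdata theta).
Local Notation Bt := (Btilde a q).
Local Notation Bth := (Btheta a q theta).
Implicit Types (X Y Z W : Dst).

Hypothesis B_symmetric : symmetric_op mu H Bt.
Hypothesis B_deficiency : deficiency_indices_1_1 mu H Bt.
Hypothesis Btheta_positive : nonneg_sa_extension mu H Bt Bth.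
Hypothesis form_nonneg : forall Y, 0 <= ipa a (lexpr Y) Y - w Y * (Y a)^*%C.
Hypothesis adjoint_max : forall z g, adjoint mu H Bt z g ->
  exists Y, aeqa a z Y /\ aeqa a g (lexpr Y).

Let data_surj := exists_data B_deficiency Btheta_positive.
Let same_data := aeq_data B_symmetric B_deficiency Btheta_positive.
Let green := greenE B_symmetric.

Definition dirichlet := schrodinger_op a q (fun u _ => u = 0).

Lemma schrodinger_op_Dst bc Y : bc (Y a) (dval' Y a) ->
  schrodinger_op a q bc Y (lexpr Y).
Proof.
move=> bY; split; [exact: dstar_L2|exact: dstar_lL2|].
by exists Y; split => //; exact: aeq_refl.
Qed.

Lemma ip_Dst y f z g Y Z : L2a a y -> L2a a f -> L2a a z -> L2a a g ->
  aeqa a y Y -> aeqa a f (lexpr Y) -> aeqa a z Z -> aeqa a g (lexpr Z) ->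
  ip mu H f z = ipa a (lexpr Y) Z /\ ip mu H y g = ipa a Y (lexpr Z).
Proof.
move=> Ly Lf Lz Lg yY fY zZ gZ; split; apply: (ip_aeq mH) => //;
  by [exact: dstar_L2|exact: dstar_lL2].
Qed.

Lemma ipa_green Y Z : bform Y Z = 0 -> ipa a (lexpr Y) Z = ipa a Y (lexpr Z).
Proof. by rewrite -green /gform => /eqP; rewrite subr_eq0 => /eqP. Qed.

Lemma densely_definedS (S T : operator) : extends S T ->
  densely_defined mu H T -> densely_defined mu H S.
Proof.
move=> ST dT f Lf e e0; have [y [g [Tyg fy]]] := dT f Lf e e0.
by exists y, g; split => //; exact: ST.
Qed.

Lemma adjointS (S T : operator) : extends S T -> extends (adjoint mu H T) (adjoint mu H S).
Proof. by move=> ST z g [Lz Lg zg]; split => // y f /ST; exact: zg. Qed.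

Lemma dirichlet_extends : extends dirichlet Bt.
Proof.
by move=> y f [Ly Lf [Y [[Ya _] yY fY]]]; split => //; exists Y.
Qed.

(** The adjoint lies in the maximal operator, and Green's formula against an element with data 0 and
    1 forces [Z a = 0]. Nonnegativity is [form_nonneg] without its boundary term. *)
Lemma dirichlet_nonneg_sa : nonneg_sa_extension mu H Bt dirichlet.
Proof.
split; last exact: dirichlet_extends.
- split; first by apply: densely_definedS dirichlet_extends _; case: B_symmetric.
  move=> z g; split=> [[Lz Lg [Z [Za zZ gZ]]]|Az].
    split => // y f [Ly Lf [Y [Ya yY fY]]].
    have [-> ->] := ip_Dst Ly Lf Lz Lg yY fY zZ gZ.
    by apply: ipa_green; rewrite /bform Za Ya conjc0; ring.
  have [Z [zZ gZ]] := adjoint_max (adjointS dirichlet_extends Az).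
  have [Lz Lg zg] := Az; split => //; exists Z; split => //.
  have [Y [Ya wY]] := data_surj 0 1.
  have := zg _ _ (schrodinger_op_Dst (bc := fun u _ => u = 0) Ya).
  have [-> ->] := ip_Dst (dstar_L2 Y) (dstar_lL2 Y) Lz Lg (aeq_refl _ _ _) (aeq_refl _ _ _) zZ gZ.
  move=> /eqP; rewrite -subr_eq0 => /eqP E.
  have := green Y Z; rewrite /gform E (bform_wdata theta) Ya wY mul0r subr0 mul1r.
  by move=> /esym/eqP; rewrite conjc_eq0 => /eqP.
- move=> y f [Ly Lf [Y [Ya yY fY]]].
  have [-> _] := ip_Dst Ly Lf Ly Lf yY fY yY fY.
  by have := form_nonneg Y; rewrite Ya conjc0 mulr0 subr0.
Qed.

Variable e : Dst.
Hypothesis we : w e = 1.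
Hypothesis le : aeqa a (lexpr e) (fun x => (-1) * e x).

Let ip_le Y : ipa a (lexpr e) Y = - ipa a e Y.
Proof.
rewrite /ipa (ip_aeq mH (dstar_lL2 e) (L2Z mH _ (dstar_L2 e))
  (dstar_L2 Y) (dstar_L2 Y) le (aeq_refl _ _ _)).
by rewrite (ipZl mH _ (dstar_L2 e) (dstar_L2 Y)) mulN1r.
Qed.

Let e_neq0 : sqnorm mu H e != 0.
Proof.
apply/eqP => /(sqnorm_eq0 mH (dstar_L2 e)) e0.
have [_ _] := aeq0_data B_symmetric B_deficiency Btheta_positive e0.
by rewrite we => /eqP; rewrite oner_eq0.
Qed.

Let ea_neq0 : e a != 0.
Proof.
apply: contraNN e_neq0 => /eqP ea; have := form_nonneg e.
rewrite ea conjc0 mulr0 subr0 ip_le /ipa (ip_self _ mH) -rmorphN ler0c oppr_ge0 => h.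
by rewrite eq_le h sqnorm_ge0.
Qed.

Let ea_real : (e a)^*%C = e a.
Proof.
have := green e e; rewrite (bform_wdata theta) we conjc1 mulr1 mul1r /gform ip_le.
have -> : ipa a e (lexpr e) = - ipa a e e.
  rewrite /ipa (ip_conj mH (dstar_lL2 e) (dstar_L2 e)) -/(ipa a _ _) ip_le conjcN.
  by rewrite /ipa -(ip_conj mH (dstar_L2 e) (dstar_L2 e)).
by rewrite opprK addNr => /esym/eqP; rewrite subr_eq0 => /eqP.
Qed.

(** As [(l + 1) e = 0], Green's formula expresses [(e, (l + 1) Y)] by boundary data. *)
Let ip_resolvent Y (c : R[i]) f : L2a a f -> aeqa a f (fun x => lexpr Y x + Y x) ->
  ip mu H (Dlin (- c) e Y) f = - c * (e a * (w Y)^*%C - (Y a)^*%C) + ip mu H Y f.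
Proof.
move=> Lf fE; rewrite (ip_linl mH _ (dstar_L2 e) (dstar_L2 Y) Lf); congr (_ * _ + _).
have Lg : L2 mu H (fun x => 1 * lexpr Y x + Y x).
  exact: (L2_lin mH 1 (dstar_lL2 Y) (dstar_L2 Y)).
have fE' : aeqa a f (fun x => 1 * lexpr Y x + Y x).
  by apply: (aeq_trans fE); apply: aeq_eq => x _; rewrite mul1r.
have Le := dstar_L2 e.
rewrite (ip_aeq mH Le Le Lf Lg (aeq_refl _ _ _) fE').
rewrite (ip_linr mH 1 (dstar_lL2 Y) (dstar_L2 Y) Le) conjc1 mul1r.
have := green e Y; rewrite (bform_wdata theta) we mul1r /gform ip_le /ipa => E.
by apply/eqP; rewrite -subr_eq0; apply/eqP; rewrite -[RHS](subrr (e a * (w Y)^*%C - (Y a)^*%C));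
  rewrite -{1}[(Y a)^*%C](subrK (e a * (w Y)^*%C)) -E; ring.
Qed.

(** The functions [Y - c * e] all solve [(l + 1) X = f]; a boundary condition picks [c] and thereby
    the resolvent at -1 of the corresponding operator. *)
Lemma resolvent_Dst bc (c : R[i]) Y f : L2a a f ->
  aeqa a f (fun x => lexpr Y x + Y x) ->
  bc (Dlin (- c) e Y a) (dval' (Dlin (- c) e Y) a) ->
  schrodinger_op a q bc (Dlin (- c) e Y) (fun x => f x - 1%:C * Dlin (- c) e Y x).
Proof.
move=> Lf fE bY; set X := Dlin _ _ _ in bY *; split; first exact: dstar_L2.
  have := L2_lin mH (- 1%:C) (dstar_L2 X) Lf.
  by congr (L2 _ _); apply/funext => x; ring.
exists X; split => //; first exact: aeq_refl.
move: fE le; apply: (@filterS2 _ _ (ae_filter_ringOfSetsType mu)) => x E1 E2 Hx.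
by rewrite E1// /X lexpr_Dlin E2//=; ring.
Qed.

Lemma adjoint_lin T (c : R[i]) y f z g : adjoint mu H T y f -> adjoint mu H T z g ->
  (forall x h, T x h -> L2 mu H x /\ L2 mu H h) ->
  adjoint mu H T (fun x => c * y x + z x) (fun x => c * f x + g x).
Proof.
move=> [Ly Lf yf] [Lz Lg zg] TL; split; [exact: (L2_lin mH)|exact: (L2_lin mH)|].
move=> x h Txh; have [Lx Lh] := TL _ _ Txh.
by rewrite !(ip_linr mH)// (yf _ _ Txh) (zg _ _ Txh).
Qed.

(* A common extremal extension would have the same resolvent form at [-1] as
   [Btheta] and as the Dirichlet operator, which forces it into [Btilde]. *)
Lemma no_extremal_extension S : nonneg_sa_extension mu H Bt S ->
  (forall S', nonneg_sa_extension mu H Bt S' -> op_le mu H S S') ->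
  (forall S', nonneg_sa_extension mu H Bt S' -> op_le mu H S' S) -> False.
Proof.
move=> [[_ saS] nnS SBt] minS maxS.
have SL x h : S x h -> L2 mu H x /\ L2 mu H h by move=> /saS[].
have S0 s g : S s g -> exists Y, [/\ aeqa a s Y, aeqa a g (lexpr Y), Y a = 0 & w Y = 0].
  move=> Ssg; have [Ls Lg] := SL _ _ Ssg.
  have [Y [sY gY]] := adjoint_max (adjointS SBt (proj1 (saS _ _) Ssg)).
  pose f x := 1 * g x + s x.
  have Lf : L2a a f by exact: (L2_lin mH).
  have fE : aeqa a f (fun x => lexpr Y x + Y x).
    move: sY gY; apply: (@filterS2 _ _ (ae_filter_ringOfSetsType mu)) => x E1 E2 Hx.
    by rewrite /f E1// E2// mul1r.
  have Sf : S s (fun x => f x - 1%:C * s x).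
    by move: Ssg; congr (S _ _); apply/funext => x; rewrite /f; ring.
  have same bc c : nonneg_sa_extension mu H Bt (schrodinger_op a q bc) ->
      bc (Dlin (- c) e Y a) (dval' (Dlin (- c) e Y) a) ->
      ip mu H (Dlin (- c) e Y) f = ip mu H s f.
    move=> bcS bY; have rS := resolvent_Dst Lf fE bY.
    apply/eqP; rewrite eq_le.
    by rewrite (minS _ bcS 1 f _ _ ltr01 Sf rS) (maxS _ bcS 1 f _ _ ltr01 rS Sf).
  (* [Y - w Y * e] satisfies the condition of [Btheta], and [Y - (Y a / e a) * e] that of
     [dirichlet]. *)
  have := same _ (w Y) Btheta_positive; have := same _ (Y a / e a) dirichlet_nonneg_sa.
  rewrite !ip_resolvent// => <-; last first.
    by rewrite /=; field.
  move=> /(_ _)/addIr E.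
  have {}E : w Y * (e a * (w Y)^*%C - (Y a)^*%C) =
      Y a / e a * (e a * (w Y)^*%C - (Y a)^*%C).
    apply: oppr_inj; rewrite -(mulNr (w Y)) -(mulNr (Y a / e a)); apply: E.
    have := wdata_Dlin theta (- w Y) e Y; rewrite we mulr1 addNr /wdata => /eqP.
    by rewrite subr_eq0 => /eqP.
  (* Since [e a] is real, the equality of the two forms says [|e a * w Y - Y a|^2 = 0]. *)
  have Ya : Y a = e a * w Y.
    apply/eqP; rewrite eq_sym -subr_eq0.
    have : (e a * w Y - Y a) * (e a * w Y - Y a)^*%C = 0.
      rewrite conjcB (conjcM (e a)) ea_real.
      have -> : (e a * w Y - Y a) * (e a * (w Y)^*%C - (Y a)^*%C) =
        e a * (w Y * (e a * (w Y)^*%C - (Y a)^*%C)) - Y a * (e a * (w Y)^*%C - (Y a)^*%C) by ring.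
      by rewrite E; field.
    by move/eqP; rewrite mulf_eq0 conjc_eq0 orbb.
  (* [X] has zero data, so it belongs to [Btilde] and to [S]. The difference [s - X = w Y * e] is
     then in [S] with eigenvalue -1, and nonnegativity forces [w Y = 0]. *)
  pose X := Dlin (- w Y) e Y.
  have BX : Bt X (lexpr X).
    apply/(Btilde_data B_symmetric B_deficiency Btheta_positive).
    by rewrite wdata_Dlin we /= Ya; split; ring.
  have SX := SBt _ _ BX.
  have /saS SD := adjoint_lin (-1) (proj1 (saS _ _) SX) (proj1 (saS _ _) Ssg) SL.
  have := nnS _ _ SD; have [LD1 LD2] := SL _ _ SD.
  have D1 : aeqa a (fun x => -1 * X x + s x) (fun x => w Y * e x).
    by apply: (@filterS _ _ (ae_filter_ringOfSetsType mu)) sY => x E1 Hx; rewrite E1//=; ring.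
  have D2 : aeqa a (fun x => -1 * lexpr X x + g x) (fun x => - w Y * e x).
    move: gY le; apply: (@filterS2 _ _ (ae_filter_ringOfSetsType mu)) => x E1 E2 Hx.
    by rewrite E1// lexpr_Dlin E2//; ring.
  have Le := dstar_L2 e.
  rewrite (ip_aeq mH LD2 (L2Z mH _ Le) LD1 (L2Z mH _ Le) D2 D1).
  rewrite (ipZl mH _ Le (L2Z mH _ Le)) (ipZr mH _ Le Le) (ip_self _ mH).
  rewrite mulrA mulNr mul_conjc -rmorphN -rmorphM ler0c mulNr oppr_ge0 => h.
  have wY0 : w Y = 0.
    apply/eqP; rewrite -normc_eq0 -sqrf_eq0; apply/eqP.
    have h2 : 0 < sqnorm mu H e by rewrite lt_neqAle eq_sym e_neq0 sqnorm_ge0.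
    by apply/eqP; rewrite eq_le sqr_ge0 andbT -(pmulr_lle0 _ h2).
  by exists Y; split => //; rewrite Ya wY0 mulr0.
(* Elements of [S] have zero data, so Green's formula puts [Y0] in the adjoint of [S], which is [S],
   although [Y0 a = 1]. *)
have [Y0 [Y0a wY0]] := data_surj 1 0.
have /S0[Y [YE _ Ya _]] : S Y0 (lexpr Y0).
  apply/saS; split; [exact: dstar_L2|exact: dstar_lL2|] => s g Ssg.
  have [Ls Lg] := SL _ _ Ssg; have [Y [sY gY Ya wY]] := S0 _ _ Ssg.
  have [-> ->] := ip_Dst Ls Lg (dstar_L2 Y0) (dstar_lL2 Y0) sY gY (aeq_refl _ _ _) (aeq_refl _ _ _).
  by apply: ipa_green; rewrite (bform_wdata theta) wY Ya; ring.
have [_ E _] := same_data YE; move/eqP: Y0a.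
by rewrite E Ya eq_sym oner_eq0.
Qed.

End Extensions.

Theorem theorem5p9 (R : realType) (a : R) (q : R -> R)
    (q_summable : locally_summable a q)
    (B_symmetric : symmetric_op lebesgue_measure `[a, +oo[ (Btilde a q))
    (B_deficiency :
       deficiency_indices_1_1 lebesgue_measure `[a, +oo[ (Btilde a q))
    (theta : R)
    (Btheta_positive :
       nonneg_sa_extension lebesgue_measure `[a, +oo[
         (Btilde a q) (Btheta a q theta))
    (V : R[i] -> R[i]) (gamma : R) (sigma : nondecr_halfline R)
    (V_S0 : class_S0 V gamma sigma)
    (sigma_distr : distribution_function a q theta sigma)
    (Theta : @schrodinger_system R)
    (Theta_realizes : realizes a q Theta V) :
  accretive a q Theta /\
  (forall AK AF : operator,
     krein_von_neumann lebesgue_measure `[a, +oo[ (Btilde a q) AK ->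
     friedrichs lebesgue_measure `[a, +oo[ (Btilde a q) AF ->
     AK <> AF).
Proof.
have [gamma0 M_fin _ VE] := V_S0.
have [U [U_iso U_theta U_tilde]] := sigma_distr.
have [rho rho0 rhoP] := exists_rho B_symmetric B_deficiency Btheta_positive M_fin
  U_iso U_theta U_tilde.
have form_nonneg := form_ge0 B_symmetric B_deficiency Btheta_positive M_fin
  U_iso U_theta rhoP.
split.
  apply: (accretive_system B_symmetric (exists_data B_deficiency Btheta_positive)
    form_nonneg (c := rho * rho^*%C)
    (F := fun z => cintegral (stieltjes_measure sigma) `[0, +oo[ (fun t => (t%:C - z)^-1)%C)
    _ _ _ gamma0 _ Theta_realizes).
  - move=> z Y z0 lY.
    exact: (eigen_data B_symmetric B_deficiency Btheta_positive M_fin U_iso U_theta rhoP).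
  - move=> z Y z0 lY.
    exact: (eigen_nonzero B_symmetric B_deficiency Btheta_positive z0 lY).
  - by move=> e e0; exact: resolvent_small.
  - move=> z z0; apply: VE; apply: contra z0 => /ger0_Im ->; exact: eqxx.
have [e [we le]] := exists_eigen_m1 B_symmetric B_deficiency Btheta_positive M_fin
  U_iso U_theta rho0 rhoP.
move=> AK AF [AKS minAK] [_ maxAF] AKF; subst AF.
apply: (no_extremal_extension B_symmetric B_deficiency Btheta_positive form_nonneg
  _ we le AKS minAK maxAF).
exact: (adjoint_Btilde B_symmetric B_deficiency Btheta_positive M_fin U_iso U_theta rho0 rhoP).
Qed.
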